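(* Let $n\ge 3$ be an integer and let $\Theta$ be a constant with $(n-2)\pi/2\le\Theta<n\pi/2$. Let $u\in C^\infty(B_2(0))$, $B_2(0)\subset\mathbb{R}^n$, solve the special Lagrangian equation $$\sum_{i=1}^n\arctan\lambda_i(D^2u(x))=\Theta\qquad\text{for all }x\in B_2(0).$$ Let $$a_1(D^2u)=\exp\Big(M\ln\sqrt{1+\lambda_1^2}\Big),\qquad M=1-\frac{4}{\sqrt{4n+1}+1},$$ where $\lambda_1=\lambda_1(D^2u)$ is the largest eigenvalue of $D^2u$. Then for any $y\in B_{1/2}(0)$ and $0<r<1/4$, $$\sup_{B_{1/4}(y)}a_1(D^2u)\le C\big(r,n,\|u\|_{C^{0,1}(B_1(0))}\big)\sup_{B_r(y)}a_1(D^2u),$$ and moreover $$\sup_{B_{1/4}(y)}|D^2u|\le C\Big(r,n,\|u\|_{C^{0,1}(B_1(0))},\sup_{B_r(y)}|D^2u|\Big).$$ Here the two constants $C$ (which may differ) depend only on the indicated quantities.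
   Context: $B_r(p)$ denotes the open Euclidean ball of radius $r$ centred at $p$ in $\mathbb{R}^n$. $\lambda_1(M)\ge\cdots\ge\lambda_n(M)$ denote the ordered eigenvalues, with multiplicity, of a real symmetric matrix $M$. $D^2u$ is the Hessian matrix of $u$. $\|u\|_{C^{0,1}(B_1(0))}$ is the usual Lipschitz norm, i.e. $\sup_{B_1(0)}|u|$ plus the Lipschitz constant of $u$ on $B_1(0)$. *)

(* Defs.v *)
From HB Require Import structures.
From mathcomp Require Import all_boot all_order all_algebra.
From mathcomp Require Import all_classical all_reals all_analysis.

Set Implicit Arguments.
Unset Strict Implicit.
Unset Printing Implicit Defensive.

Import Order.TTheory GRing.Theory Num.Theory.
Import numFieldNormedType.Exports.

Local Open Scope classical_set_scope.
Local Open Scope ring_scope.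

(* The library's norm `|A| on matrices (and its ball) is the max norm, so the
   Euclidean norm is defined here; on a square matrix it is the Frobenius
   norm. The two norms induce the same topology, so the library's limits,
   continuity and derivatives on 'rV[R]_n are the usual ones. *)
Definition l2norm (R : realType) (m n : nat) (A : 'M[R]_(m, n)) : R :=
  Num.sqrt (\sum_(i < m) \sum_(j < n) A i j ^+ 2).

Definition eball (R : realType) (n : nat) (p : 'rV[R]_n) (r : R) :
    set 'rV[R]_n :=
  [set x | l2norm (x - p) < r].

Definition esup (R : realType) (T : Type) (A : set T) (f : T -> R) : \bar R :=
  ereal_sup [set (f x)%:E | x in A].

Definition partial (R : realType) (n : nat) (i : 'I_n)
    (u : 'rV[R]_n -> R) : 'rV[R]_n -> R :=
  fun x => 'D_(delta_mx 0 i) u x.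

(* partials [:: i1; ...; ik] u = d_i1 (... (d_ik u)) *)
Definition partials (R : realType) (n : nat) (s : seq 'I_n)
    (u : 'rV[R]_n -> R) : 'rV[R]_n -> R :=
  foldr (@partial R n) u s.

(* C^oo on U, for U open: the values of u outside U are then irrelevant. *)
Definition smooth_on (R : realType) (n : nat) (U : set 'rV[R]_n)
    (u : 'rV[R]_n -> R) : Prop :=
  forall (s : seq 'I_n) (x : 'rV[R]_n), U x ->
    {for x, continuous (partials s u)} /\
    forall i : 'I_n, derivable (partials s u) x (delta_mx 0 i).

Definition hessian (R : realType) (n : nat) (u : 'rV[R]_n -> R)
    (x : 'rV[R]_n) : 'M[R]_n :=
  \matrix_(i, j) partials [:: i; j] u x.

(* The eigenvalues of M with multiplicity in nonincreasing order; such a list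
   exists for symmetric M, and is unique. (It is [::] if the characteristic
   polynomial of M does not split over R.) *)
Definition eigenvalues (R : realType) (n : nat) (M : 'M[R]_n) : seq R :=
  xget [::] [set s : seq R |
    sorted >=%R s /\ char_poly M = \prod_(a <- s) ('X - a%:P)].

(* Counted from 0: the largest eigenvalue is lambda M 0. *)
Definition lambda (R : realType) (n : nat) (M : 'M[R]_n) (i : nat) : R :=
  (eigenvalues M)`_i.

Definition special_lagrangian_on (R : realType) (n : nat)
    (U : set 'rV[R]_n) (Theta : R) (u : 'rV[R]_n -> R) : Prop :=
  forall x, U x -> \sum_(i < n) atan (lambda (hessian u x) i) = Theta.

Definition a1 (R : realType) (n : nat) (H : 'M[R]_n) : R :=
  let M := 1 - 4 / (Num.sqrt (4 * n%:R + 1) + 1) in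
  expR (M * ln (Num.sqrt (1 + lambda H 0 ^+ 2))).

Definition lipschitz_const (R : realType) (n : nat) (U : set 'rV[R]_n)
    (u : 'rV[R]_n -> R) : \bar R :=
  esup [set p : 'rV[R]_n * 'rV[R]_n | [/\ U p.1, U p.2 & p.1 != p.2]]
    (fun p => `|u p.1 - u p.2| / l2norm (p.1 - p.2)).

Definition C01norm (R : realType) (n : nat) (U : set 'rV[R]_n)
    (u : 'rV[R]_n -> R) : \bar R :=
  (esup U (fun x => `|u x|%R) + lipschitz_const U u)%E.

(* Main.v *)
Require Import Defs.
From HB Require Import structures.
From mathcomp Require Import all_boot all_order all_algebra.
From mathcomp Require Import all_classical all_reals all_analysis.
From mathcomp Require Import ring lra.
Set Implicit Arguments.
Unset Strict Implicit.
Unset Printing Implicit Defensive.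
Import Order.TTheory GRing.Theory Num.Theory.
Import numFieldNormedType.Exports.
Local Open Scope classical_set_scope.
Local Open Scope ring_scope.

(** Let l_1 >= ... >= l_n be the eigenvalues of the Hessian of u, with an
  orthonormal eigenframe e_i at each point, and let
  L f = \sum_i (1 + l_i^2)^-1 f_(e_i e_i) be the linearised operator there. The
  estimates are a maximum principle: a positive function that is small where
  l_1 is large, and superharmonic for L, is compared with an explicit strict
  subsolution, the barrier.

  The phase. Since the sum of the angles pi/2 - atan l_i is at most pi, at most
  one eigenvalue is negative, l_i + l_j >= 0 for i <> j and l_n >= - l_1 / 2
  ([phase_pair], [phase_min_ge]); when l_n is very negative, the addition
  theorem for the tangent gives the sharper relation [phase_tan].

  Superharmonicity. Differentiating the equation once gives L (Du) = 0
  ([first_variation]); differentiating it twice expresses L u_(ee) by squares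
  of third derivatives ([second_variation]). At each point the largest
  eigenvalue is supported from below by a Rayleigh quotient at a slightly
  tilted top eigenvector ([upper_support]), so that
  m = (1 + l_1^2)^(-1/8), called [profile] of l_1, is supported from above by a
  function with explicit second derivatives. That L m <= 0 in this sense
  becomes an inequality for a quadratic form in the third derivatives
  ([jacobi_inequality]); its off-diagonal part is nonnegative by the phase
  bounds, and the diagonal part, restricted by L (Du) = 0, is nonnegative by
  the Cauchy-Schwarz inequality and [phase_tan].

  The barrier. With X = x - y, consider exp (K phi) - 1 for
  phi = 1/16 - |X|^2 / 2 - T (X . Du - u) + B |Du|^2 / 2. Here X . Du - u is the
  derivative of u under dilations, and |Du|^2 brings in the squares of the l_i.
  The third derivatives of u cancel by L (Du) = 0, leaving
  L phi = \sum_i (1 + l_i^2)^-1 (- 1 - T l_i + B l_i^2), while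
  phi_(e_i) = - X_i (1 + T l_i) + B l_i u_(e_i). For |X| >= r some X_i is not
  small, and then phi_(e_i)^2 is comparable with 1 + l_i^2 unless l_i is close
  to - 1 / T, so that a large K makes the barrier a strict subsolution. In the
  exceptional case all the other eigenvalues are at least 1 / (2 T), and L phi is
  already positive ([barrier_positive]). The constants T, B and K depend on n,
  on r and on a bound for u and Du only.

  Conclusion. On the ball of radius 1/2 about y take the minimum of
  m - delta * barrier, with delta chosen so that it is positive for |X| < r. For
  |X| = 1/2 it is positive since the barrier is negative there, and a minimum
  with r <= |X| < 1/2 would contradict the second derivative test
  ([no_interior_min]). So m is bounded below for |X| < 1/4, where the barrier
  is: 1 + l_1^2 <= C (1 + Lam^2) if l_1 <= Lam on the small ball
  ([eigenvalue_growth]). A power of this inequality is the first estimate, and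
  the second one follows since l_1 <= |D^2 u| <= sqrt n * l_1. *)

(** * Euclidean inner product and the spectral theorem *)

Definition dot (R : realType) (n : nat) (x y : 'rV[R]_n) : R :=
  (x *m y^T) 0 0.

Section Dot.
Variables (R : realType) (n : nat).
Implicit Types (x y z : 'rV[R]_n) (a : R).

Lemma dotE x y : dot x y = \sum_j x 0 j * y 0 j.
Proof. by rewrite /dot mxE; apply: eq_bigr => j _; rewrite mxE. Qed.

Lemma dotC x y : dot x y = dot y x.
Proof. by rewrite !dotE; apply: eq_bigr => j _; rewrite mulrC. Qed.

Lemma dotDl x y z : dot (x + y) z = dot x z + dot y z.
Proof. by rewrite /dot mulmxDl mxE. Qed.

Lemma dotDr x y z : dot x (y + z) = dot x y + dot x z.
Proof. by rewrite dotC dotDl !(dotC x). Qed.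

Lemma dotZl a x y : dot (a *: x) y = a * dot x y.
Proof. by rewrite /dot -scalemxAl mxE. Qed.

Lemma dotZr a x y : dot x (a *: y) = a * dot x y.
Proof. by rewrite dotC dotZl dotC. Qed.

Lemma dot_ge0 x : 0 <= dot x x.
Proof. by rewrite dotE sumr_ge0 // => j _; rewrite -expr2 sqr_ge0. Qed.

Lemma dot_eq0 x : (dot x x == 0) = (x == 0).
Proof.
apply/eqP/eqP => [|->]; last by rewrite /dot mul0mx mxE.
rewrite dotE => /eqP; rewrite psumr_eq0 => [/allP h|j _]; last first.
  by rewrite -expr2 sqr_ge0.
apply/rowP => j; rewrite mxE; have /= := h j (mem_index_enum _).
by rewrite mulf_eq0 orbb => /eqP.
Qed.

Lemma l2norm_row x : l2norm x = Num.sqrt (dot x x).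
Proof. by rewrite /l2norm big_ord1 dotE. Qed.

End Dot.

Lemma dot_mulmx (R : realType) m n (x : 'rV[R]_m) (A : 'M[R]_(m, n)) y :
  dot (x *m A) y = dot x (y *m A^T).
Proof. by rewrite /dot trmx_mul trmxK mulmxA. Qed.

Lemma cvg_sumr (R : realType) (T : Type) (F : set_system T) {FF : Filter F}
    (I : Type) (r : seq I) (f : I -> T -> R) (l : I -> R) :
  (forall i, f i x @[x --> F] --> l i) ->
  (\sum_(i <- r) f i x) @[x --> F] --> \sum_(i <- r) l i.
Proof.
move=> h; elim: r => [|i r IH].
  by under eq_fun do rewrite big_nil; rewrite big_nil; exact: cvg_cst.
by under eq_fun do rewrite big_cons; rewrite big_cons; apply: cvgD.
Qed.

Lemma continuous_sumr (R : realType) (T : topologicalType) (I : Type)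
    (r : seq I) (f : I -> T -> R) (x : T) :
  (forall i, {for x, continuous (f i)}) ->
  {for x, continuous (fun y => \sum_(i <- r) f i y)}.
Proof. by move=> h; apply: (@cvg_sumr _ _ (nbhs x)) => i; exact: h. Qed.

Section Spectral.
Variable R : realType.

(** A maximiser of the quadratic form on the compact unit sphere is an
  eigenvector: moving it in a direction [w] turns maximality into a quadratic
  inequality in the step, whose linear term [b] must vanish. *)
Lemma exists_eigenvector n (A : 'M[R]_n.+1) : A^T = A ->
  exists (v : 'rV[R]_n.+1) (l : R), dot v v = 1 /\ v *m A = l *: v.
Proof.
move=> sA; pose S := [set v : 'rV[R]_n.+1 | dot v v = 1].
have cS : compact S.
  apply: bounded_closed_compact.
    exists 1; split=> [|M M1 x]; first exact: num_real.
    rewrite /S /= => Sx; apply: le_trans (ltW M1).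
    rewrite [`|x|]mx_normrE; apply/bigmax_leP; split => // -[i j] _ /=.
    rewrite -(@ler_pXn2r _ 2) ?nnegrE// expr1n real_normK ?num_real//.
    rewrite -Sx dotE (bigD1 j) //= ord1 expr2 lerDl sumr_ge0 // => k _.
    by rewrite -expr2 sqr_ge0.
  have cd : continuous (fun v : 'rV[R]_n.+1 => dot v v).
    move=> v; under eq_fun do rewrite dotE.
    by apply: continuous_sumr => j; apply: continuousM; exact: coord_continuous.
  by apply: (@closed_comp _ _ (fun v => dot v v) [set 1]) => // v _; exact: cd.
have S0 : S !=set0.
  exists (delta_mx 0 0); rewrite /S /= dotE big_ord_recl !mxE /= big1 ?addr0 ?mulr1 //.
  by move=> j _; rewrite !mxE /= mulr0.
have ca : continuous (fun v : 'rV[R]_n.+1 => dot (v *m A) v).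
  have -> : (fun v : 'rV[R]_n.+1 => dot (v *m A) v) =
      (fun v => \sum_j (\sum_i v 0 i * A i j) * v 0 j).
    by apply/funext => v; rewrite dotE; apply: eq_bigr => j _; rewrite mxE.
  move=> v; apply: continuous_sumr => j.
  apply: continuousM; last exact: coord_continuous.
  apply: continuous_sumr => i; apply: continuousM; first exact: coord_continuous.
  exact: cst_continuous.
have [v Sv vmax] := @EVT_max_rV R _ _ S S0 cS (continuous_subspaceT ca).
exists v, (dot (v *m A) v); split; first by move: Sv; rewrite inE.
set l := dot _ _.
have {vmax} hmax w : dot (w *m A) w <= l * dot w w.
  have := dot_ge0 w; rewrite le_eqVlt => /orP[/eqP/esym/eqP|w0].
    by rewrite dot_eq0 => /eqP->; rewrite mul0mx /dot mul0mx mxE mulr0.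
  have s0 : 0 < Num.sqrt (dot w w) by rewrite sqrtr_gt0.
  have := vmax ((Num.sqrt (dot w w))^-1 *: w).
  rewrite -scalemxAl !(dotZl, dotZr) mulrA -invfM -expr2 sqr_sqrtr ?(ltW w0)//.
  rewrite ler_pdivrMl // (mulrC (dot w w)); apply; rewrite inE /S /= !(dotZl, dotZr) mulrA.
  by rewrite -invfM -expr2 sqr_sqrtr ?(ltW w0)// mulVf ?gt_eqF.
have sAd x y : dot (x *m A) y = dot (y *m A) x.
  by rewrite dot_mulmx sA dotC.
have lin w : dot (v *m A - l *: v) w = 0.
  set b := dot _ _; apply/eqP/negPn/negP => b0.
  pose c := l * dot w w - dot (w *m A) w.
  have c0 : 0 <= c by rewrite subr_ge0.
  have Sv' : dot v v = 1 by move: Sv; rewrite inE.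
  have key t : 2 * t * b <= t ^+ 2 * c.
    have := hmax (v + t *: w); rewrite mulmxDl -scalemxAl.
    rewrite !(dotDl, dotDr, dotZl, dotZr) (sAd w v) (dotC w v) Sv' -/l.
    move: @c @b b0 c0; rewrite dotDl -scaleNr dotZl /=.
    by set p := dot (v *m A) w; set q := dot v w; lra.
  (* a step at which [key] fails unless [b = 0]; adding 1 covers [c = 0] *)
  have := key (b / (c + 1)).
  have h : 0 < c + 1 by lra.
  rewrite -subr_ge0 (_ : _ - _ = - (b / (c + 1)) ^+ 2 * (c + 2)); last first.
    by field; rewrite gt_eqF.
  rewrite mulNr oppr_ge0 pmulr_lle0; last lra.
  rewrite le_eqVlt ltNge sqr_ge0 orbF sqrf_eq0 mulf_eq0 (negPf b0) /= invr_eq0.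
  by rewrite gt_eqF.
by apply/eqP; rewrite -subr_eq0 -dot_eq0 lin.
Qed.

(** The Householder reflection in the hyperplane orthogonal to
  [v - delta_mx 0 0] exchanges [v] and the first basis vector. *)
Lemma exists_reflection n (v : 'rV[R]_n.+1) : dot v v = 1 ->
  exists Q : 'M[R]_n.+1, Q *m Q^T = 1%:M /\ row 0 Q = v.
Proof.
move=> v1; have [->|nv] := eqVneq v (delta_mx 0 0).
  exists 1%:M; rewrite trmx1 mulmx1 row1; split => //.
pose w := v - delta_mx 0 0.
have w0 : dot w w != 0 by rewrite dot_eq0 subr_eq0.
have e0v (x : 'rV[R]_n.+1) : dot (delta_mx 0 0) x = x 0 0.
  by rewrite /dot -rowE !mxE.
have w00 : dot w w = - 2 * w 0 0.
  rewrite /w -scaleN1r !(dotDl, dotDr, dotZl, dotZr) v1 (dotC v) !e0v !mxE /=.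
  by ring.
pose Q := 1%:M - (2 / dot w w) *: (w^T *m w).
have sQ : Q^T = Q.
  by rewrite /Q linearB /= linearZ /= trmx_mul trmxK trmx1.
exists Q; split; last first.
  rewrite rowE /Q mulmxBr mulmx1 -scalemxAr mulmxA.
  have -> : delta_mx 0 0 *m w^T = (w 0 0)%:M :> 'M[R]_1.
    by rewrite [LHS]mx11_scalar -(e0v w).
  rewrite mul_scalar_mx scalerA w00.
  have w000 : w 0 0 != 0 by move: w0; rewrite w00 mulf_eq0 negb_or => /andP[].
  rewrite (_ : 2 / _ * _ = - 1); last by field.
  by rewrite scaleN1r opprK /w addrC subrK.
rewrite sQ /Q mulmxBr mulmxBl mulmx1 mulmxBl mul1mx -!scalemxAl -!scalemxAr.
rewrite scalerA mulmxA -(mulmxA w^T w w^T).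
have -> : w *m w^T = (dot w w)%:M by rewrite [LHS]mx11_scalar.
rewrite mulmx1 mul_mx_scalar -!scalemxAl scalerA.
rewrite (_ : _ * dot w w = 2 / dot w w + 2 / dot w w); last by field.
by rewrite scalerDl opprB addrK subrK.
Qed.

(** Deflation: in an orthonormal basis that starts with a unit eigenvector, a
  symmetric matrix splits into a scalar block and a smaller symmetric one. *)
Lemma spectral_theorem n (A : 'M[R]_n) : A^T = A ->
  exists (P : 'M[R]_n) (d : 'rV[R]_n),
    P *m P^T = 1%:M /\ A = P^T *m diag_mx d *m P.
Proof.
elim: n A => [|n IH] A sA.
  by exists 0, 0; split; apply/matrixP => -[].
have [v [l [v1 vA]]] := exists_eigenvector sA.
have [Q [QQ rQ]] := exists_reflection v1.
have QQ' : Q^T *m Q = 1%:M by exact: mulmx1C.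
pose B := (Q *m A *m Q^T : 'M[R]_(1 + n)).
have sB : B^T = B by rewrite /B !trmx_mul trmxK sA mulmxA.
have rB : row 0 B = l *: delta_mx 0 0.
  by rewrite /B !row_mul rQ vA -scalemxAl -rQ -row_mul QQ row1.
have B0 j : B 0 j = l * (j == 0)%:R.
  have := congr1 (fun x : 'rV_(1 + n) => x 0 j) rB; rewrite !mxE /= => ->.
  by rewrite eq_sym.
have BQ : A = Q^T *m B *m Q.
  by rewrite /B !mulmxA QQ' mul1mx -mulmxA QQ' mulmx1.
clearbody B; have l0 : lshift n (0 : 'I_1) = 0 by exact: val_inj.
pose A' := drsubmx B.
have BE : B = block_mx l%:M 0 0 A'.
  rewrite -[LHS]submxK; congr block_mx.
  - apply/matrixP => i j; rewrite !ord1 !mxE /=.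
    by rewrite l0 B0 eqxx mulr1 mulr1n.
  - apply/matrixP => i j; rewrite !ord1 !mxE /=.
    by rewrite l0 B0 (_ : _ == 0 = false) ?mulr0.
  - apply/matrixP => i j; rewrite !ord1 -sB !mxE /=.
    by rewrite l0 B0 (_ : _ == 0 = false) ?mulr0.
have [|P [d [PP A'E]]] := IH A'; first by rewrite /A' -[in RHS]sB trmx_drsub.
pose P1 : 'M[R]_(1 + n) := block_mx 1%:M 0 0 P.
have PP1 : P1 *m P1^T = 1%:M.
  rewrite /P1 tr_block_mx mulmx_block !trmx0 !trmx1.
  rewrite !(mulmx0, mul0mx, mulmx1, mul1mx, addr0, add0r) PP.
  by rewrite -scalar_mx_block.
pose D : 'rV[R]_(1 + n) := row_mx (const_mx l) d.
have BP : B = P1^T *m diag_mx D *m P1.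
  rewrite BE A'E /P1 /D tr_block_mx diag_mx_row !mulmx_block !trmx0 trmx1.
  rewrite !(mulmx0, mul0mx, mulmx1, mul1mx, addr0, add0r).
  by congr block_mx; apply/matrixP => i j; rewrite !ord1 !mxE eqxx !mulr1n.
exists ((P1 : 'M[R]_n.+1) *m Q), D; split.
  rewrite trmx_mul mulmxA -(mulmxA _ Q) QQ mulmx1; exact: PP1.
by rewrite trmx_mul BQ BP !mulmxA.
Qed.

End Spectral.

(** * Eigenvalue lists and eigenframes *)

Section EigenvalueList.
Variable R : realType.

(** Vectors are rows and matrices act on the right, so the orthonormal
  eigenvectors of [A] are the rows of [P]. *)
Definition eigenframe n (A P : 'M[R]_n) (d : 'rV[R]_n) : Prop :=
  P *m P^T = 1%:M /\ A = P^T *m diag_mx d *m P.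

Lemma char_poly_eigenframe n (A P : 'M[R]_n) d : eigenframe A P d ->
  char_poly A = \prod_i ('X - (d 0 i)%:P).
Proof.
move=> [PP ->]; have PP' := mulmx1C PP.
have dt : is_trig_mx (diag_mx d) by apply/is_diag_mx_is_trig; exact: diag_mx_is_diag.
transitivity (char_poly (diag_mx d)); last first.
  by rewrite char_poly_trig //; apply: eq_bigr => i _; rewrite mxE eqxx mulr1n.
rewrite /char_poly /char_poly_mx.
pose Q := map_mx (@polyC R) P.
have QQ : Q^T *m Q = 1%:M by rewrite /Q matrix.map_trmx -map_mxM PP' map_mx1.
have -> : 'X%:M - map_mx polyC (P^T *m diag_mx d *m P) =
   Q^T *m ('X%:M - map_mx polyC (diag_mx d)) *m Q.
  rewrite mulmxBr mulmxBl mul_mx_scalar -scalemxAl QQ scalemx1.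
  by rewrite !map_mxM matrix.map_trmx.
by rewrite !det_mulmx mulrAC -det_mulmx QQ det1 mul1r.
Qed.

(** [eigenvalues A] is a chosen sorted factorisation of the characteristic
  polynomial; an eigenframe shows that the choice is not empty, and unique
  factorisation identifies the two lists. *)
Lemma perm_eigenvalues n (A P : 'M[R]_n) d : eigenframe A P d ->
  perm_eq (eigenvalues A) [seq d 0 i | i <- enum 'I_n].
Proof.
move=> AP; have cA := char_poly_eigenframe AP.
set s := [seq _ | _ <- _].
have cs : char_poly A = \prod_(a <- s) ('X - a%:P).
  by rewrite cA big_map big_enum.
rewrite /eigenvalues; case: xgetP => [t _ [_ ct]|/(_ (sort >=%R s)) []].
  by apply: prod_XsubC_eq; rewrite -ct.
split.
  by apply: sort_sorted => x y; exact: le_total.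
by rewrite cs; apply/perm_big; rewrite perm_sym perm_sort.
Qed.

Lemma size_eigenvalues n (A P : 'M[R]_n) d : eigenframe A P d ->
  size (eigenvalues A) = n.
Proof. by move=> /perm_eigenvalues /perm_size ->; rewrite size_map size_enum_ord. Qed.

Lemma sum_lambda n (A P : 'M[R]_n) d (f : R -> R) : eigenframe A P d ->
  \sum_(i < n) f (lambda A i) = \sum_i f (d 0 i).
Proof.
move=> AP; have sz := size_eigenvalues AP.
transitivity (\sum_(a <- eigenvalues A) f a).
  by rewrite (big_nth 0) sz big_mkord.
by rewrite (perm_big _ (perm_eigenvalues AP)) big_map big_enum.
Qed.

Lemma sorted_eigenvalues n (A : 'M[R]_n) : sorted >=%R (eigenvalues A).
Proof. by rewrite /eigenvalues; case: xgetP => // t _ []. Qed.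

Lemma le_lambda0 n (A P : 'M[R]_n) d (i : 'I_n) : eigenframe A P d ->
  d 0 i <= lambda A 0.
Proof.
move=> AP; have : d 0 i \in eigenvalues A.
  rewrite (perm_mem (perm_eigenvalues AP)); apply/mapP; exists i => //.
  by rewrite mem_enum.
rewrite /lambda; have := sorted_eigenvalues A.
case: (eigenvalues A) => //= a s p; rewrite inE => /orP[/eqP->//|ins].
have tr : transitive (>=%R : rel R) by move=> x y z yx xz; exact: le_trans xz yx.
by have /allP/(_ _ ins) := order_path_min tr p.
Qed.

Lemma lambda0_eq n (A P : 'M[R]_n) d : eigenframe A P d -> (0 < n)%N ->
  exists i, lambda A 0 = d 0 i.
Proof.
move=> AP n0; have : lambda A 0 \in eigenvalues A.
  by apply: mem_nth; rewrite (size_eigenvalues AP).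
by rewrite (perm_mem (perm_eigenvalues AP)) => /mapP[i _ ->]; exists i.
Qed.

End EigenvalueList.

(** * A trace inequality for the arctangent *)

Section Klein.
Variable R : realType.

(** The derivative of [atan] is 1-Lipschitz, so the mean value theorem leaves a
  quadratic error with constant 1. *)
Lemma atan_taylor (x y : R) :
  `|atan y - atan x - (y - x) / (1 + x ^+ 2)| <= (y - x) ^+ 2.
Proof.
have key (c : R) : `|c - x| <= `|y - x| -> atan y - atan x = (1 + c ^+ 2)^-1 * (y - x) ->
    `|atan y - atan x - (y - x) / (1 + x ^+ 2)| <= (y - x) ^+ 2.
  move=> cx ->.
  have c1 : 0 < 1 + c ^+ 2 by have := sqr_ge0 c; lra.
  have x1 : 0 < 1 + x ^+ 2 by have := sqr_ge0 x; lra.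
  have -> : (1 + c ^+ 2)^-1 * (y - x) - (y - x) / (1 + x ^+ 2) =
     ((x + c) / ((1 + c ^+ 2) * (1 + x ^+ 2))) * ((x - c) * (y - x)).
    by field; rewrite !gt_eqF.
  set q := (x + c) / _; have q1 : `|q| <= 1.
    rewrite /q normrM normfV (gtr0_norm (mulr_gt0 c1 x1)) ler_pdivrMr ?mulr_gt0//.
    have h z := sqr_ge0 (x + z); have k z := sqr_ge0 (c + z).
    have := h (1 / 2); have := k (1 / 2); have := h (- (1 / 2)).
    have := k (- (1 / 2)); have := sqr_ge0 (x * c).
    by rewrite ler_norml => *; apply/andP; split; nra.
  rewrite normrM -[leRHS]mul1r; apply: ler_pM => //.
  rewrite normrM -[leRHS]ger0_norm ?sqr_ge0// expr2 (normrM (y - x)).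
  by rewrite ler_wpM2r // distrC.
have cont (a b : R) : {within `[a, b], continuous (@atan R)}.
  by apply: continuous_subspaceT => z; exact: continuous_atan.
have [xy|yx] := leP x y.
  have [c cxy e] := @MVT_segment R atan (fun c => (1 + c ^+ 2)^-1) x y xy
    (fun c _ => is_derive1_atan c) (cont _ _).
  apply: (key c) => //; move: cxy; rewrite in_itv /= => /andP[h1 h2].
  by rewrite !ger0_norm ?subr_ge0// lerB.
have [c cxy e] := @MVT_segment R atan (fun c => (1 + c ^+ 2)^-1) y x (ltW yx)
    (fun c _ => is_derive1_atan c) (cont _ _).
apply: (key c); last by lra.
move: cxy; rewrite in_itv /= => /andP[h1 h2].
by rewrite distrC (distrC y) !ger0_norm ?subr_ge0 ?(ltW yx)// lerB.
Qed.

Definition sqr_frobenius m n (M : 'M[R]_(m, n)) : R := \sum_i \sum_j M i j ^+ 2.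

Lemma sqr_frobenius_ge0 m n (M : 'M[R]_(m, n)) : 0 <= sqr_frobenius M.
Proof. by apply: sumr_ge0 => i _; apply: sumr_ge0 => j _; exact: sqr_ge0. Qed.

Lemma sqr_frobeniusE m n (M : 'M[R]_(m, n)) : sqr_frobenius M = \tr (M *m M^T).
Proof.
rewrite /sqr_frobenius /mxtrace; apply: eq_bigr => i _; rewrite mxE.
by apply: eq_bigr => j _; rewrite mxE.
Qed.

Lemma sqr_frobenius_orthogonal n (P Q M : 'M[R]_n) : P *m P^T = 1%:M -> Q *m Q^T = 1%:M ->
  sqr_frobenius (P *m M *m Q^T) = sqr_frobenius M.
Proof.
move=> PP QQ; rewrite !sqr_frobeniusE !trmx_mul trmxK !mulmxA -(mulmxA _ Q^T Q).
rewrite (mulmx1C QQ) mulmx1 mxtrace_mulC -!mulmxA (mulmxA P^T P).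
by rewrite (mulmx1C PP) mul1mx.
Qed.

(** Klein's trace inequality, to second order: in the two eigenframes the
  matrix of squared cosines is doubly stochastic, so a scalar Taylor bound
  can be averaged over the pairs of eigenvalues. This differentiates the sum
  of the arctangents of the eigenvalues at [A] even where single eigenvalues
  are not differentiable. *)
Lemma klein_atan n (A B P Q : 'M[R]_n) (a b : 'rV[R]_n) :
  eigenframe A P a -> eigenframe B Q b ->
  `|\sum_i atan (b 0 i) - \sum_i atan (a 0 i)
    - \sum_i (P *m (B - A) *m P^T) i i / (1 + a 0 i ^+ 2)| <= sqr_frobenius (B - A).
Proof.
move=> [PP EA] [QQ EB]; have PP' := mulmx1C PP; have QQ' := mulmx1C QQ.
pose W := P *m Q^T.
have WW : W *m W^T = 1%:M.
  by rewrite /W trmx_mul trmxK !mulmxA -(mulmxA P) QQ' mulmx1 PP.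
have WW' : W^T *m W = 1%:M by exact: mulmx1C.
have Pa : P *m A *m P^T = diag_mx a.
  by rewrite EA !mulmxA PP mul1mx -mulmxA PP mulmx1.
have Pb : P *m B *m P^T = W *m diag_mx b *m W^T.
  by rewrite EB /W trmx_mul trmxK !mulmxA.
have PQM : P *m (B - A) *m Q^T = W *m diag_mx b - diag_mx a *m W.
  rewrite mulmxBr mulmxBl; congr (_ - _).
    by rewrite EB !mulmxA -(mulmxA _ Q) QQ mulmx1.
  by rewrite EA !mulmxA PP mul1mx -mulmxA.
clearbody W.
have PQ i j : (P *m (B - A) *m Q^T) i j = W i j * (b 0 j - a 0 i).
  by rewrite PQM mul_mx_diag mul_diag_mx !mxE; ring.
have rW i : \sum_j W i j ^+ 2 = 1.
  have := congr1 (fun M : 'M[R]_n => M i i) WW; rewrite !mxE eqxx mulr1n => <-.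
  by apply: eq_bigr => j _; rewrite mxE.
have cW j : \sum_i W i j ^+ 2 = 1.
  have := congr1 (fun M : 'M[R]_n => M j j) WW'; rewrite !mxE eqxx mulr1n => <-.
  by apply: eq_bigr => i _; rewrite mxE.
have dPP i : (P *m (B - A) *m P^T) i i = \sum_j W i j ^+ 2 * (b 0 j - a 0 i).
  rewrite mulmxBr mulmxBl Pa Pb !mxE eqxx mulr1n.
  under [RHS]eq_bigr do rewrite mulrBr.
  rewrite sumrB -mulr_suml rW mul1r; congr (_ - _).
  apply: eq_bigr => j _; rewrite mul_mx_diag !mxE; ring.
have -> : \sum_i atan (b 0 i) = \sum_i \sum_j W i j ^+ 2 * atan (b 0 j).
  rewrite exchange_big; apply: eq_bigr => j _.
  by rewrite -mulr_suml cW mul1r.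
have -> : \sum_i atan (a 0 i) = \sum_i \sum_j W i j ^+ 2 * atan (a 0 i).
  by apply: eq_bigr => i _; rewrite -mulr_suml rW mul1r.
rewrite -(sqr_frobenius_orthogonal (B - A) PP QQ) -!sumrB.
apply: le_trans (ler_norm_sum _ _ _) _; apply: ler_sum => i _.
rewrite dPP mulr_suml -!sumrB.
apply: le_trans (ler_norm_sum _ _ _) _; apply: ler_sum => j _.
rewrite PQ exprMn -mulrA -!mulrBr normrM ger0_norm ?sqr_ge0//.
by rewrite ler_wpM2l ?sqr_ge0// atan_taylor.
Qed.

End Klein.

(** * Addition inequalities for the arctangent *)

Section Arctangent.
Variable R : realType.
Implicit Types x y z : R.

Lemma atan_inv x : 0 < x -> atan x^-1 = pi / 2 - atan x.
Proof.
move=> x0; have a0 : 0 < atan x by rewrite -(atan0 R) lt_atan.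
have a1 := atan_ltpi2 x; have p0 := pi_gt0 R.
rewrite -[RHS]tanK; last by rewrite in_itv /=; apply/andP; split; lra.
congr atan; rewrite -{1}[x]atanK /tan sinB cosB sin_pihalf cos_pihalf.
by rewrite !mul0r !mul1r subr0 add0r invf_div.
Qed.

Lemma atan_subr x y : - (pi / 2) < atan x - atan y < pi / 2 ->
  atan x - atan y = atan ((x - y) / (1 + x * y)).
Proof.
move=> h; rewrite -[LHS]tanK; last by rewrite in_itv /=.
have c z : cos (atan z) != 0.
  by rewrite cos_atan invr_eq0 gt_eqF // sqrtr_gt0; have := sqr_ge0 z; lra.
rewrite tanD ?cosN // tanN !atanK; congr (atan (_ / _)); ring.
Qed.

(** When the difference of the angles exceeds [pi / 2], the tangent formula
  describes its supplement. *)
Lemma atan_subr_gt x y : pi / 2 < atan x - atan y ->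
  pi - (atan x - atan y) = atan (- ((x - y) / (1 + x * y))).
Proof.
move=> h; have p0 := pi_gt0 R; have x1 := atan_ltpi2 x; have y1 := atan_gtNpi2 y.
rewrite -[LHS]tanK; last by rewrite in_itv /=; apply/andP; split; lra.
have c z : cos (atan z) != 0.
  by rewrite cos_atan invr_eq0 gt_eqF // sqrtr_gt0; have := sqr_ge0 z; lra.
congr atan; rewrite addrC tanDpi tanN tanD ?cosN // tanN !atanK.
by congr (- (_ / _)); ring.
Qed.

(** The derivative of [atan] decreases on the positive half-line. *)
Lemma atan_subadditive x y : 0 <= x -> 0 <= y -> atan (x + y) <= atan x + atan y.
Proof.
move=> x0 y0; pose h z := atan z - atan (x + z).
have dh z : is_derive z 1 h ((1 + z ^+ 2)^-1 - (1 + (x + z) ^+ 2)^-1).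
  apply: is_deriveB.
  have := @is_derive1_comp R (@atan R) (fun z => x + z) z _ _ (is_derive1_atan _)
    (is_deriveD (is_derive_cst x z 1) (is_derive_id z 1)).
  by rewrite add0r mulr1.
have ch : {within `[0, y], continuous h}.
  apply: continuous_subspaceT => z; apply: differentiable_continuous.
  by apply/derivable1_diffP; have [] := dh z.
have [c] := @MVT_segment R h _ 0 y y0 (fun z _ => dh z) ch.
rewrite in_itv /= => /andP[c0 cy]; rewrite /h atan0 addr0 subr0 => e.
have : 0 <= ((1 + c ^+ 2)^-1 - (1 + (x + c) ^+ 2)^-1) * y.
  apply: mulr_ge0 => //; rewrite subr_ge0 lef_pV2 ?posrE.
  - rewrite lerD2l; apply: lerXn2r; rewrite ?nnegrE; lra.
  - by have := sqr_ge0 (x + c); lra.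
  - by have := sqr_ge0 c; lra.
lra.
Qed.

Lemma atan_sum_le (I : Type) (r : seq I) (P : pred I) (f : I -> R) :
  (forall i, P i -> 0 <= f i) ->
  atan (\sum_(i <- r | P i) f i) <= \sum_(i <- r | P i) atan (f i).
Proof.
move=> f0; suff [] : 0 <= \sum_(i <- r | P i) f i /\
   atan (\sum_(i <- r | P i) f i) <= \sum_(i <- r | P i) atan (f i) by [].
elim/big_ind2: _ => [|x1 x2 y1 y2 [h1 h2] [h3 h4]|i Pi]; first by rewrite atan0.
  split; first by lra.
  apply: le_trans (lerD h2 h4); exact: atan_subadditive.
by split => //; exact: f0.
Qed.

End Arctangent.

(** * Eigenvalues in the supercritical and critical phase range *)

Section Phase.
Variables (R : realType) (n : nat) (d : 'I_n -> R) (o : 'I_n).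
Hypothesis n3 : (3 <= n)%N.
Hypothesis phase : (n%:R - 2) * pi / 2 <= \sum_i atan (d i).
Hypothesis max_o : forall k, d k <= d o.

(* The complementary angles: all positive, with sum at most [pi]. *)
Let al k := pi / 2 - atan (d k).

Let al_gt0 k : 0 < al k.
Proof. by rewrite subr_gt0 atan_ltpi2. Qed.

Let n3R : (3 : R) <= n%:R.
Proof. by rewrite (ler_nat R 3 n). Qed.

Let sum_al : \sum_k al k <= pi.
Proof.
rewrite sumrB sumr_const card_ord -(mulr_natr (pi / 2) n); move: phase.
by move: (\sum_i _) (n%:R : R) => S N; lra.
Qed.

(** The complementary angles of [d i] and [d j] already add up to at most [pi]. *)
Lemma phase_pair i j : i != j -> 0 <= d i + d j.
Proof.
move=> ij; have : al i + al j <= pi.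
  apply: le_trans sum_al; rewrite (bigD1 i) //= (bigD1 j) 1?eq_sym //=.
  by rewrite lerD2l lerDl sumr_ge0 // => k _; rewrite ltW.
rewrite /al => h; rewrite leNgt; apply/negP => h'.
have : atan (d i) < atan (- d j) by apply: lt_atan; lra.
rewrite atanN; lra.
Qed.

Lemma phase_max_gt0 : 0 < d o.
Proof.
rewrite ltNge; apply/negP => d0.
have : \sum_i atan (d i) <= 0.
  rewrite sumr_le0 // => i _; rewrite -(atan0 R) le_atan //.
  exact: le_trans d0.
have := pi_gt0 R; move: n3R phase => h1 h2 h3 h4; nra.
Qed.

(** Otherwise the complementary angle of [d k] exceeds
  [pi / 2 + atan (d o / 2)]. There are at least two further indices, each with
  complementary angle at least [atan (d o)^-1], and twice this is at least
  [atan (2 / d o) = pi / 2 - atan (d o / 2)]: the sum would exceed [pi]. *)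
Lemma phase_min_ge k : - (d o / 2) <= d k.
Proof.
have o0 := phase_max_gt0; rewrite leNgt; apply/negP => h.
have a2 : al k + 2 * al o <= pi.
  apply: le_trans sum_al; rewrite (bigD1 k) //= lerD2l.
  apply: (@le_trans _ _ (\sum_(i < n | i != k) al o)).
    rewrite sumr_const cardC1 card_ord -[leRHS]mulr_natl ler_wpM2r ?(ltW (al_gt0 o))//.
    by rewrite (ler_nat R 2) -ltnS prednK // (leq_trans _ n3).
  by apply: ler_sum => i _; rewrite lerD2l lerN2 le_atan.
have h1 : atan (d o / 2) < - atan (d k) by rewrite -atanN lt_atan //; lra.
have h2 : atan ((d o)^-1 + (d o)^-1) <= 2 * al o.
  by rewrite mulr2n mulrDl mul1r /al -atan_inv // atan_subadditive // invr_ge0 ltW.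
have h3 : atan ((d o)^-1 + (d o)^-1) = pi / 2 - atan (d o / 2).
  rewrite -atan_inv ?divr_gt0//; congr atan; by field; rewrite gt_eqF.
move: a2; rewrite {1}/al; lra.
Qed.

(** The phase condition read through tangents. Relative to the angle of [L] the
  angles [atan L - atan (d k)] have tangents [(L - d k) / (1 + L * d k)]; the one
  of the negative [d k0] exceeds [pi / 2], and the phase condition bounds all
  the other ones, together with the angles complementary to those of [d o] and
  ([n - 1] times) of [L], by its supplement. Subadditivity of [atan] turns the
  sum of angles into a sum of tangents. *)
Lemma phase_tan (L : R) k0 : d o <= L -> k0 != o -> 1 + L * d k0 < 0 ->
  (d o)^-1 + (n%:R - 1) / L + \sum_(k | (k != o) && (k != k0)) (L - d k) / (1 + L * d k)
    <= - ((L - d k0) / (1 + L * d k0)).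
Proof.
move=> oL k0o neg; have o0 := phase_max_gt0.
have L0 : 0 < L by exact: lt_le_trans oL.
have k00 : d k0 < 0 by nra.
have pos k : k != k0 -> 0 < d k by move=> /phase_pair; lra.
have den k : k != k0 -> 0 < 1 + L * d k by move=> /pos ?; nra.
have p0 := pi_gt0 R.
have aL0 : 0 < atan L by rewrite -(atan0 R) lt_atan.
have aL1 := atan_ltpi2 L.
have tauE k : k != k0 -> atan L - atan (d k) = atan ((L - d k) / (1 + L * d k)).
  move=> kk0; apply: atan_subr; apply/andP; split.
    have : atan (d k) <= atan L by apply/le_atan/(le_trans _ oL).
    lra.
  have : 0 < atan (d k) by rewrite -(atan0 R) lt_atan // pos.
  lra.
have tau0 k : k != k0 -> 0 <= (L - d k) / (1 + L * d k).
  move=> kk0; apply: divr_ge0; last by rewrite ltW // den.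
  by rewrite subr_ge0 (le_trans _ oL).
have S1 : \sum_(k | (k != o) && (k != k0)) (atan L - atan (d k)) <=
   (n%:R - 2) * (atan L - pi / 2) + (atan (d k0) + atan (d o)).
  have : \sum_k (atan L - atan (d k)) <= n%:R * atan L - (n%:R - 2) * pi / 2.
    by rewrite sumrB sumr_const card_ord -(mulr_natl (atan L) n) lerD2l lerN2.
  rewrite (bigD1 o) //= (bigD1 k0) //=; lra.
have S2 : atan (\sum_(k | (k != o) && (k != k0)) (L - d k) / (1 + L * d k)) <=
     \sum_(k | (k != o) && (k != k0)) (atan L - atan (d k)).
  rewrite [leRHS](eq_bigr (fun k => atan ((L - d k) / (1 + L * d k)))); last first.
    by move=> k /andP[_ kk0]; exact: tauE.
  apply: atan_sum_le => k /andP[_ kk0]; exact: tau0.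
have S0 : 0 <= \sum_(k | (k != o) && (k != k0)) (L - d k) / (1 + L * d k).
  apply: sumr_ge0 => k /andP[_ kk0]; exact: tau0.
have S3 : atan ((n%:R - 1) / L) <= (n%:R - 1) * (pi / 2 - atan L).
  rewrite -(atan_inv L0) -(natrB R (m := n) (n := 1)); last exact: leq_trans n3.
  have := @atan_sum_le R 'I_(n - 1) (index_enum _) predT (fun=> L^-1)
    (fun _ _ => ltW (etrans (invr_gt0 L) L0)).
  rewrite !sumr_const card_ord -(mulr_natl L^-1) -(mulr_natl (atan L^-1)).
  by [].
have S4 := atan_inv o0.
have n1 : 0 <= (n%:R - 1) / L by apply: divr_ge0; have := n3R; lra.
have big : pi / 2 < atan L - atan (d k0).
  have : atan L^-1 < atan (- d k0).
    by apply: lt_atan; rewrite -(ltr_pM2l L0) mulfV ?gt_eqF//; lra.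
  rewrite atan_inv // atanN; lra.
have := atan_subr_gt big.
set t0 := - (_ / _) => e0; rewrite leNgt; apply/negP => /lt_atan.
rewrite -e0; apply/negP; rewrite -leNgt.
apply: le_trans (atan_subadditive _ S0) _; first by rewrite addr_ge0 // invr_ge0 ltW.
have S5 := @atan_subadditive R (d o)^-1 ((n%:R - 1) / L) (ltW (etrans (invr_gt0 _) o0)) n1.
move: S1 S2 S3 S4 S5; set T := \sum_(k | _) (atan L - _).
set N := n%:R; move=> S1 S2 S3 S4 S5; lra.
Qed.

End Phase.

(** * The Jacobi inequality, algebraic part *)

Section Jacobi.
Variables (R : realType) (n : nat) (d : 'I_n -> R) (o : 'I_n).
Hypothesis n3 : (3 <= n)%N.
Hypothesis phase : (n%:R - 2) * pi / 2 <= \sum_i atan (d i).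
Hypothesis max_o : forall k, d k <= d o.

Let o0 : 0 < d o. Proof. exact: phase_max_gt0 n3 phase max_o. Qed.

(** Tilting the top eigenvector with the coefficients [(d o - d k)^-1] would be
  optimal, but these blow up when the largest eigenvalue is multiple. Raising
  the level to [9 / 8] of it keeps them finite at a tolerable loss. *)
Definition tilt_level : R := 9 / 8 * d o.
Definition tilt (k : 'I_n) : R := (tilt_level - d k)^-1.

Lemma tilt_level_gt k : 0 < tilt_level - d k.
Proof. by have := max_o k; have := o0; rewrite /tilt_level => *; lra. Qed.

Lemma tilt_gt0 k : 0 < tilt k.
Proof. by rewrite invr_gt0 tilt_level_gt. Qed.

Lemma tilt_le1 k : tilt k * (d o - d k) <= 1.
Proof.
rewrite mulrC ler_pdivrMr ?tilt_level_gt// mul1r lerD2r.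
by have := o0; rewrite /tilt_level => *; lra.
Qed.

(** Completing the squares at the minimiser [y i = mu * z / m i]. *)
Lemma weighted_cauchy (I : finType) (P : pred I) (m y : I -> R) (mu z : R) :
  0 < mu -> (forall i, P i -> 0 < m i) -> \sum_(i | P i) (m i)^-1 <= mu^-1 ->
  z = \sum_(i | P i) y i ->
  mu * z ^+ 2 <= \sum_(i | P i) m i * y i ^+ 2.
Proof.
move=> mu0 m0 hm hz; pose s := mu * z.
have : 0 <= \sum_(i | P i) m i * (y i - s / m i) ^+ 2.
  by apply: sumr_ge0 => i /m0 ?; rewrite mulr_ge0 ?sqr_ge0 ?ltW.
have -> : \sum_(i | P i) m i * (y i - s / m i) ^+ 2 =
   \sum_(i | P i) m i * y i ^+ 2 - 2 * s * z + s ^+ 2 * \sum_(i | P i) (m i)^-1.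
  rewrite hz !mulr_sumr -sumrB -big_split; apply: eq_bigr => i /m0 mi /=.
  by field; rewrite gt_eqF.
have : s ^+ 2 * (\sum_(i | P i) (m i)^-1) <= s ^+ 2 * mu^-1.
  by rewrite ler_wpM2l ?sqr_ge0.
have -> : s ^+ 2 * mu^-1 = mu * z ^+ 2 by rewrite /s; field; rewrite gt_eqF.
have -> : 2 * s * z = 2 * (mu * z ^+ 2) by rewrite /s; ring.
lra.
Qed.

(** By [phase_pair] at most one weight is negative, that of a very negative
  [d k0]. The constraint expresses [y k0] by the other [y k], and the
  weighted Cauchy inequality absorbs its square: the bound on the sum of
  reciprocal weights that this requires is [phase_tan] divided by [2 * d o]. *)
Lemma jacobi_diagonal (y : 'I_n -> R) : \sum_k y k = 0 ->
  0 <= (3 / 4 * d o ^+ 2 + 1) * y o ^+ 2 +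
       \sum_(k | k != o) 2 * d o * (d k + tilt k * (1 + d k ^+ 2)) * y k ^+ 2.
Proof.
move=> y0; have L0 : 0 < tilt_level by rewrite /tilt_level; have := o0; lra.
have Mo : 0 < 3 / 4 * d o ^+ 2 + 1 by have := sqr_ge0 (d o); lra.
have mE k : d k + tilt k * (1 + d k ^+ 2) = (1 + tilt_level * d k) / (tilt_level - d k).
  by rewrite /tilt; field; rewrite gt_eqF ?tilt_level_gt.
have [/existsP[k0 /andP[k0o neg]]|/existsPn allpos] :=
    boolP [exists k, (k != o) && (1 + tilt_level * d k < 0)]; last first.
  apply: addr_ge0; first by rewrite mulr_ge0 ?sqr_ge0 ?(ltW Mo).
  apply: sumr_ge0 => k ko.
  have := allpos k; rewrite ko /= -leNgt => h.
  rewrite mE; apply: mulr_ge0 (sqr_ge0 _); apply: mulr_ge0.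
    by have := o0; lra.
  by apply: divr_ge0 => //; exact: ltW (tilt_level_gt k).
have k00 : d k0 < 0 by nra.
have pos k : k != k0 -> 0 < d k by move=> /(phase_pair phase); lra.
have den k : k != k0 -> 0 < 1 + tilt_level * d k by move=> /pos ?; nra.
have tan := phase_tan n3 phase max_o (_ : d o <= tilt_level) k0o neg.
rewrite (bigD1 k0) //=.
pose m k := if k == o then 3 / 4 * d o ^+ 2 + 1 else
  2 * d o * (d k + tilt k * (1 + d k ^+ 2)).
pose mu := - (2 * d o * ((1 + tilt_level * d k0) / (tilt_level - d k0))).
have mu0 : 0 < mu.
  rewrite oppr_gt0 pmulr_rlt0 ?pmulr_llt0 ?invr_gt0 ?tilt_level_gt//.
  by have := o0; lra.
have := @weighted_cauchy _ (fun k => k != k0) m y mu (- y k0) mu0.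
have yk0 : \sum_(k | k != k0) y k = - y k0.
  by have := y0; rewrite (bigD1 k0) //=; lra.
rewrite -yk0.
have mpos k : k != k0 -> 0 < m k.
  move=> kk0; rewrite /m; case: eqP => // _; rewrite mE.
  apply: mulr_gt0; first by have := o0; lra.
  by apply: divr_gt0 (tilt_level_gt k); exact: den.
move=> /(_ mpos) H.
have {H} H : mu * (\sum_(k | k != k0) y k) ^+ 2 <= \sum_(k | k != k0) m k * y k ^+ 2.
  apply: H => //.
  rewrite (bigD1 o) 1?eq_sym //= {1}/m eqxx.
  have -> : \sum_(k | (k != k0) && (k != o)) (m k)^-1 = (2 * d o)^-1 *
     \sum_(k | (k != o) && (k != k0)) (tilt_level - d k) / (1 + tilt_level * d k).
    rewrite mulr_sumr; apply: eq_big => [k|k /andP[kk0 ko]]; first by rewrite andbC.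
    rewrite /m (negPf ko) mE; field.
    by rewrite !gt_eqF ?den ?tilt_level_gt// o0.
  have -> : mu^-1 = (2 * d o)^-1 * - ((tilt_level - d k0) / (1 + tilt_level * d k0)).
    by rewrite /mu; field; rewrite (lt_eqF neg) (gt_eqF (tilt_level_gt k0)) (gt_eqF o0).
  have i0 : 0 < (2 * d o)^-1 by rewrite invr_gt0; have := o0; lra.
  have h1 : (3 / 4 * d o ^+ 2 + 1)^-1 <=
      (2 * d o)^-1 * ((d o)^-1 + (n%:R - 1) / tilt_level).
    have e0 : 0 < (d o)^-1 by rewrite invr_gt0 o0.
    have -> : tilt_level^-1 = 8 / 9 * (d o)^-1.
      by rewrite /tilt_level; field; rewrite gt_eqF ?o0.
    have -> : (2 * d o)^-1 = 1 / 2 * (d o)^-1 by field; rewrite gt_eqF ?o0.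
    apply: (@le_trans _ _ (4 / 3 * (d o)^-1 ^+ 2)).
      have -> : 4 / 3 * (d o)^-1 ^+ 2 = (3 / 4 * d o ^+ 2)^-1.
        by field; rewrite gt_eqF ?o0.
      rewrite lef_pV2 ?posrE//; first by lra.
      by rewrite mulr_gt0 ?exprn_gt0 ?o0//; lra.
    have : (3 : R) <= n%:R by rewrite (ler_nat R 3 n).
    move: (n%:R : R) => N N3; nra.
  apply: le_trans (lerD h1 (lexx _)) _; rewrite -mulrDr.
  rewrite ler_wpM2l ?(ltW i0)// tan //.
  by rewrite /tilt_level; have := o0; lra.
move: H; rewrite yk0 sqrrN (bigD1 o) 1?eq_sym //= {1}/m eqxx (mE k0).
have -> : \sum_(k | (k != k0) && (k != o)) m k * y k ^+ 2 =
  \sum_(k | (k != o) && (k != k0)) 2 * d o * (d k + tilt k * (1 + d k ^+ 2)) * y k ^+ 2.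
  apply: eq_big => [k|k /andP[kk0 ko]]; first by rewrite andbC.
  by rewrite /m (negPf ko).
rewrite /mu; move: (_ / _) (\sum_(k | _) _) => q S; lra.
Qed.

(** The algebra behind the superharmonicity of [(1 + l ^+ 2) `^ (- 1 / 8)], for
  [l] the largest eigenvalue, with respect to the linearised operator with
  coefficients [g i]. Here [H i k] is the third derivative of the solution in
  the eigendirections [i], [k] and [o], [C i] its fourth derivative in the
  directions [i], [i], [o] and [o], and [G i] the gain from tilting the top
  eigenvector along direction [i]; the two equations on [H] and [C] are the
  first and second variation of the special Lagrangian equation. They
  bound the sum from below by a quadratic form in the [H i k]: for distinct [i]
  and [k] its coefficients are nonnegative by [phase_pair] and [phase_min_ge],
  and the part in the [H k k] is [jacobi_diagonal] at [y k = g k * H k k]. *)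
Lemma jacobi_inequality (g : 'I_n -> R) (H : 'I_n -> 'I_n -> R) (C G : 'I_n -> R) :
  (forall i, g i = (1 + d i ^+ 2)^-1) ->
  (forall i k, H i k = H k i) ->
  \sum_i g i * H i i = 0 ->
  \sum_i g i * C i = \sum_i \sum_k g i * g k * (d i + d k) * H i k ^+ 2 ->
  \sum_(k | k != o) 2 * tilt k * H o k ^+ 2 <= G o ->
  (forall i, i != o -> 2 * tilt i * H i i ^+ 2 <= G i) ->
  0 <= \sum_i g i * (d o * (1 + d o ^+ 2) * (C i + G i) -
                     (5 / 4 * d o ^+ 2 - 1) * H o i ^+ 2).
Proof.
move=> gE symH first second Go Gi.
have g0 i : 0 < g i by rewrite gE invr_gt0; have := sqr_ge0 (d i); lra.
have q0 : 0 < 1 + d o ^+ 2 by have := sqr_ge0 (d o); lra.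
have pairs : 2 * \sum_i d i * g i ^+ 2 * H i i ^+ 2 +
     2 * \sum_(k | k != o) g o * g k * (d o + d k) * H o k ^+ 2 <= \sum_i g i * C i.
  rewrite second (bigD1 o) //= [in leRHS](bigD1 o) //= [in leRHS](bigD1 o) //=.
  have : \sum_(i | i != o) (2 * (d i * g i ^+ 2 * H i i ^+ 2) +
            g o * g i * (d o + d i) * H o i ^+ 2) <=
     \sum_(i < n | i != o) \sum_k g i * g k * (d i + d k) * H i k ^+ 2.
    apply: ler_sum => i io; rewrite (bigD1 i) //= (bigD1 o) 1?eq_sym //=.
    have : 0 <= \sum_(k | (k != i) && (k != o)) g i * g k * (d i + d k) * H i k ^+ 2.
      apply: sumr_ge0 => k /andP[ki ko]; apply: mulr_ge0 (sqr_ge0 _).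
      apply: mulr_ge0; first by rewrite mulr_ge0 ?(ltW (g0 _)).
      by apply: phase_pair phase _ _ _; rewrite eq_sym.
    rewrite (symH i o); lra.
  rewrite big_split /= -mulr_sumr; lra.
have gains : g o * \sum_(k | k != o) 2 * tilt k * H o k ^+ 2 +
    \sum_(i | i != o) g i * (2 * tilt i * H i i ^+ 2) <= \sum_i g i * G i.
  rewrite [leRHS](bigD1 o) //=; apply: lerD; first by rewrite ler_wpM2l ?(ltW (g0 _)).
  by apply: ler_sum => i io; rewrite ler_wpM2l ?(ltW (g0 _)) // Gi.
have diag := jacobi_diagonal first.
have off : 0 <= \sum_(k | k != o) (g k * (2 * d o * (d o + d k) +
     2 * d o * tilt k * (1 + d k ^+ 2) - 5 / 4 * d o ^+ 2 + 1)) * H o k ^+ 2.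
  apply: sumr_ge0 => k ko; apply: mulr_ge0 (sqr_ge0 _).
  apply: mulr_ge0; first exact: ltW (g0 k).
  have t0 := tilt_gt0 k; have k1 := phase_min_ge n3 phase max_o k.
  have tE : tilt k * (9 / 8 * d o - d k) = 1.
    by rewrite /tilt mulVf // gt_eqF // tilt_level_gt.
  have [dk|dk] := leP 0 (d k).
    have : 0 <= 2 * d o * tilt k * (1 + d k ^+ 2).
      have h2 := sqr_ge0 (d k); apply: mulr_ge0; last lra.
      by rewrite mulr_ge0 ?mulr_ge0 ?(ltW t0) ?(ltW o0).
    have := o0; nra.
  have k2 : 0 < 27 / 32 * d o + 3 / 2 * d k by have := o0; lra.
  have s0 := tilt_level_gt k; rewrite -(pmulr_rge0 _ s0).
  have -> : (tilt_level - d k) * (2 * d o * (d o + d k) + 2 * d o * tilt k * (1 + d k ^+ 2)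
       - 5 / 4 * d o ^+ 2 + 1) =
     d o ^+ 2 * (27 / 32 * d o + 3 / 2 * d k) + 2 * d o + (tilt_level - d k).
    transitivity ((9 / 8 * d o - d k) * (2 * d o * (d o + d k) - 5 / 4 * d o ^+ 2 + 1)
        + 2 * d o * (1 + d k ^+ 2) * (tilt k * (9 / 8 * d o - d k))).
      by rewrite /tilt_level; ring.
    by rewrite tE /tilt_level; field.
  have h2 : 0 <= d o ^+ 2 * (27 / 32 * d o + 3 / 2 * d k).
    by rewrite mulr_ge0 ?sqr_ge0 ?(ltW k2).
  by have := o0; lra.
have go : g o * (1 + d o ^+ 2) = 1 by rewrite gE mulVf // gt_eqF.
have gk k : g k ^+ 2 * (1 + d k ^+ 2) = g k.
  by rewrite gE expr2 -mulrA mulVf ?mulr1 // gt_eqF; have := sqr_ge0 (d k); lra.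
have DE : \sum_(k | k != o) 2 * d o * (d k + tilt k * (1 + d k ^+ 2)) * (g k * H k k) ^+ 2
   = 2 * d o * \sum_(k | k != o) d k * g k ^+ 2 * H k k ^+ 2
     + d o * \sum_(k | k != o) g k * (2 * tilt k * H k k ^+ 2).
  rewrite !mulr_sumr -big_split; apply: eq_bigr => k _ /=.
  by rewrite -{3}(gk k); ring.
have OE : \sum_(k | k != o) (g k * (2 * d o * (d o + d k) +
     2 * d o * tilt k * (1 + d k ^+ 2) - 5 / 4 * d o ^+ 2 + 1)) * H o k ^+ 2 =
   2 * (d o * (1 + d o ^+ 2)) * \sum_(k | k != o) g o * g k * (d o + d k) * H o k ^+ 2
   + d o * (1 + d o ^+ 2) * g o * \sum_(k | k != o) 2 * tilt k * H o k ^+ 2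
   - (5 / 4 * d o ^+ 2 - 1) * \sum_(k | k != o) g k * H o k ^+ 2.
  rewrite !mulr_sumr -big_split -sumrB; apply: eq_bigr => k _ /=.
  have gk1 : g k * (1 + d k ^+ 2) = 1.
    by rewrite gE mulVf // gt_eqF //; have := sqr_ge0 (d k); lra.
  have -> : g k * (2 * d o * (d o + d k) + 2 * d o * tilt k * (1 + d k ^+ 2)
      - 5 / 4 * d o ^+ 2 + 1) = g k * (2 * d o * (d o + d k) - 5 / 4 * d o ^+ 2 + 1)
      + 2 * d o * tilt k * (g k * (1 + d k ^+ 2)) by ring.
  have -> : 2 * (d o * (1 + d o ^+ 2)) * (g o * g k * (d o + d k) * H o k ^+ 2) =
    2 * d o * (g o * (1 + d o ^+ 2)) * g k * (d o + d k) * H o k ^+ 2 by ring.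
  have -> : d o * (1 + d o ^+ 2) * g o * (2 * tilt k * H o k ^+ 2) =
    d o * (g o * (1 + d o ^+ 2)) * (2 * tilt k * H o k ^+ 2) by ring.
  by rewrite gk1 go; ring.
have -> : \sum_i g i * (d o * (1 + d o ^+ 2) * (C i + G i) -
                     (5 / 4 * d o ^+ 2 - 1) * H o i ^+ 2) =
   d o * (1 + d o ^+ 2) * (\sum_i g i * C i) + d o * (1 + d o ^+ 2) * (\sum_i g i * G i)
   - (5 / 4 * d o ^+ 2 - 1) * (\sum_i g i * H o i ^+ 2).
  by rewrite !mulr_sumr -big_split -sumrB; apply: eq_bigr => k _ /=; ring.
have dq : 0 <= d o * (1 + d o ^+ 2) by rewrite mulr_ge0 ?(ltW o0) ?(ltW q0).
have := ler_wpM2l dq pairs; have := ler_wpM2l dq gains.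
have := mulr_ge0 (ltW q0) diag; move: off; rewrite OE DE.
rewrite [\sum_i d i * _ * _](bigD1 o) //= [\sum_i g i * H o i ^+ 2](bigD1 o) //=.
have -> : (5 / 4 * d o ^+ 2 - 1) * (g o * H o o ^+ 2 + \sum_(i | i != o) g i * H o i ^+ 2)
  = (5 / 4 * d o ^+ 2 - 1) * (g o ^+ 2 * (1 + d o ^+ 2) * H o o ^+ 2) +
    (5 / 4 * d o ^+ 2 - 1) * (\sum_(i | i != o) g i * H o i ^+ 2).
  by rewrite gk mulrDr.
set S1 := \sum_(k | k != o) d k * _ * _; set S2 := \sum_(k | k != o) _ * (d o + d k) * _.
set S3 := \sum_(k | k != o) 2 * tilt k * _; set S4 := \sum_(k | k != o) _ * (2 * _ * _).
set S5 := \sum_(k | k != o) g k * _; set SC := \sum_i g i * C i; set SG := \sum_i g i * G i.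
move=> h1 h2 h3 h4; lra.
Qed.

End Jacobi.

(** * Directional derivatives and the chain rule *)

Section LineCalculus.
Variables (R : realType) (n : nat).
Implicit Types (f : 'rV[R]_n -> R) (x v h : 'rV[R]_n) (U : set 'rV[R]_n).

Lemma coord_le_norm h j : `|h 0 j| <= `|h|.
Proof.
rewrite [leRHS]mx_normrE.
by apply: (le_trans _ (le_bigmax _ (fun ij : 'I_1 * 'I_n => `|h ij.1 ij.2|) (0, j))).
Qed.

Lemma norm_le_coord h (r : R) : 0 <= r -> (forall j, `|h 0 j| <= r) -> `|h| <= r.
Proof.
move=> r0 hr; rewrite [leLHS]mx_normrE; apply/bigmax_leP; split => // -[i j] _ /=.
by rewrite ord1.
Qed.

Lemma near_norm_ball x (P : 'rV[R]_n -> Prop) : (\forall y \near x, P y) ->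
  exists2 e : R, 0 < e & forall y, `|y - x| < e -> P y.
Proof.
move=> /nbhs_normP[e /= e0 he]; exists e => // y xy; apply: he.
by rewrite /= distrC.
Qed.

Lemma is_derive_line f x v (t : R) : derivable f (x + t *: v) v ->
  is_derive t 1 (fun s : R => f (x + s *: v)) ('D_v f (x + t *: v)).
Proof.
move=> df.
have E : (fun h : R => h^-1 *: (f (x + (h *: 1 + t) *: v) - f (x + t *: v))) =
         (fun h : R => h^-1 *: (f (h *: v + (x + t *: v)) - f (x + t *: v))).
  by apply/funext => h; rewrite scalerDl [h *: 1]mulr1 addrCA.
by split; rewrite /derivable /derive /= E.
Qed.

(** Derivative in the direction [v], made linear in [v] by definition; it agrees
  with ['D_v] on functions that are C^1. *)
Definition dd v f x : R := \sum_j v 0 j * partial j f x.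

Lemma mvt_line f x v (a : R) :
  (forall t : R, `|t| <= `|a| -> derivable f (x + t *: v) v) ->
  exists2 c : R, `|c| <= `|a| & f (x + a *: v) - f x = a * 'D_v f (x + c *: v).
Proof.
move=> df; pose g (s : R) := f (x + s *: v).
pose dg (s : R) := 'D_v f (x + s *: v).
have dgE (s : R) : `|s| <= `|a| -> is_derive s 1 g (dg s).
  by move=> sa; apply: is_derive_line; exact: df.
have g0 : g 0 = f x by rewrite /g scale0r addr0.
have cont (b c : R) : (forall s, s \in `[b, c] -> `|s| <= `|a|) ->
    {within `[b, c], continuous g}.
  move=> h; apply: derivable_within_continuous => s /h sa.
  by have [] := dgE _ sa.
have [a0|a0] := leP 0 a.
  have sa (s : R) : s \in `[0, a] -> `|s| <= `|a|.
    by rewrite in_itv /= => /andP[s0 ?]; rewrite !ger0_norm.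
  have [s|c /sa ca] := @MVT_segment R g dg 0 a a0 _ (cont _ _ sa).
    by move=> /subset_itv_oo_cc /sa; exact: dgE.
  by rewrite g0 subr0 mulrC => e; exists c.
have sa (s : R) : s \in `[a, 0] -> `|s| <= `|a|.
  by rewrite in_itv /= => /andP[s0 ?]; rewrite !ler0_norm ?lerN2 // ltW.
have [s|c /sa ca] := @MVT_segment R g dg a 0 (ltW a0) _ (cont _ _ sa).
  by move=> /subset_itv_oo_cc /sa; exact: dgE.
by rewrite g0 sub0r => e; exists c => //; rewrite -/(g a) -opprB e /dg; ring.
Qed.

(** Consecutive truncations differ in one coordinate only. *)
Definition trunc h (k : nat) : 'rV[R]_n := \row_j (if (j < k)%N then h 0 j else 0).

Lemma trunc0 h : trunc h 0 = 0.
Proof. by apply/rowP => j; rewrite !mxE. Qed.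

Lemma truncn h : trunc h n = h.
Proof. by apply/rowP => j; rewrite !mxE ltn_ord. Qed.

Lemma truncS h (k : 'I_n) : trunc h k.+1 = trunc h k + h 0 k *: delta_mx 0 k.
Proof.
apply/rowP => j; rewrite !mxE eqxx /= ltnS leq_eqVlt -val_eqE.
have [/eqP/val_inj->|jk] := boolP (val j == val k).
  by rewrite ltnn /= mulr1 add0r.
by rewrite /= mulr0 addr0.
Qed.

(** Continuity of the partial derivatives gives strict differentiability: the
  increment is a sum of increments along the axes, and the mean value theorem
  applies to each. *)
Lemma differentiable_estimate f x (e : R) : 0 < e ->
  (\forall y \near x, forall i, derivable f y (delta_mx 0 i)) ->
  (forall i, {for x, continuous (partial i f)}) ->
  exists2 r : R, 0 < r & forall h, `|h| < r ->
    `|f (x + h) - f x - dd h f x| <= n%:R * (e * `|h|).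
Proof.
move=> e0 df cf.
have cA : \forall y \near x, forall i : 'I_n, `|partial i f x - partial i f y| <= e.
  by apply: (@filter_forall _ _ _ (nbhs x)) => i; move/cvgrPdist_le: (cf i); exact.
have : \forall y \near x, forall i, derivable f y (delta_mx 0 i) /\
    `|partial i f x - partial i f y| <= e.
  by apply: filterS2 df cA => y h1 h2 i; split; [exact: h1|exact: h2].
move=> /near_norm_ball[r r0 hr]; exists r => // h hr0.
have E : f (x + h) - f x = \sum_(k < n) (f (x + trunc h k.+1) - f (x + trunc h k)).
  rewrite -(big_mkord xpredT (fun k => f (x + trunc h k.+1) - f (x + trunc h k))).
  by rewrite telescope_sumr // trunc0 truncn addr0.
rewrite E /dd -sumrB; apply: le_trans (ler_norm_sum _ _ _) _.
have -> : n%:R * (e * `|h|) = \sum_(k < n) e * `|h|.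
  by rewrite sumr_const card_ord mulr_natl.
apply: ler_sum => k _; rewrite truncS addrA.
have near_k (t : R) : `|t| <= `|h 0 k| -> `|x + trunc h k + t *: delta_mx 0 k - x| < r.
  move=> th; apply: le_lt_trans hr0; rewrite addrAC [x + _]addrC addrK; apply: norm_le_coord => // j.
  rewrite !mxE eqxx /=; have [->|jk] := eqVneq j k.
    by rewrite ltnn add0r mulr1 (le_trans th) // coord_le_norm.
  rewrite mulr0 addr0; case: ifP => _; first exact: coord_le_norm.
  by rewrite normr0.
have [t th|c ch ->] := @mvt_line f (x + trunc h k) (delta_mx 0 k) (h 0 k).
  by have [] := hr _ (near_k _ th) k.
rewrite -mulrBr normrM mulrC; apply: ler_pM => //; last exact: coord_le_norm.
rewrite distrC; by have [] := hr _ (near_k _ ch) k.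
Qed.

Lemma is_derive_dd f x v :
  (\forall y \near x, forall i, derivable f y (delta_mx 0 i)) ->
  (forall i, {for x, continuous (partial i f)}) ->
  is_derive x v f (dd v f x).
Proof.
move=> df cf.
suff C : (fun h : R => h^-1 *: (f (h *: v + x) - f x)) @ 0^' --> dd v f x.
  split; first by apply/cvg_ex; exists (dd v f x).
  exact/cvg_lim.
apply/cvgrPdist_le => /= e e0.
pose M := n%:R * (`|v| + 1) + 1.
have M0 : 0 < M by rewrite /M ltr_wpDl // mulr_ge0 // addr_ge0.
have [r r0 hr] := differentiable_estimate (divr_gt0 e0 M0) df cf.
near=> h.
have h0 : h != 0 by near: h; exact: nbhs_dnbhs_neq.
have hv : `|h *: v| < r.
  rewrite normrZ; apply: (@le_lt_trans _ _ (`|h| * (`|v| + 1))).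
    by rewrite ler_wpM2l // lerDl.
  rewrite -ltr_pdivlMr ?ltr_wpDl//.
  by near: h; apply: dnbhs0_lt; rewrite divr_gt0 // ltr_wpDl.
have := hr _ hv; rewrite (addrC x).
have -> : dd (h *: v) f x = h * dd v f x.
  by rewrite /dd mulr_sumr; apply: eq_bigr => j _; rewrite mxE mulrA.
have -> : dd v f x - h^-1 *: (f (h *: v + x) - f x) =
   - (h^-1 * (f (h *: v + x) - f x - h * dd v f x)).
  by rewrite mulrBr mulrA mulVf // mul1r opprB.
move=> H; rewrite normrN normrM normfV ler_pdivrMl ?normr_gt0//.
apply: (le_trans H); rewrite normrZ.
have -> : n%:R * (e / M * (`|h| * `|v|)) = `|h| * e * (n%:R * `|v| / M).
  by move: (M^-1) (`|v| : R) (`|h| : R) => a b c; ring.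
rewrite ler_piMr ?mulr_ge0 ?(ltW e0)// ler_pdivrMr // mul1r /M mulrDr.
by rewrite -addrA lerDl addr_ge0 // mulr1.
Unshelve. all: by end_near. Qed.

End LineCalculus.

(** * Calculus of smooth functions on open sets *)

Section SmoothFunctions.
Variables (R : realType) (n : nat) (U : set 'rV[R]_n).
Hypothesis oU : open U.
Implicit Types (f g : 'rV[R]_n -> R) (x v a b : 'rV[R]_n).

Lemma open_near x (P : 'rV[R]_n -> Prop) : U x -> (forall y, U y -> P y) ->
  \forall y \near x, P y.
Proof. by move=> Ux h; apply: filterS (open_nbhs_nbhs (conj oU Ux)). Qed.

Lemma smooth_continuous f x : smooth_on U f -> U x -> {for x, continuous f}.
Proof. by move=> sf Ux; have [] := sf [::] x Ux. Qed.

Lemma smooth_partial f i : smooth_on U f -> smooth_on U (partial i f).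
Proof.
move=> sf s x Ux; have := sf (s ++ [:: i]) x Ux.
by rewrite /partials foldr_cat.
Qed.

Lemma partials_eq f g s : (forall x, U x -> f x = g x) ->
  forall x, U x -> partials s f x = partials s g x.
Proof.
move=> fg; elim: s => [|i s IH] x Ux; first exact: fg.
by apply: near_eq_derive; apply: (open_near Ux).
Qed.

Lemma smooth_is_derive f x v : smooth_on U f -> U x -> is_derive x v f (dd v f x).
Proof.
move=> sf Ux; apply: is_derive_dd.
  by apply: (open_near Ux) => y Uy i; have [_] := sf [::] y Uy; apply.
by move=> i; have [] := sf [:: i] x Ux.
Qed.

Lemma smooth_line f x v (t : R) : smooth_on U f -> U (x + t *: v) ->
  is_derive t 1 (fun s : R => f (x + s *: v)) (dd v f (x + t *: v)).
Proof.
move=> sf Ux; have D := smooth_is_derive v sf Ux.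
by case: D => df <-; exact: is_derive_line.
Qed.

Lemma dd_eq f g v x : (forall y, U y -> f y = g y) -> U x -> dd v f x = dd v g x.
Proof.
move=> fg Ux; apply: eq_bigr => j _; congr (_ * _).
exact: (partials_eq [:: j] fg Ux).
Qed.

Lemma partials_lincomb m (c : 'I_m -> R) (F : 'I_m -> 'rV[R]_n -> R) s x :
  (forall j, smooth_on U (F j)) -> U x ->
  partials s (fun y => \sum_j c j * F j y) x = \sum_j c j * partials s (F j) x.
Proof.
move=> sF; elim: s x => [//|i s IH] x Ux.
rewrite /= /partial (near_eq_derive _ (g := fun y => \sum_j c j * partials s (F j) y)).
  rewrite -(fct_sumE _ _ (fun j y => c j * partials s (F j) y)).
  rewrite derive_sum; last first.
    by move=> j; apply: derivableM => //; have [_] := sF j s x Ux; exact.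
  apply: eq_bigr => j _; rewrite deriveMl//.
  by have [_] := sF j s x Ux; exact.
by apply: (open_near Ux).
Qed.

Lemma smooth_lincomb m (c : 'I_m -> R) (F : 'I_m -> 'rV[R]_n -> R) :
  (forall j, smooth_on U (F j)) -> smooth_on U (fun y => \sum_j c j * F j y).
Proof.
move=> sF s x Ux.
have E : \forall y \near x, (\sum_j c j * partials s (F j) y) =
   partials s (fun y => \sum_j c j * F j y) y.
  by apply: (open_near Ux) => y Uy; rewrite partials_lincomb.
split=> [|i].
  rewrite /prop_for /continuous_at partials_lincomb //.
  apply: cvg_trans (_ : (fun y => \sum_j c j * partials s (F j) y) @ x --> _).
    exact: near_eq_cvg E.
  apply: (@continuous_sumr _ _ _ _ (fun j y => c j * partials s (F j) y) x) => j.
  by apply: continuousM; [exact: cst_continuous|have [] := sF j s x Ux].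
apply: near_eq_derivable E _.
rewrite -(fct_sumE _ _ (fun j y => c j * partials s (F j) y)).
apply: derivable_sum => j; apply: derivableM => //.
by have [_] := sF j s x Ux; exact.
Qed.

Lemma smooth_dd f v : smooth_on U f -> smooth_on U (dd v f).
Proof. by move=> sf; apply: smooth_lincomb => j; exact: smooth_partial. Qed.

Lemma dd_lincomb m (c : 'I_m -> R) (F : 'I_m -> 'rV[R]_n -> R) v x :
  (forall j, smooth_on U (F j)) -> U x ->
  dd v (fun y => \sum_j c j * F j y) x = \sum_j c j * dd v (F j) x.
Proof.
move=> sF Ux; transitivity (\sum_i \sum_j c j * (v 0 i * partial i (F j) x)).
  apply: eq_bigr => i _; rewrite [partial i _ x](partials_lincomb c [:: i] sF Ux).
  by rewrite mulr_sumr; apply: eq_bigr => j _; rewrite mulrCA.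
rewrite exchange_big; apply: eq_bigr => j _.
by rewrite /dd mulr_sumr.
Qed.

Lemma ddZ f a (c : R) x : dd (c *: a) f x = c * dd a f x.
Proof. by rewrite /dd mulr_sumr; apply: eq_bigr => j _; rewrite mxE mulrA. Qed.

(** Linearity in the inner direction: the coefficients [c i] are constants for
  the outer derivative. *)
Lemma dd_dd_sum (I : finType) (c : I -> R) (a : I -> 'rV[R]_n) f v x :
  smooth_on U f -> U x ->
  dd v (dd (\sum_i c i *: a i) f) x = \sum_i c i * dd v (dd (a i) f) x.
Proof.
move=> sf Ux.
have -> : dd v (dd (\sum_i c i *: a i) f) x =
   \sum_j (\sum_i c i *: a i) 0 j * dd v (partial j f) x.
  exact: dd_lincomb (fun j => smooth_partial j sf) Ux.
under eq_bigr do rewrite summxE mulr_suml.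
rewrite exchange_big; apply: eq_bigr => i _.
have -> := dd_lincomb (fun j => a i 0 j) v (fun j => smooth_partial j sf) Ux.
by rewrite mulr_sumr; apply: eq_bigr => j _; rewrite mxE mulrA.
Qed.

Lemma is_derive_translate f w x v df : is_derive (x + w) v f df ->
  is_derive x v (fun y => f (y + w)) df.
Proof.
move=> [df1 df2].
have E : (fun h : R => h^-1 *: (f (h *: v + x + w) - f (x + w))) =
         (fun h : R => h^-1 *: (f (h *: v + (x + w)) - f (x + w))).
  by apply/funext => h; rewrite addrA.
by split; [rewrite /derivable|rewrite -df2 /derive]; rewrite E.
Qed.

(** The mean value theorem, first along [a] and then along [b]. *)
Lemma second_difference f x a b (t : R) : smooth_on U f ->
  (forall c c' : R, `|c| <= `|t| -> `|c'| <= `|t| -> U (x + c *: a + c' *: b)) ->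
  exists c c' : R, [/\ `|c| <= `|t|, `|c'| <= `|t| &
    f (x + t *: a + t *: b) - f (x + t *: a) - (f (x + t *: b) - f x)
      = t ^+ 2 * dd b (dd a f) (x + c *: a + c' *: b)].
Proof.
move=> sf Uab; pose F z := f (z + t *: b) - f z.
have U0 c : `|c| <= `|t| -> U (x + c *: a).
  by move=> ct; have := Uab c 0 ct; rewrite normr0 scale0r addr0; exact.
have dF c : `|c| <= `|t| ->
    is_derive (x + c *: a) a F (dd a f (x + c *: a + t *: b) - dd a f (x + c *: a)).
  move=> ct; apply: is_deriveB.
    by apply: is_derive_translate; apply: smooth_is_derive => //; exact: Uab.
  by apply: smooth_is_derive => //; exact: U0.
have [c ct|c ct e1] := @mvt_line R n F x a t; first by have [] := dF _ ct.
have {dF} dF := dF _ ct.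
have [c' c't|c' c't e2] := @mvt_line R n (dd a f) (x + c *: a) b t.
  by have [] := smooth_is_derive b (smooth_dd a sf) (Uab _ _ ct c't).
exists c, c'; split => //; rewrite -[LHS]/(F (x + t *: a) - F x) e1.
rewrite derive_val e2 mulrA -expr2; congr (_ * _).
have D := smooth_is_derive b (smooth_dd a sf) (Uab _ _ ct c't).
by rewrite derive_val.
Qed.

(** Both mixed derivatives at nearby points equal one and the same second
  difference quotient; let the step tend to 0. *)
Lemma dd_comm f x a b : smooth_on U f -> U x -> dd a (dd b f) x = dd b (dd a f) x.
Proof.
move=> sf Ux.
have sab := smooth_dd a (smooth_dd b sf); have sba := smooth_dd b (smooth_dd a sf).
apply/eqP; rewrite eq_sym -subr_eq0 -normr_le0; apply/ler_addgt0Pl => e e0.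
rewrite addr0; have e2 : 0 < e / 2 by lra.
have /cvgrPdist_le/(_ _ e2) c1 := smooth_continuous sab Ux.
have /cvgrPdist_le/(_ _ e2) c2 := smooth_continuous sba Ux.
have [r r0 hr] := near_norm_ball (filterI (open_nbhs_nbhs (conj oU Ux)) (filterI c1 c2)).
pose M := `|a| + `|b| + 1; have M0 : 0 < M by rewrite /M ltr_wpDl // addr_ge0.
pose t := r / 2 / M; have t0 : 0 < t by rewrite !divr_gt0.
have near_t c c' : `|c| <= `|t| -> `|c'| <= `|t| -> `|x + c *: a + c' *: b - x| < r.
  move=> ct c't; rewrite addrAC [x + _]addrC addrK.
  apply: le_lt_trans (ler_normD _ _) _; rewrite !normrZ.
  apply: (@le_lt_trans _ _ (t * `|a| + t * `|b|)).
    by apply: lerD; apply: ler_wpM2r => //; rewrite -(gtr0_norm t0).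
  have : t * M = r / 2 by rewrite /t divfK // gt_eqF.
  by rewrite /M !mulrDr mulr1 => h; lra.
have [c|c [c' [ct c't e1]]] := @second_difference f x a b t sf.
  by move=> c' ct c't; have [] := hr _ (near_t _ _ ct c't).
have near_t' k k' : `|k| <= `|t| -> `|k'| <= `|t| -> `|x + k *: b + k' *: a - x| < r.
  by move=> kt k't; rewrite (addrAC x (k *: b)); exact: near_t.
have [k|k [k' [kt k't e3]]] := @second_difference f x b a t sf.
  by move=> k' kt k't; have [] := hr _ (near_t' _ _ kt k't).
have e4 : dd b (dd a f) (x + c *: a + c' *: b) = dd a (dd b f) (x + k *: b + k' *: a).
  have tn : t ^+ 2 != 0 by rewrite expf_neq0 // gt_eqF.
  move: e1 e3; rewrite (addrAC x (t *: b) (t *: a)).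
  move: (dd b _ _) (dd a _ _) => p q.
  move: (f _) (f _) (f _) (f _) => f1 f2 f3 f4 e1 e3.
  by apply: (mulfI tn); rewrite -e1 -e3; ring.
have [_ [_ h1]] := hr _ (near_t _ _ ct c't).
have [_ [h2 _]] := hr _ (near_t' _ _ kt k't).
move: h1 h2; rewrite e4.
move: (dd a _ (_ + _)) (dd a _ x) (dd b _ x) => p q s h1 h2.
have -> : s - q = (s - p) - (q - p) by ring.
by apply: le_trans (ler_normB _ _) _; rewrite [leRHS]splitr; exact: lerD.
Qed.

Lemma dd_comm_in f v a b x : smooth_on U f -> U x ->
  dd v (dd a (dd b f)) x = dd v (dd b (dd a f)) x.
Proof.
move=> sf Ux; have C y (Uy : U y) := dd_comm a b sf Uy.
exact: (dd_eq v C Ux).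
Qed.

End SmoothFunctions.

(** * Derivatives of curves of matrices *)

Section MatrixCurves.
Variable R : realType.

Lemma is_derive_sumr (I : Type) (r : seq I) (f : I -> R -> R) (df : I -> R) (t : R) :
  (forall i, is_derive t 1 (f i) (df i)) ->
  is_derive t 1 (fun s => \sum_(i <- r) f i s) (\sum_(i <- r) df i).
Proof.
move=> h; elim: r => [|i r IH].
  rewrite big_nil; under eq_fun do rewrite big_nil; exact: is_derive_cst.
by rewrite big_cons; under eq_fun do rewrite big_cons; apply: is_deriveD.
Qed.

Lemma derivable_prodr (I : Type) (r : seq I) (f : I -> R -> R) (t : R) :
  (forall i, derivable (f i) t 1) -> derivable (fun s => \prod_(i <- r) f i s) t 1.
Proof.
move=> h; elim: r => [|i r IH].
  under eq_fun do rewrite big_nil; exact: derivable_cst.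
have -> : (fun s => \prod_(j <- i :: r) f j s) =
    (fun s => f i s * \prod_(j <- r) f j s) by apply/funext => s; rewrite big_cons.
exact: derivableM.
Qed.

Lemma derivable_sumr (I : Type) (r : seq I) (f : I -> R -> R) (t : R) :
  (forall i, derivable (f i) t 1) -> derivable (fun s => \sum_(i <- r) f i s) t 1.
Proof.
by move=> h; have [] := is_derive_sumr r (fun i => derivableP (h i)).
Qed.

Definition mder m n (t : R) (M : R -> 'M[R]_(m, n)) (M' : 'M[R]_(m, n)) : Prop :=
  forall i j, is_derive t 1 (fun s => M s i j) (M' i j).

Lemma mder_unique m n t (M : R -> 'M[R]_(m, n)) M1 M2 :
  mder t M M1 -> mder t M M2 -> M1 = M2.
Proof.
move=> h1 h2; apply/matrixP => i j.
by rewrite -(@derive_val _ _ _ _ _ _ _ (h1 i j)) -(@derive_val _ _ _ _ _ _ _ (h2 i j)).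
Qed.

Lemma mder_mul m n p t (M : R -> 'M[R]_(m, n)) (N : R -> 'M[R]_(n, p)) M' N' :
  mder t M M' -> mder t N N' -> mder t (fun s => M s *m N s) (M' *m N t + M t *m N').
Proof.
move=> hM hN i j.
have -> : (fun s => (M s *m N s) i j) = (fun s => \sum_k M s i k * N s k j).
  by apply/funext => s; rewrite mxE.
have -> : (M' *m N t + M t *m N') i j = \sum_k (M t i k * N' k j + N t k j * M' i k).
  rewrite !mxE -big_split; apply: eq_bigr => k _ /=; ring.
by apply: is_derive_sumr => k; apply: is_deriveM.
Qed.

Lemma mder_add m n t (M N : R -> 'M[R]_(m, n)) M' N' :
  mder t M M' -> mder t N N' -> mder t (fun s => M s + N s) (M' + N').
Proof.
move=> hM hN i j; rewrite mxE; under eq_fun do rewrite mxE.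
exact: is_deriveD.
Qed.

Lemma mder_trace n t (M : R -> 'M[R]_n) M' : mder t M M' ->
  is_derive t 1 (fun s => \tr (M s)) (\tr M').
Proof. by move=> hM; apply: is_derive_sumr => i; exact: hM. Qed.

Lemma mder_cst m n t (M : 'M[R]_(m, n)) : mder t (fun=> M) 0.
Proof. by move=> i j; rewrite mxE; exact: is_derive_cst. Qed.

Lemma near_eq_mder m n t (M N : R -> 'M[R]_(m, n)) M' :
  (\forall s \near t, M s = N s) -> mder t M M' -> mder t N M'.
Proof.
move=> MN hM i j; apply: near_eq_is_derive (hM i j).
by apply: filterS MN => s ->.
Qed.

Lemma mder_trace0 n t (M : R -> 'M[R]_n) M' :
  mder t M M' -> (\forall s \near t, \tr (M s) = 0) -> \tr M' = 0.
Proof.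
move=> hM tr0; have [_ <-] := mder_trace hM.
have [_ ] : is_derive t 1 (fun s => \tr (M s)) 0; last by [].
apply: near_eq_is_derive (is_derive_cst (0 : R) t 1).
by apply: filterS tr0 => s ->.
Qed.

Lemma derivable_det n t (M : R -> 'M[R]_n) :
  (forall i j, derivable (fun s => M s i j) t 1) -> derivable (fun s => \det (M s)) t 1.
Proof.
move=> hM; rewrite /determinant; apply: derivable_sumr => s.
by apply: derivableM; [exact: derivable_cst|exact: derivable_prodr].
Qed.

(** The adjugate formula shows that the entries of the inverse are
  differentiable, and the product rule for [invmx (M s) *m M s = 1] then gives
  their derivatives. *)
Lemma mder_invmx n t (M : R -> 'M[R]_n) M' :
  (\forall s \near t, M s \in unitmx) -> mder t M M' ->
  mder t (fun s => invmx (M s)) (- (invmx (M t) *m M' *m invmx (M t))).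
Proof.
move=> uM hM.
have dM i j : derivable (fun s => M s i j) t 1 by have [] := hM i j.
have ut : M t \in unitmx by exact: nbhs_singleton uM.
have dI i j : derivable (fun s => invmx (M s) i j) t 1.
  apply: (@near_eq_derivable _ _ _ (fun s => (\det (M s))^-1 * cofactor (M s) j i)).
    by apply: filterS uM => s us; rewrite /invmx us !mxE.
  apply: derivableM.
    apply: derivableV; first by have := ut; rewrite unitmxE unitfE.
    exact: derivable_det.
  apply: derivableM; first exact: derivable_cst.
  apply: derivable_det => k l.
  by under eq_fun do rewrite !mxE; exact: dM.
pose I' := \matrix_(i, j) 'D_1 (fun s => invmx (M s) i j) t.
have hI : mder t (fun s => invmx (M s)) I'.
  by move=> i j; rewrite mxE; exact: derivableP.
have : I' *m M t + invmx (M t) *m M' = 0.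
  apply: (mder_unique (mder_mul hI hM)).
  apply: near_eq_mder (mder_cst t (1%:M : 'M[R]_n)).
  by apply: filterS uM => s us; rewrite mulVmx.
move/(congr1 (mulmx^~ (invmx (M t)))) => /=; rewrite mulmxDl -(mulmxA I') mulmxV // mulmx1 mul0mx.
by move/eqP; rewrite addr_eq0 => /eqP <-.
Qed.

Lemma derive_at_min (f : R -> R) (t l : R) : is_derive t 1 f l ->
  (\forall s \near t, f t <= f s) -> l = 0.
Proof.
move=> [df dl] mf; apply/eqP/negPn/negP => l0.
have C : (fun h : R => h^-1 *: (f (h *: 1 + t) - f t)) @ 0^' --> l.
  by rewrite -dl; exact: df.
have l1 : 0 < `|l| by rewrite normr_gt0.
have /cvgrPdist_lt/(_ _ l1) := C.
move=> [/= r r0 hr]; have [r' r'0 hr'] : exists2 r' : R, 0 < r' &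
    forall s, `|s - t| < r' -> f t <= f s.
  move: mf => /nbhs_normP[r' /= r'0 hr']; exists r' => // s st.
  by apply: hr'; rewrite /= distrC.
(* a small step against the sign of the derivative *)
pose h := - Num.sg l * (Num.min r r' / 2).
have m0 : 0 < Num.min r r' by rewrite lt_min r0.
have hn : `|h| = Num.min r r' / 2.
  by rewrite /h mulNr normrN normrM normr_sg l0 mul1r gtr0_norm // divr_gt0.
have h0 : h != 0 by rewrite -normr_eq0 hn gt_eqF // divr_gt0.
have hm : `|h| < Num.min r r' by rewrite hn; lra.
have hrr : `|h| < r by apply: lt_le_trans hm _; rewrite ge_min lexx.
have f0 : 0 <= f (h *: 1 + t) - f t.
  rewrite subr_ge0; apply: hr'; rewrite addrK [h *: 1]mulr1.
  by apply: lt_le_trans hm _; rewrite ge_min lexx orbT.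
have : `|l - h^-1 * (f (h *: 1 + t) - f t)| < `|l|.
  by apply: (hr h) => //=; rewrite sub0r normrN.
apply/negP; rewrite -leNgt.
have e : h^-1 = - Num.sg l * (Num.min r r' / 2)^-1.
  rewrite /h invfM invrN; congr (- _ * _).
  by move: l0; rewrite -sgr_eq0; case: sgrP => _; rewrite ?eqxx ?invr1 ?invrN1.
have mm : 0 < (Num.min r r' / 2)^-1 by rewrite invr_gt0 divr_gt0.
rewrite e -mulrA !mulNr opprK.
have p0 := mulr_ge0 (ltW mm) f0; move: (_ * _) p0 => p p0.
by case: sgrP l0 => [->|l2|l2] _; rewrite ?eqxx ?mul1r ?mulN1r //;
  [rewrite !gtr0_norm|rewrite !ltr0_norm]; lra.
Qed.

End MatrixCurves.

(** * Euclidean balls *)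

Section EuclideanBalls.
Variables (R : realType) (n : nat).
Implicit Types x y p : 'rV[R]_n.

Lemma continuous_dot_sub p : continuous (fun x : 'rV[R]_n => dot (x - p) (x - p)).
Proof.
have -> : (fun x => dot (x - p) (x - p)) =
    (fun x : 'rV[R]_n => \sum_j (x 0 j - p 0 j) * (x 0 j - p 0 j)).
  by apply/funext => x; rewrite dotE; apply: eq_bigr => j _; rewrite !mxE.
move=> x; apply: continuous_sumr => j.
have c : {for x, continuous (fun y : 'rV[R]_n => y 0 j - p 0 j)}.
  by apply: continuousB; [exact: coord_continuous|exact: cst_continuous].
exact: continuousM.
Qed.

Lemma eballE p (r : R) x : 0 < r -> eball p r x <-> dot (x - p) (x - p) < r ^+ 2.
Proof.
move=> r0; rewrite /eball /= l2norm_row -{1}(ger0_norm (ltW r0)) -sqrtr_sqr.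
by rewrite ltr_sqrt // exprn_gt0.
Qed.

Lemma open_eball p (r : R) : 0 < r -> open (eball p r).
Proof.
move=> r0; have -> : eball p r = (fun x => dot (x - p) (x - p)) @^-1` [set s | s < r ^+ 2].
  by apply/seteqP; split => x /(eballE _ _ r0).
apply: open_comp; last exact: open_lt.
by move=> x _; exact: continuous_dot_sub.
Qed.

End EuclideanBalls.

(** * The Hessian and the variations of the equation *)

Section Hessian.
Variables (R : realType) (n : nat) (U : set 'rV[R]_n) (u : 'rV[R]_n -> R).
Hypotheses (oU : open U) (su : smooth_on U u).
Implicit Types x v w a b : 'rV[R]_n.

Let sij i j : smooth_on U (partial i (partial j u)).
Proof. by do 2!apply: smooth_partial. Qed.

(** Nested so as to match an iterated directional derivative term by term. *)
Definition bilin (M : 'M[R]_n) a b : R := \sum_i a 0 i * \sum_j b 0 j * M i j.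

Lemma bilinE (M : 'M[R]_n) a b : bilin M a b = dot (a *m M) b.
Proof.
rewrite dotE /bilin; under eq_bigr do rewrite mulr_sumr.
rewrite exchange_big; apply: eq_bigr => j _; rewrite mxE mulr_suml.
by apply: eq_bigr => i _; ring.
Qed.

Lemma bilin_rows (P M : 'M[R]_n) i k : bilin M (row i P) (row k P) = (P *m M *m P^T) i k.
Proof.
rewrite bilinE dotE mxE; apply: eq_bigr => j _.
by rewrite !mxE; congr (_ * _); apply: eq_bigr => l _; rewrite mxE.
Qed.

Lemma trace_diag_frame (P M : 'M[R]_n) (g : 'rV[R]_n) :
  \tr (P^T *m diag_mx g *m P *m M) = \sum_i g 0 i * (P *m M *m P^T) i i.
Proof.
rewrite -(mulmxA _ P) -(mulmxA P^T) mxtrace_mulC -(mulmxA (diag_mx g)).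
by apply: eq_bigr => i _; rewrite mul_diag_mx [LHS]mxE.
Qed.

Definition hessian' v x : 'M[R]_n := \matrix_(i, j) dd v (partial i (partial j u)) x.
Definition hessian'' w v x : 'M[R]_n :=
  \matrix_(i, j) dd w (dd v (partial i (partial j u))) x.

Lemma dd_hessian a b x : U x -> dd a (dd b u) x = bilin (hessian u x) a b.
Proof.
move=> Ux; apply: eq_bigr => i _; congr (_ * _).
rewrite [partial i _ x](partials_lincomb oU _ [:: i] (fun j => smooth_partial j su) Ux).
by apply: eq_bigr => j _; rewrite mxE.
Qed.

Lemma dd_hessian' v a b x : U x -> dd v (dd a (dd b u)) x = bilin (hessian' v x) a b.
Proof.
move=> Ux; rewrite (dd_eq oU v (dd_hessian a b) Ux).
have sF i : smooth_on U (fun y => \sum_j b 0 j * partial i (partial j u) y).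
  exact (smooth_lincomb oU (fun j => b 0 j) (fun j => sij i j)).
have E y : U y -> bilin (hessian u y) a b =
    \sum_i a 0 i * (\sum_j b 0 j * partial i (partial j u) y).
  by move=> Uy; apply: eq_bigr => i _; congr (_ * _); apply: eq_bigr => j _; rewrite mxE.
rewrite (dd_eq oU v E Ux) (dd_lincomb oU _ v sF Ux).
apply: eq_bigr => i _; congr (_ * _).
rewrite (dd_lincomb oU _ v (fun j => sij i j) Ux).
by apply: eq_bigr => j _; rewrite mxE.
Qed.

Lemma dd_hessian'' w v a b x : U x ->
  dd w (dd v (dd a (dd b u))) x = bilin (hessian'' w v x) a b.
Proof.
move=> Ux; rewrite (dd_eq oU w (dd_hessian' v a b) Ux).
have sv i j : smooth_on U (dd v (partial i (partial j u))).
  exact (smooth_dd oU v (sij i j)).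
have sF i : smooth_on U (fun y => \sum_j b 0 j * dd v (partial i (partial j u)) y).
  exact (smooth_lincomb oU (fun j => b 0 j) (fun j => sv i j)).
have E y : U y -> bilin (hessian' v y) a b =
    \sum_i a 0 i * (\sum_j b 0 j * dd v (partial i (partial j u)) y).
  by move=> Uy; apply: eq_bigr => i _; congr (_ * _); apply: eq_bigr => j _; rewrite mxE.
rewrite (dd_eq oU w E Ux) (dd_lincomb oU _ w sF Ux).
apply: eq_bigr => i _; congr (_ * _).
rewrite (dd_lincomb oU _ w (fun j => sv i j) Ux).
by apply: eq_bigr => j _; rewrite mxE.
Qed.

Lemma dd_delta i (f : 'rV[R]_n -> R) x : dd (delta_mx 0 i) f x = partial i f x.
Proof.
rewrite /dd (bigD1 i) //= mxE !eqxx mul1r big1 ?addr0 // => j ji.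
by rewrite mxE (negPf ji) mul0r.
Qed.

Lemma hessian_sym x : U x -> (hessian u x)^T = hessian u x.
Proof.
move=> Ux; apply/matrixP => i j; rewrite !mxE /=.
have E k : dd (delta_mx 0 k) u = partial k u by apply/funext => y; rewrite dd_delta.
by have := dd_comm oU (delta_mx 0 j) (delta_mx 0 i) su Ux; rewrite !dd_delta !E.
Qed.

Lemma hessian_eigenframe x : U x -> exists P d, eigenframe (hessian u x) P d.
Proof. by move=> Ux; exact: spectral_theorem (hessian_sym Ux). Qed.

Lemma near_line x v : U x -> \forall t \near (0 : R), U (x + t *: v).
Proof.
move=> Ux; have c : {for 0, continuous (fun t : R => x + t *: v)}.
  apply: continuousD; first exact: cst_continuous.
  exact: scalel_continuous.
apply: c; rewrite scale0r addr0; exact: open_nbhs_nbhs.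
Qed.

Lemma mder_hessian x v : U x -> mder 0 (fun t => hessian u (x + t *: v)) (hessian' v x).
Proof.
move=> Ux i j; rewrite mxE.
have := @smooth_line R n U oU (partial i (partial j u)) x v 0 (sij i j).
rewrite scale0r addr0 => /(_ Ux) D.
by under eq_fun do rewrite mxE.
Qed.

Lemma mder_hessian' x v w : U x ->
  mder 0 (fun t => hessian' v (x + t *: w)) (hessian'' w v x).
Proof.
move=> Ux i j; rewrite mxE.
have := @smooth_line R n U oU _ x w 0 (smooth_dd oU v (sij i j)).
rewrite scale0r addr0 => /(_ Ux) D.
by under eq_fun do rewrite mxE.
Qed.

Section Equation.
Variable Theta : R.
Hypothesis slag : special_lagrangian_on U Theta u.

Lemma sum_atan_eigenframe x P d : U x -> eigenframe (hessian u x) P d ->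
  \sum_i atan (d 0 i) = Theta.
Proof. by move=> Ux HP; rewrite -(slag Ux) (sum_lambda (@atan R) HP). Qed.

(** The linearised operator annihilates the first derivatives of [u]. Along a
  line the sum of arctangents is constant, so [klein_atan] bounds the
  linear functional [phi] of the increment of the Hessian by the squared norm
  [psi] of that increment, with equality at 0; hence the derivatives of the
  two agree there. *)
Lemma first_variation x P d v : U x -> eigenframe (hessian u x) P d ->
  \sum_i dd v (dd (row i P) (dd (row i P) u)) x / (1 + d 0 i ^+ 2) = 0.
Proof.
move=> Ux HP.
pose D t := hessian u (x + t *: v) - hessian u x.
have DE t : D t = hessian u (x + t *: v) - hessian u x by [].
have mD : mder 0 D (hessian' v x).
  have := mder_add (mder_hessian v Ux) (mder_cst 0 (- hessian u x)).
  by rewrite addr0.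
have D0 : D 0 = 0 by rewrite DE scale0r addr0 subrr.
clearbody D.
pose phi t := \sum_i (P *m D t *m P^T) i i / (1 + d 0 i ^+ 2).
pose psi t := sqr_frobenius (D t).
have phi0 : phi 0 = 0.
  have E0 : P *m D 0 *m P^T = 0 by rewrite D0 mulmx0 mul0mx.
  by rewrite /phi E0; apply: big1 => i _; rewrite mxE mul0r.
have psi0 : psi 0 = 0.
  by rewrite /psi D0; apply: big1 => i _; apply: big1 => j _; rewrite mxE expr0n.
have dphi : is_derive (0 : R) 1 phi (\sum_i (P *m hessian' v x *m P^T) i i / (1 + d 0 i ^+ 2)).
  apply: is_derive_sumr => i.
  have := mder_mul (mder_mul (mder_cst 0 P) mD) (mder_cst 0 P^T).
  rewrite mul0mx add0r mulmx0 addr0 => /(_ i i) h.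
  have := is_deriveM h (is_derive_cst (1 + d 0 i ^+ 2)^-1 (0 : R) 1).
  by rewrite scaler0 add0r [_ *: _]mulrC.
have dpsi : is_derive (0 : R) 1 psi (\sum_(i < n) \sum_(j < n) (0 : R)).
  apply: is_derive_sumr => i; apply: is_derive_sumr => j.
  by have := is_deriveM (mD i j) (mD i j); rewrite D0 mxE scale0r addr0.
have {}dpsi : is_derive (0 : R) 1 psi 0.
  move: dpsi; rewrite (_ : \sum_(i < n) _ = 0) // big1 // => i _.
  by rewrite big1.
(* the sums of arctangents at the two ends of the segment agree *)
have key : \forall t \near (0 : R), phi t <= psi t.
  apply: filterS (near_line v Ux) => t Ut.
  have [Q [b HQ]] := hessian_eigenframe Ut.
  have := klein_atan HP HQ; rewrite -DE (sum_atan_eigenframe Ux HP) (sum_atan_eigenframe Ut HQ).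
  by rewrite subrr sub0r normrN; apply: le_trans; exact: ler_norm.
have /derive_at_min : is_derive (0 : R) 1 (fun t => psi t - phi t)
   (0 - (\sum_i (P *m hessian' v x *m P^T) i i / (1 + d 0 i ^+ 2))).
  exact: is_deriveB.
have h : \forall t \near (0 : R), psi 0 - phi 0 <= psi t - phi t.
  by apply: filterS key => t; rewrite phi0 psi0 subrr subr_ge0.
move=> /(_ h)/eqP; rewrite sub0r oppr_eq0 => /eqP e0; rewrite -[RHS]e0.
by apply: eq_bigr => i _; rewrite dd_hessian' // bilin_rows.
Qed.

Let K x := 1%:M + hessian u x *m hessian u x.

(** The matrix of the linearised operator as [invmx (K x)]: unlike an
  eigenframe, this depends differentiably on [x]. *)
Lemma invmx_eigenframe x P d : eigenframe (hessian u x) P d ->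
  K x \in unitmx /\
  invmx (K x) = P^T *m diag_mx (\row_i (1 + d 0 i ^+ 2)^-1) *m P.
Proof.
move=> [PP HE]; have PP' := mulmx1C PP.
set G := _ *m P.
suff E : K x *m G = 1%:M.
  have uK : K x \in unitmx by case/mulmx1_unit: E.
  by split => //; rewrite -[RHS](mulKmx uK) E mulmx1.
have -> : K x = P^T *m diag_mx (\row_i (1 + d 0 i ^+ 2)) *m P.
  have -> : diag_mx (\row_i (1 + d 0 i ^+ 2)) = 1%:M + diag_mx d *m diag_mx d.
    apply/matrixP => i j; rewrite mul_diag_mx !mxE.
    by case: eqP => [->|_]; rewrite ?mulr1n ?mulr0n; ring.
  rewrite mulmxDr mulmxDl mulmx1 PP' /K HE; congr (_ + _).
  by rewrite !mulmxA -(mulmxA _ P P^T) PP mulmx1.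
rewrite /G !mulmxA -(mulmxA _ P P^T) PP mulmx1 -(mulmxA _ (diag_mx _) (diag_mx _)).
rewrite (_ : diag_mx _ *m diag_mx _ = 1%:M) ?mulmx1 //.
apply/matrixP => i j; rewrite mul_diag_mx !mxE.
case: eqP => [->|_]; rewrite ?mulr1n ?mulr0n ?mulr0// mulfV // gt_eqF //.
by have := sqr_ge0 (d 0 j); lra.
Qed.

Lemma trace_first_variation x v : U x -> \tr (invmx (K x) *m hessian' v x) = 0.
Proof.
move=> Ux; have [P [d HP]] := hessian_eigenframe Ux.
have [_ ->] := invmx_eigenframe HP.
rewrite trace_diag_frame -[RHS](first_variation v Ux HP); apply: eq_bigr => i _.
by rewrite [_ 0 i]mxE mulrC dd_hessian' // bilin_rows.
Qed.

(** Differentiating [trace_first_variation] once more: the second derivatives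
  of the Hessian are balanced by the derivative of [invmx (K x)]. *)
Lemma second_variation x P d v : U x -> eigenframe (hessian u x) P d ->
  \sum_i dd v (dd v (dd (row i P) (dd (row i P) u))) x / (1 + d 0 i ^+ 2) =
  \sum_i \sum_k (1 + d 0 i ^+ 2)^-1 * (1 + d 0 k ^+ 2)^-1 * (d 0 i + d 0 k)
     * dd v (dd (row i P) (dd (row k P) u)) x ^+ 2.
Proof.
move=> Ux HP; pose X t := x + t *: v.
have X0 : X 0 = x by rewrite /X scale0r addr0.
pose H1 := hessian' v x; pose H2 := hessian'' v v x.
have mH : mder 0 (fun t => hessian u (X t)) H1 by exact: mder_hessian.
have mH' : mder 0 (fun t => hessian' v (X t)) H2 by exact: mder_hessian'.
have mK : mder 0 (fun t => K (X t)) (H1 *m hessian u x + hessian u x *m H1).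
  have := mder_add (mder_cst 0 1%:M) (mder_mul mH mH).
  by rewrite add0r X0.
have uK : \forall t \near (0 : R), K (X t) \in unitmx.
  apply: filterS (near_line v Ux) => t Ut; have [Q [b HQ]] := hessian_eigenframe Ut.
  by have [] := invmx_eigenframe HQ.
have nX : \forall t \near (0 : R), U (X t) by exact: near_line.
clearbody X.
have mT := mder_mul (mder_invmx uK mK) mH'; rewrite X0 in mT.
have nT : \forall t \near (0 : R), \tr (invmx (K (X t)) *m hessian' v (X t)) = 0.
  by apply: filterS nX => t Ut; exact: trace_first_variation.
have E := mder_trace0 mT nT.
have {mT nT} {}E : \tr (invmx (K x) *m H2) = \tr (invmx (K x) *m
    (H1 *m hessian u x + hessian u x *m H1) *m invmx (K x) *m H1).
  move: E; rewrite mulNmx; move: (_ *m H1) (_ *m H2) => A C.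
  rewrite addrC mxtraceD linearN /=.
  by move/eqP; rewrite subr_eq0 => /eqP.
have [PP HE] := HP; have PP' := mulmx1C PP.
pose B := P *m H1 *m P^T; pose g := \row_i (1 + d 0 i ^+ 2)^-1.
have Bik i k : B i k = dd v (dd (row i P) (dd (row k P) u)) x.
  by rewrite dd_hessian' // bilin_rows.
have Bsym i k : B i k = B k i.
  by rewrite !Bik (dd_comm_in oU).
have [_ GE] := invmx_eigenframe HP; rewrite -/g in GE.
have e1 : \tr (invmx (K x) *m H2) =
    \sum_i dd v (dd v (dd (row i P) (dd (row i P) u))) x / (1 + d 0 i ^+ 2).
  rewrite GE trace_diag_frame; apply: eq_bigr => i _.
  by rewrite [g 0 i]mxE mulrC dd_hessian'' // bilin_rows.
have e2 : \tr (invmx (K x) *m (H1 *m hessian u x + hessian u x *m H1) *m invmx (K x) *m H1)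
   = \tr (diag_mx g *m (B *m diag_mx d + diag_mx d *m B) *m diag_mx g *m B).
  have -> : B *m diag_mx d + diag_mx d *m B =
      P *m (H1 *m hessian u x + hessian u x *m H1) *m P^T.
    rewrite /B HE mulmxDr mulmxDl !mulmxA; congr (_ + _).
      by rewrite -(mulmxA _ P P^T) PP mulmx1.
    by rewrite PP mul1mx.
  rewrite GE /B -!mulmxA mxtrace_mulC !mulmxA.
  by [].
clearbody B.
have ldE (c : 'rV[R]_n) (M : 'M[R]_n) i k : (diag_mx c *m M) i k = c 0 i * M i k.
  by rewrite mul_diag_mx mxE.
have rdE (c : 'rV[R]_n) (M : 'M[R]_n) i k : (M *m diag_mx c) i k = M i k * c 0 k.
  by rewrite mul_mx_diag mxE.
have gE i : g 0 i = (1 + d 0 i ^+ 2)^-1 by rewrite mxE.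
rewrite -e1 E e2; apply: eq_bigr => i _.
rewrite -(mulmxA _ (diag_mx g) B) -(mulmxA (diag_mx g)) ldE [X in _ * X]mxE mulr_sumr.
apply: eq_bigr => k _.
rewrite ldE [(B *m _ + _) i k]mxE ldE rdE (Bsym k i) Bik !gE; ring.
Qed.

End Equation.
End Hessian.

(** * The barrier inequality, algebraic part *)

Section BarrierAlgebra.
Variables (R : realType) (n : nat).

(** The parameters of the barrier: [bar_T] is small against [r / L], [bar_B]
  makes [bar_B * l ^+ 2 - bar_T * l - 1] exceed 1 as soon as
  [bar_T * `|l|] is at least [1 / 2], and [bar_K] is large enough for one good
  direction to outweigh the [n] terms bounded below by [- (1 + bar_T)]. *)
Definition bar_T (r L : R) : R := r / (128 * n%:R * (L + 1)).
Definition bar_B (r L : R) : R := 16 * bar_T r L ^+ 2.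
Definition bar_K (r L : R) : R :=
  (n%:R * (1 + bar_T r L) + 1) * (32 * n%:R) / (r ^+ 2 * bar_T r L ^+ 2).

Hypothesis n3 : (3 <= n)%N.

Let N3 : (3 : R) <= n%:R. Proof. by rewrite (ler_nat R 3 n). Qed.

Lemma bar_T_gt0 (r L : R) (r0 : 0 < r) (L0 : 0 <= L) : 0 < bar_T r L.
Proof.
have L1 : 0 < L + 1 by lra.
have N0 : (0 : R) < n%:R by have := N3; lra.
by rewrite /bar_T divr_gt0 // !mulr_gt0.
Qed.

Lemma bar_TE (r L : R) (r0 : 0 < r) (L0 : 0 <= L) : bar_T r L * (128 * n%:R * (L + 1)) = r.
Proof.
have L1 : 0 < L + 1 by lra.
have N0 : (0 : R) < n%:R by have := N3; lra.
by rewrite /bar_T divfK // gt_eqF // !mulr_gt0.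
Qed.

Lemma bar_TL (r L : R) (r0 : 0 < r) (L0 : 0 <= L) : bar_T r L * L <= r / (128 * n%:R).
Proof.
have N0 : (0 : R) < 128 * n%:R by have := N3; lra.
rewrite ler_pdivlMr // -[leRHS](bar_TE r0 L0) -[leLHS]mulrA ler_pM2l ?(bar_T_gt0 r0 L0)//.
by rewrite mulrC ler_pM2l //; lra.
Qed.

Lemma bar_T_le (r L : R) (r0 : 0 < r) (r1 : r <= 1) (L0 : 0 <= L) : bar_T r L <= 1 / 384.
Proof.
have t0 := bar_T_gt0 r0 L0; have e := bar_TE r0 L0; have N := N3.
have : bar_T r L * 384 <= r; last by lra.
rewrite -[leRHS]e ler_pM2l //; nra.
Qed.

Lemma bar_K_gt0 (r L : R) (r0 : 0 < r) (L0 : 0 <= L) : 0 < bar_K r L.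
Proof.
have t0 := bar_T_gt0 r0 L0; have N := N3; rewrite /bar_K; apply: divr_gt0.
  by apply: mulr_gt0; nra.
by rewrite mulr_gt0 // exprn_gt0.
Qed.

(** The gradient of the exponent of the barrier in an eigendirection of
  eigenvalue [l]: its main part vanishes only at [l = - bar_T^-1], and away
  from this value its square is comparable with [1 + l ^+ 2]. *)
Lemma bar_coef (r L : R) (r0 : 0 < r) (r1 : r <= 1) (L0 : 0 <= L)
    (x l w : R) :
  r ^+ 2 <= n%:R * x ^+ 2 -> `|w| <= L ->
  - (2 * bar_T r L)^-1 <= l \/ l <= - (2 / bar_T r L) ->
  r ^+ 2 * bar_T r L ^+ 2 / (32 * n%:R) * (1 + l ^+ 2) <=
    (- x * (1 + bar_T r L * l) + bar_B r L * l * w) ^+ 2.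
Proof.
move=> hx hw hl; have t0 := bar_T_gt0 r0 L0; have N := N3; have T1 := bar_T_le r0 r1 L0.
have N0 : (0 : R) < n%:R by lra.
have a0 := normr_ge0 x; have aE : x ^+ 2 = `|x| ^+ 2 by rewrite real_normK ?num_real.
have [a aX] : exists a : R, a = `|x| by exists `|x|.
rewrite -aX in a0 aE; rewrite aE in hx.
have ra : r <= n%:R * a.
  rewrite -(@ler_pXn2r _ 2) ?nnegrE ?mulr_ge0 ?(ltW r0) ?(ltW N0)// exprMn.
  apply: le_trans hx _; rewrite ler_wpM2r ?sqr_ge0//; nra.
have Tw : bar_B r L * `|w| <= bar_T r L * a / 8.
  rewrite /bar_B; apply: (@le_trans _ _ (16 * bar_T r L * (bar_T r L * L))).
    have -> : 16 * bar_T r L ^+ 2 * `|w| = 16 * bar_T r L * (bar_T r L * `|w|) by ring.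
    have t16 : 0 < 16 * bar_T r L by rewrite mulr_gt0.
    by rewrite (ler_pM2l t16) (ler_pM2l t0).
  apply: (@le_trans _ _ (16 * bar_T r L * (r / (128 * n%:R)))).
    by rewrite ler_pM2l ?(bar_TL r0 L0)//; lra.
  have -> : 16 * bar_T r L * (r / (128 * n%:R)) = bar_T r L * (r / n%:R) / 8.
    by field; rewrite gt_eqF.
  by rewrite ler_pM2r // ler_pM2l // ler_pdivrMr // mulrC.
have B0 : 0 <= bar_B r L by rewrite /bar_B mulr_ge0 // sqr_ge0.
move: (bar_B r L) B0 Tw => B B0 Tw.
move: (bar_T r L) hl t0 T1 Tw => T hl t0 T1 Tw.
have ew : `|B * l * w| <= T * a / 8 * `|l|.
  by rewrite !normrM (ger0_norm B0) mulrAC ler_wpM2r.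
have low m : 0 <= m -> m <= a * `|1 + T * l| - T * a / 8 * `|l| ->
    m ^+ 2 <= (- x * (1 + T * l) + B * l * w) ^+ 2.
  move=> m0 hm; rewrite -[leRHS]real_normK ?num_real//.
  rewrite ler_pXn2r ?nnegrE //; apply: le_trans hm _.
  apply: le_trans (lerB_normD _ _).
  by rewrite mulNr normrN normrM -aX lerB.
have goal m : 0 <= m -> m <= a * `|1 + T * l| - T * a / 8 * `|l| ->
    a ^+ 2 * T ^+ 2 * (1 + l ^+ 2) <= 32 * m ^+ 2 ->
    r ^+ 2 * T ^+ 2 / (32 * n%:R) * (1 + l ^+ 2) <=
    (- x * (1 + T * l) + B * l * w) ^+ 2.
  move=> m0 hm h; apply: le_trans (low _ m0 hm).
  have -> : r ^+ 2 * T ^+ 2 / (32 * n%:R) * (1 + l ^+ 2) =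
     r ^+ 2 / n%:R * (T ^+ 2 * (1 + l ^+ 2)) / 32 by field; rewrite gt_eqF.
  rewrite ler_pdivrMr // mulrC [leRHS]mulrC; apply: le_trans h.
  rewrite -mulrA mulrC ler_wpM2r //.
    by rewrite mulr_ge0 ?sqr_ge0 //; have := sqr_ge0 l; lra.
  by rewrite ler_pdivrMr // mulrC.
(* three regimes: [0 <= l], then [- 1 / 2 <= T * l < 0], then [T * l <= - 2] *)
have [l0|l0] := leP 0 l.
  have Tl : 0 <= T * l by rewrite mulr_ge0 ?(ltW t0).
  have p1 : 0 <= 1 + T * l by lra.
  apply: (goal (a * (T * (1 + l) / 2))).
  - by rewrite !mulr_ge0 ?(ltW t0)//; lra.
  - rewrite (ger0_norm p1) (ger0_norm l0).
    have : 0 <= a * (1 - T / 2 + T * l * (3 / 8)) by rewrite mulr_ge0 //; lra.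
    lra.
  have -> : 32 * (a * (T * (1 + l) / 2)) ^+ 2 = a ^+ 2 * T ^+ 2 * (8 * (1 + l) ^+ 2).
    by field.
  rewrite ler_wpM2l ?mulr_ge0 ?sqr_ge0//; nra.
pose v := - l; have v0 : 0 < v by rewrite oppr_gt0.
have lE : l = - v by rewrite opprK.
have nl : `|l| = v by rewrite ltr0_norm.
have [h|h] := hl.
  have Tv : T * v <= 1 / 2.
    have : v <= (2 * T)^-1 by rewrite lerNl.
    rewrite -(ler_pM2l t0) invfM mulrCA mulfV ?gt_eqF//; lra.
  apply: (goal (a * (7 / 16))); first by rewrite mulr_ge0.
    have p : 0 <= 1 + T * l by rewrite lE; lra.
    rewrite nl (ger0_norm p) lE.
    have : 0 <= a * (1 - 7 / 16 - T * v * (9 / 8)) by rewrite mulr_ge0 //; lra.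
    lra.
  have -> : 32 * (a * (7 / 16)) ^+ 2 = a ^+ 2 * (49 / 8) by field.
  rewrite -mulrA ler_wpM2l ?sqr_ge0 // lE sqrrN.
  have : (T * v) ^+ 2 <= (1 / 2) ^+ 2.
    by rewrite ler_pXn2r ?nnegrE ?mulr_ge0 ?(ltW t0) ?(ltW v0).
  rewrite exprMn; have : T ^+ 2 <= 1 by rewrite expr_le1 ?(ltW t0) //; lra.
  lra.
have Tv : 2 <= T * v.
  have : 2 / T <= v by rewrite lerNr.
  by rewrite ler_pdivrMr // mulrC.
have v1 : 1 <= v by nra.
apply: (goal (a * (T * v) * (3 / 8))); first by rewrite !mulr_ge0 ?(ltW t0) ?(ltW v0).
  have p : 1 + T * l <= 0 by rewrite lE; lra.
  rewrite nl (ler0_norm p) lE.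
  have : 0 <= a * (T * v * (1 - 1 / 8 - 3 / 8) - 1) by rewrite mulr_ge0 //; lra.
  lra.
have -> : 32 * (a * (T * v) * (3 / 8)) ^+ 2 = a ^+ 2 * T ^+ 2 * (9 / 2 * v ^+ 2) by field.
apply: ler_wpM2l; first by rewrite mulr_ge0 ?sqr_ge0.
by rewrite lE sqrrN; nra.
Qed.

(** Some direction [i] carries a share [1 / n] of [\sum_i X i ^+ 2]. If [d i] is
  not close to [- bar_T^-1], the square of the gradient in that direction wins
  by [bar_coef]. If it is, then [phase_pair] makes all the other eigenvalues at
  least [(2 * bar_T)^-1], and the quadratic terms are positive one by one. *)
Lemma barrier_positive (r L : R) (r0 : 0 < r) (r1 : r <= 1) (L0 : 0 <= L) (d X W : 'I_n -> R) :
  (n%:R - 2) * pi / 2 <= \sum_i atan (d i) ->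
  r ^+ 2 <= \sum_i X i ^+ 2 -> (forall i, `|W i| <= L) ->
  0 < \sum_i (1 + d i ^+ 2)^-1 *
     ((- 1 - bar_T r L * d i + bar_B r L * d i ^+ 2) +
      bar_K r L * (- X i * (1 + bar_T r L * d i) + bar_B r L * d i * W i) ^+ 2).
Proof.
move=> phase hX hW; have t0 := bar_T_gt0 r0 L0; have N := N3; have T1 := bar_T_le r0 r1 L0.
have N0 : (0 : R) < n%:R by lra.
have q0 i : 0 < 1 + d i ^+ 2 by have := sqr_ge0 (d i); lra.
have g0 i : 0 < (1 + d i ^+ 2)^-1 by rewrite invr_gt0.
have K0 := bar_K_gt0 r0 L0.
have [i hi] : exists i, r ^+ 2 <= n%:R * X i ^+ 2.
  apply/not_existsP => h.
  have : \sum_i X i ^+ 2 < r ^+ 2; last by rewrite ltNge hX.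
  have n0 : (0 < n)%N by exact: leq_trans n3.
  have -> : r ^+ 2 = \sum_(i < n) r ^+ 2 / n%:R.
    by rewrite sumr_const card_ord -[RHS]mulr_natl mulrC divfK // gt_eqF.
  apply: ltr_sum => [|i _]; first by apply/hasP; exists (Ordinal n0); rewrite ?mem_index_enum.
  by rewrite ltr_pdivlMr // mulrC ltNge; apply/negP; exact: h.
have [good|bad] := pselect (- (2 * bar_T r L)^-1 <= d i \/ d i <= - (2 / bar_T r L)).
  have c := bar_coef r0 r1 L0 hi (hW i) good.
  have e : bar_K r L * (r ^+ 2 * bar_T r L ^+ 2 / (32 * n%:R)) = n%:R * (1 + bar_T r L) + 1.
    rewrite /bar_K; move: (bar_T r L) t0 => t t0'; field.
    by rewrite (gt_eqF t0') (gt_eqF r0) (gt_eqF N0).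
  apply: (@lt_le_trans _ _ (\sum_(j < n) - (1 + bar_T r L) +
      bar_K r L * (r ^+ 2 * bar_T r L ^+ 2 / (32 * n%:R)))).
    by rewrite e sumr_const card_ord mulNrn -(mulr_natl (1 + bar_T r L)) addKr.
  under [leRHS]eq_bigr do rewrite mulrDr.
  rewrite big_split /=; apply: lerD.
    apply: ler_sum => j _; rewrite mulrC ler_pdivlMr //.
    have B0 : 0 <= bar_B r L * d j ^+ 2 by apply: mulr_ge0 (sqr_ge0 _); apply: mulr_ge0 (sqr_ge0 _).
    have h1 : 0 <= 1 + d j ^+ 2 - d j by have := sqr_ge0 (d j - 1 / 2); lra.
    have := mulr_ge0 (ltW t0) h1; have := sqr_ge0 (d j); lra.
  rewrite (bigD1 i) //=; apply: ler_wpDr.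
    apply: sumr_ge0 => j _; apply: mulr_ge0; first exact: ltW.
    by apply: mulr_ge0 (sqr_ge0 _); exact: ltW.
  by rewrite [leRHS]mulrC -[leRHS]mulrA (ler_pM2l K0) ler_pdivlMr.
apply: (@lt_le_trans _ _ (\sum_(j < n) (1 + d j ^+ 2)^-1)).
  have n0 : (0 < n)%N by exact: leq_trans n3.
  rewrite (bigD1 (Ordinal n0)) //= ltr_pwDl // sumr_ge0 // => j _.
  exact: ltW.
apply: ler_sum => j _; rewrite ler_peMr ?(ltW (g0 j))//.
apply: ler_wpDr; first by apply: mulr_ge0 (sqr_ge0 _); exact: ltW.
rewrite /bar_B; move: (bar_T r L) bad t0 T1 => T bad t0 T1.
have di : d i < - (2 * T)^-1.
  by rewrite ltNge; apply/negP => h; apply: bad; left.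
have s1 : 1 / 2 < T * - d i.
  have <- : T * (2 * T)^-1 = 1 / 2 by field; rewrite gt_eqF.
  by rewrite (ltr_pM2l t0) ltrNr.
have [ji|ji] := eqVneq j i.
  rewrite ji -[d i]opprK; move: (- d i) s1 => v s1.
  rewrite sqrrN mulrN -mulrA -exprMn.
  move: (T * v) s1 => s s1; nra.
have p := phase_pair phase ji.
have s2 : 1 / 2 < T * d j by apply: lt_le_trans s1 _; rewrite ler_pM2l //; lra.
rewrite -mulrA -exprMn; move: (T * d j) s2 => s s2; nra.
Qed.

End BarrierAlgebra.

(** * Second-order jets along lines *)

Section Jets.
Variable R : realType.
Implicit Types (f g : R -> R) (a b c : R).

(** The second derivative test only needs derivatives along lines, and jets of
  functions of one variable compose. *)
Definition jet2 f a b c : Prop :=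
  f 0 = a /\ exists f1 : R -> R,
    [/\ \forall t \near (0 : R), is_derive (t : R) 1 f (f1 t), f1 0 = b & is_derive (0 : R) 1 f1 c].

Lemma jet2_cst a : jet2 (fun=> a) a 0 0.
Proof.
split => //; exists (fun=> 0); split => //; last exact: is_derive_cst.
by near=> t; exact: is_derive_cst.
Unshelve. all: by end_near. Qed.

Lemma jet2_affine a b : jet2 (fun t => a + t * b) a b 0.
Proof.
split; first by rewrite mul0r addr0.
exists (fun=> b); split => //; last exact: is_derive_cst.
near=> t.
have := is_deriveD (is_derive_cst a t 1) (is_deriveM (is_derive_id t (1 : R)) (is_derive_cst b t 1)).
by rewrite scaler0 !add0r [b *: 1]mulr1.
Unshelve. all: by end_near. Qed.

Lemma jet2_add f g a b c a' b' c' : jet2 f a b c -> jet2 g a' b' c' ->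
  jet2 (fun t => f t + g t) (a + a') (b + b') (c + c').
Proof.
move=> [<- [f1 [hf <- hf1]]] [<- [g1 [hg <- hg1]]]; split => //.
exists (fun t => f1 t + g1 t); split => //; last exact: is_deriveD.
by apply: filterS2 hf hg => t h1 h2; exact: is_deriveD.
Qed.

Lemma jet2_mul f g a b c a' b' c' : jet2 f a b c -> jet2 g a' b' c' ->
  jet2 (fun t => f t * g t) (a * a') (a * b' + a' * b) (a * c' + a' * c + 2 * b * b').
Proof.
move=> [<- [f1 [hf <- hf1]]] [<- [g1 [hg <- hg1]]]; split => //.
exists (fun t => f t * g1 t + g t * f1 t); split => //.
  by apply: filterS2 hf hg => t h1 h2; exact: is_deriveM.
have hf0 := nbhs_singleton hf; have hg0 := nbhs_singleton hg.
have := is_deriveD (is_deriveM hf0 hg1) (is_deriveM hg0 hf1).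
by move=> D; apply: (is_derive_eq D); rewrite /GRing.scale /=; ring.
Qed.

Lemma jet2_scale k f a b c : jet2 f a b c -> jet2 (fun t => k * f t) (k * a) (k * b) (k * c).
Proof.
move=> hf; have := jet2_mul (jet2_cst k) hf.
by rewrite !(mulr0, mul0r, addr0).
Qed.

Lemma jet2_sum (I : Type) (r : seq I) (f : I -> R -> R) (a b c : I -> R) :
  (forall i, jet2 (f i) (a i) (b i) (c i)) ->
  jet2 (fun t => \sum_(i <- r) f i t) (\sum_(i <- r) a i) (\sum_(i <- r) b i)
    (\sum_(i <- r) c i).
Proof.
move=> h; elim: r => [|i r IH].
  rewrite !big_nil; under eq_fun do rewrite big_nil; exact: jet2_cst.
rewrite !big_cons; under eq_fun do rewrite big_cons; exact: jet2_add.
Qed.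

Lemma jet2_comp (h h1 : R -> R) (h2 : R) f a b c :
  (forall y : R, is_derive y 1 h (h1 y)) -> is_derive a 1 h1 h2 -> jet2 f a b c ->
  jet2 (fun t => h (f t)) (h a) (h1 a * b) (h1 a * c + h2 * b ^+ 2).
Proof.
move=> dh dh1 [fa [f1 [hf <- hf1]]]; split; first by rewrite fa.
exists (fun t => h1 (f t) * f1 t); split; last 1 first.
- have hf0 := nbhs_singleton hf; rewrite -fa in dh1 *.
  have := is_deriveM (is_derive1_comp dh1 hf0) hf1.
  by move=> D; apply: (is_derive_eq D); rewrite /GRing.scale /=; ring.
- by apply: filterS hf => t ht; exact: is_derive1_comp.
- by rewrite fa.
Qed.

Lemma jet2_eq f a b c a' b' c' : jet2 f a b c -> a = a' -> b = b' -> c = c' ->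
  jet2 f a' b' c'.
Proof. by move=> hf <- <- <-. Qed.

Lemma jet2_id : jet2 (fun t => t) 0 1 0.
Proof.
have := jet2_affine 0 1; congr jet2.
by apply/funext => t; rewrite add0r mulr1.
Qed.

(** Jet of a quadratic form evaluated at a vector that moves linearly in [t]. *)
Lemma jet2_tilt f g h l b c b' c' m b'' c'' :
  jet2 f l b c -> jet2 g 0 b' c' -> jet2 h m b'' c'' ->
  jet2 (fun t => f t + (2 * (t * g t) + t * t * h t)) l b (c + (4 * b' + 2 * m)).
Proof.
move=> hf hg hh; have jt := jet2_id.
apply: (jet2_eq (jet2_add hf (jet2_add (jet2_scale 2 (jet2_mul jt hg))
  (jet2_mul (jet2_mul jt jt) hh)))); ring.
Qed.

(** [1 - p * (t * t)] stands for [(1 + p * (t * t))^-1]: same 2-jet, and a lower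
  bound. *)
Lemma jet2_normalise f l b c p : jet2 f l b c ->
  jet2 (fun t => f t * (1 - p * (t * t))) l b (c - 2 * p * l).
Proof.
move=> hf; have jt := jet2_id.
have := jet2_mul hf (jet2_add (jet2_cst 1) (jet2_scale (- p) (jet2_mul jt jt))).
under eq_fun do rewrite mulNr.
move=> j; apply: (jet2_eq j); ring.
Qed.

(** If [c] were negative, the derivative would be negative just to the right of
  0, and the function would decrease there. *)
Lemma jet2_min f a b c : jet2 f a b c ->
  (\forall t \near (0 : R), a <= f t) -> 0 <= c.
Proof.
move=> [fa [f1 [hf f1b hf1]]] mf; rewrite leNgt; apply/negP => c0.
have hf0 := nbhs_singleton hf.
have b0 : f1 0 = 0 by apply: (derive_at_min hf0); rewrite fa.
have C : (fun h : R => h^-1 *: (f1 (h *: 1 + 0) - f1 0)) @ 0^' --> c.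
  by case: hf1 => df <-; exact: df.
have c1 : 0 < - c by lra.
have /cvgrPdist_lt/(_ _ c1)[/= r r0 hr] := C.
have [e1 /= e10 he1] := (nbhs_normP _ _).1 hf.
have [e2 /= e20 he2] := (nbhs_normP _ _).1 mf.
pose t := Num.min r (Num.min e1 e2) / 2.
have m0 : 0 < Num.min r (Num.min e1 e2) by rewrite !lt_min r0 e10.
have t0 : 0 < t by rewrite divr_gt0.
have tm : t < Num.min r (Num.min e1 e2) by rewrite /t; lra.
have [tr te1 te2] : [/\ t < r, t < e1 & t < e2].
  by move: tm; rewrite !lt_min => /andP[-> /andP[-> ->]].
clearbody t.
have df (s : R) : s \in `[0, t] -> is_derive s 1 f (f1 s).
  rewrite in_itv /= => /andP[s0 st]; apply: he1.
  by rewrite /= sub0r normrN ger0_norm //; exact: le_lt_trans te1.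
have cf : {within `[0, t], continuous f}.
  by apply: derivable_within_continuous => s /df[].
have df' (s : R) : s \in `]0, t[ -> is_derive s 1 f (f1 s).
  by move=> st; apply: df; apply: subset_itv_oo_cc.
have [s] := @MVT R f f1 0 t t0 df' cf.
rewrite in_itv /= subr0 => /andP[s0 st] e.
have : 0 <= f t - f 0.
  by rewrite subr_ge0 fa; apply: he2; rewrite /= sub0r normrN gtr0_norm.
rewrite e pmulr_lge0 //; apply/negP; rewrite -ltNge.
have := hr s; rewrite /= sub0r normrN gtr0_norm // => /(_ (lt_trans st tr)).
rewrite gt_eqF // => /(_ isT); rewrite [s *: 1]mulr1 addr0 b0 subr0.
rewrite [_ *: _]/(_ * _) ltr_norml => /andP[+ _].
move=> h; have {}h : - - c < c - s^-1 * f1 s := h.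
have : s^-1 * f1 s < 0 by move: (s^-1 * f1 s) h => z h; lra.
by rewrite pmulr_rlt0 // invr_gt0.
Qed.

End Jets.

(** * The largest eigenvalue as a maximum of the quadratic form *)

Section TopEigenvalue.
Variables (R : realType) (n : nat).
Implicit Types (A B P : 'M[R]_n) (w : 'rV[R]_n).

Lemma rayleigh A P d w : eigenframe A P d ->
  bilin A w w <= lambda A 0 * dot w w.
Proof.
move=> AP; have [PP AE] := AP; have PP' := mulmx1C PP.
pose z := w *m P^T.
have -> : dot w w = dot z z.
  by rewrite /z dot_mulmx trmxK -mulmxA PP' mulmx1.
have -> : bilin A w w = \sum_i d 0 i * z 0 i ^+ 2.
  rewrite bilinE AE !mulmxA dot_mulmx -/z dotE.
  by apply: eq_bigr => i _; rewrite mul_mx_diag mxE expr2; ring.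
rewrite dotE mulr_sumr; apply: ler_sum => i _; rewrite -expr2.
by rewrite ler_wpM2r ?sqr_ge0 // (le_lambda0 i AP).
Qed.

Lemma row_eigenframe A P d i : eigenframe A P d -> row i P *m A = d 0 i *: row i P.
Proof.
move=> [PP ->]; rewrite !mulmxA rowE -(mulmxA _ P P^T) PP mulmx1 -rowE row_diag_mx.
by rewrite -scalemxAl -rowE.
Qed.

Lemma bilin_row A P d i : eigenframe A P d -> bilin A (row i P) (row i P) = d 0 i.
Proof.
move=> [PP ->]; rewrite bilin_rows !mulmxA PP mul1mx -mulmxA PP mulmx1.
by rewrite mxE eqxx mulr1n.
Qed.

Lemma dot_rows P i k : P *m P^T = 1%:M -> dot (row i P) (row k P) = (i == k)%:R.
Proof.
move=> PP; have := congr1 (fun M : 'M[R]_n => M i k) PP.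
rewrite !mxE => <-; rewrite dotE; apply: eq_bigr => j _; by rewrite !mxE.
Qed.

Lemma coord_unit w j : dot w w = 1 -> `|w 0 j| <= 1.
Proof.
move=> w1; rewrite -(@ler_pXn2r _ 2) ?nnegrE// expr1n real_normK ?num_real//.
rewrite -w1 dotE (bigD1 j) //= expr2 lerDl sumr_ge0 // => k _.
by rewrite -expr2 sqr_ge0.
Qed.

(** Test the quadratic form of [A] on a top eigenvector of [B]. *)
Lemma lambda0_le A B P Q a b : (0 < n)%N -> eigenframe A P a -> eigenframe B Q b ->
  lambda B 0 - lambda A 0 <= \sum_i \sum_j `|B i j - A i j|.
Proof.
move=> n0 AP BQ; have [k ek] := lambda0_eq BQ n0; have [QQ _] := BQ.
pose v := row k Q; have v1 : dot v v = 1 by rewrite dot_rows // eqxx.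
have eB : lambda B 0 = bilin B v v by rewrite (bilin_row k BQ).
have := rayleigh v AP; rewrite v1 mulr1 => h.
apply: (@le_trans _ _ (bilin B v v - bilin A v v)); first by rewrite eB lerB.
rewrite /bilin -sumrB; apply: ler_sum => i _.
rewrite -mulrBr -sumrB; apply: le_trans (ler_norm _) _.
rewrite normrM; apply: (@le_trans _ _ (1 * `|\sum_j (v 0 j * B i j - v 0 j * A i j)|)).
  by rewrite ler_wpM2r // coord_unit.
rewrite mul1r; apply: le_trans (ler_norm_sum _ _ _) _; apply: ler_sum => j _.
by rewrite -mulrBr normrM -[leRHS]mul1r ler_wpM2r // coord_unit.
Qed.

Lemma lambda0_lipschitz A B P Q a b : (0 < n)%N -> eigenframe A P a -> eigenframe B Q b ->
  `|lambda A 0 - lambda B 0| <= \sum_i \sum_j `|B i j - A i j|.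
Proof.
move=> n0 AP BQ; rewrite ler_norml lerNl opprB (lambda0_le n0 AP BQ) /=.
apply: le_trans (lambda0_le n0 BQ AP) _.
by apply: ler_sum => i _; apply: ler_sum => j _; rewrite distrC.
Qed.

End TopEigenvalue.

(** * Upper supports of the profile of the largest eigenvalue *)

Section Profile.
Variable R : realType.
Implicit Types q : R.

(** Decreasing in [q], so that lower bounds on the largest eigenvalue support it
  from above; the exponent is small enough for the Jacobi inequality. *)
Definition profile q : R := expR (- (1 / 8) * ln (1 + q ^+ 2)).
Definition profile1 q : R := profile q * (- (1 / 4) * (q / (1 + q ^+ 2))).

Lemma one_sqr_gt0 q : 0 < 1 + q ^+ 2.
Proof. by have := sqr_ge0 q; lra. Qed.

Lemma profile_gt0 q : 0 < profile q.
Proof. exact: expR_gt0. Qed.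

Lemma is_derive_one_sqr q : is_derive q 1 (fun s : R => 1 + s ^+ 2) (2 * q).
Proof.
have := is_deriveD (is_derive_cst (1 : R) q 1) (is_deriveX 2 (is_derive_id q (1 : R))).
move=> D; apply: (is_derive_eq D).
by rewrite add0r /= expr1 /GRing.scale /= mulr1.
Qed.

Lemma is_derive_profile q : is_derive q 1 profile (profile1 q).
Proof.
have D1 := @is_derive1_comp R (@ln R) (fun s => 1 + s ^+ 2) q _ _
  (is_derive1_ln (one_sqr_gt0 q)) (is_derive_one_sqr q).
have D2 := is_deriveZ (- (1 / 8)) D1.
have D3 := @is_derive1_comp R expR _ q _ _ (is_derive_expR _) D2.
apply: (is_derive_eq D3); rewrite /profile1 /profile /GRing.scale /=.
by move: (expR _) (one_sqr_gt0 q) => e q0; field; rewrite gt_eqF.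
Qed.

Lemma is_derive_profile1 q : is_derive q 1 profile1
  (profile q / (4 * (1 + q ^+ 2) ^+ 2) * (5 / 4 * q ^+ 2 - 1)).
Proof.
have q0 := one_sqr_gt0 q; have q1 : 1 + q ^+ 2 != 0 by rewrite gt_eqF.
have D1 := @is_deriveV R (fun s => 1 + s ^+ 2) q _ _ q1 (is_derive_one_sqr q).
have D2 := is_deriveM (is_derive_id q (1 : R)) D1.
have D3 := is_deriveZ (- (1 / 4)) D2.
have D4 := is_deriveM (is_derive_profile q) D3.
apply: (is_derive_eq D4); set z := (_ \*: _) q.
have {z}-> : z = - (1 / 4) * (q / (1 + q ^+ 2)) by [].
rewrite /profile1 /GRing.scale /=.
by move: (profile q) q1 => e q1; field.
Qed.

Lemma ler_profile q q' : 0 <= q -> q <= q' -> profile q' <= profile q.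
Proof.
move=> q0 qq; rewrite /profile ler_expR !mulNr lerN2 ler_pM2l; last by lra.
rewrite ler_ln ?posrE ?one_sqr_gt0// lerD2l ler_pXn2r ?nnegrE //.
exact: le_trans qq.
Qed.

End Profile.

Section LineJets.
Variables (R : realType) (n : nat) (U : set 'rV[R]_n) (u : 'rV[R]_n -> R).
Hypotheses (oU : open U) (su : smooth_on U u).
Implicit Types x y v w a b : 'rV[R]_n.

Lemma near_line_of x v (P : 'rV[R]_n -> Prop) : (\forall z \near x, P z) ->
  \forall t \near (0 : R), P (x + t *: v).
Proof.
move=> Px; have c : {for 0, continuous (fun t : R => x + t *: v)}.
  apply: continuousD; first exact: cst_continuous.
  exact: scalel_continuous.
by apply: c; rewrite scale0r addr0.
Qed.

Lemma jet2_line f x v : smooth_on U f -> U x ->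
  jet2 (fun t => f (x + t *: v)) (f x) (dd v f x) (dd v (dd v f) x).
Proof.
move=> sf Ux; split; first by rewrite scale0r addr0.
exists (fun t => dd v f (x + t *: v)); split.
- apply: filterS (near_line_of v (open_nbhs_nbhs (conj oU Ux))) => t Ut.
  exact: (smooth_line oU sf Ut).
- by rewrite scale0r addr0.
have := @smooth_line R n U oU _ x v 0 (smooth_dd oU v sf).
by rewrite scale0r addr0; apply.
Qed.

Lemma jet2_gt0 (f : R -> R) (a b c : R) : jet2 f a b c -> 0 < a -> \forall t \near (0 : R), 0 < f t.
Proof.
move=> [fa [f1 [hf _ _]]] a0; have [df _] := nbhs_singleton hf.
have cf : {for 0, continuous f}.
  by apply: differentiable_continuous; apply/derivable1_diffP.
by have /cvgrPdist_lt/(_ _ a0) := cf; apply: filterS => t; rewrite fa ltr_norml; lra.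
Qed.

(** Rayleigh quotient of the Hessian along a line, at a trial vector that tilts
  linearly from the top eigenvector: a smooth lower bound on the largest
  eigenvalue, exact at [x], where that eigenvalue itself may fail to be
  differentiable. Applied to a decreasing function it becomes an upper support. *)
Lemma upper_support x P d (o : 'I_n) v z : (0 < n)%N -> U x ->
  eigenframe (hessian u x) P d -> d 0 o = lambda (hessian u x) 0 -> 0 < d 0 o ->
  dot z (row o P) = 0 ->
  exists q : R -> R,
    jet2 q (d 0 o) (dd v (dd (row o P) (dd (row o P) u)) x)
     (dd v (dd v (dd (row o P) (dd (row o P) u))) x
       + (4 * dd v (dd (row o P) (dd z u)) x
       + 2 * bilin (hessian u x) z z - 2 * dot z z * d 0 o)) /\
    \forall t \near (0 : R),
      profile (lambda (hessian u (x + t *: v)) 0) <= profile (q t).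
Proof.
move=> n0 Ux HP dmax d0 zo; set e := row o P.
have [PP HE] := HP.
have e1 : dot e e = 1 by rewrite /e dot_rows // eqxx.
have eH : bilin (hessian u x) e e = d 0 o by rewrite (bilin_row o HP).
have ezH : bilin (hessian u x) e z = 0.
  by rewrite bilinE (row_eigenframe o HP) dotZl dotC zo mulr0.
have DH a b := dd_hessian oU su a b Ux.
have s2 a b : smooth_on U (dd a (dd b u)).
  exact (smooth_dd oU a (smooth_dd oU b su)).
pose A a b t := dd a (dd b u) (x + t *: v).
have jA a b := jet2_line v (s2 a b) Ux.
pose N t := A e e t + (2 * (t * A e z t) + t * t * A z z t).
have jez : jet2 (A e z) 0 (dd v (dd e (dd z u)) x) (dd v (dd v (dd e (dd z u))) x).
  by apply: (jet2_eq (jA e z)) => //; rewrite DH.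
have jN := jet2_tilt (jA e e) jez (jA z z).
have jq := jet2_normalise (dot z z) jN.
exists (fun t => N t * (1 - dot z z * (t * t))); split.
  apply: (jet2_eq jq) => //; first by rewrite DH.
  by rewrite !DH eH -!addrA.
have nN : \forall t \near (0 : R), 0 < N t.
  by apply: (jet2_gt0 jN); rewrite DH eH.
have nD : \forall t \near (0 : R), 0 < 1 - dot z z * (t * t).
  have := jet2_gt0 (jet2_normalise (dot z z) (jet2_cst (1 : R))) ltr01.
  by apply: filterS => t; rewrite mul1r.
apply: filterS3 nN nD (near_line oU v Ux) => t Nt Dt Ut.
apply: ler_profile; first by rewrite mulr_ge0 ?(ltW Nt) ?(ltW Dt).
have [Q [b HQ]] := hessian_eigenframe oU su Ut.
have := rayleigh (e + t *: z) HQ.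
have -> : bilin (hessian u (x + t *: v)) (e + t *: z) (e + t *: z) = N t.
  rewrite /N /A !(dd_hessian oU su _ _ Ut) !bilinE mulmxDl -scalemxAl.
  rewrite !(dotDl, dotDr, dotZl, dotZr).
  rewrite (dot_mulmx z) (hessian_sym oU su Ut) (dotC z); ring.
have -> : dot (e + t *: z) (e + t *: z) = 1 + dot z z * (t * t).
  by rewrite !(dotDl, dotDr, dotZl, dotZr) e1 (dotC e) zo; ring.
move: (lambda _ 0) (dot_ge0 z) => l; move: (dot z z) (N t) Nt Dt => p Nt Nt0 Dt p0 h.
have tt : 0 <= p * (t * t) by rewrite mulr_ge0 // -expr2 sqr_ge0.
move: (p * (t * t)) tt Dt h => s s0 Ds h.
have l0 : 0 < l by rewrite -(pmulr_lgt0 _ (_ : 0 < 1 + s)); [exact: lt_le_trans h|lra].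
nra.
Qed.

End LineJets.

(** * The barrier *)

Section Barrier.
Variables (R : realType) (n : nat) (U : set 'rV[R]_n) (u : 'rV[R]_n -> R).
Hypotheses (oU : open U) (su : smooth_on U u).
Implicit Types x y v : 'rV[R]_n.

(** With [X = x - y] this is [1 / 16 - |X| ^+ 2 / 2 - T * (X . Du - u) +
  B / 2 * |Du| ^+ 2]. Second derivatives of [X . Du - u] and [|Du| ^+ 2] contain
  third derivatives of [u] linearly only, where the first variation of the
  equation removes them. The sums are written entrywise, which is how the jets
  below are assembled. *)
Definition barrier_phi (y : 'rV[R]_n) (T B : R) x : R :=
  1 / 16 + (- (1 / 2) * (\sum_j (x 0 j - y 0 j) * (x 0 j - y 0 j))
   + (- T * (\sum_j (x 0 j - y 0 j) * partial j u x + - 1 * u x)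
   + B / 2 * (\sum_j partial j u x * partial j u x))).

Definition barrier y (T B K : R) x : R := expR (K * barrier_phi y T B x) + - 1.

(** The third derivatives [E j] are kept apart: only their weighted sums over an
  eigenframe are controlled, not each of them. *)
Lemma jet2_barrier_phi y T B x v : U x ->
  let E j := dd v (dd v (partial j u)) x in
  jet2 (fun t => barrier_phi y T B (x + t *: v)) (barrier_phi y T B x)
    (- dot (x - y) v - T * bilin (hessian u x) (x - y) v
       + B * \sum_j partial j u x * dd v (partial j u) x)
    (- dot v v - T * (bilin (hessian u x) v v + \sum_j (x 0 j - y 0 j) * E j)
       + B * (\sum_j dd v (partial j u) x ^+ 2 + \sum_j partial j u x * E j)).
Proof.
move=> Ux E.
have jx j : jet2 (fun t => (x + t *: v) 0 j - y 0 j) (x 0 j - y 0 j) (v 0 j) 0.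
  have := jet2_affine (x 0 j - y 0 j) (v 0 j); congr jet2.
  by apply/funext => t; rewrite !mxE addrAC.
have jp j := jet2_line oU v (smooth_partial j su) Ux.
have ju := jet2_line oU v su Ux.
have j1 := jet2_sum (index_enum 'I_n) (fun j => jet2_mul (jx j) (jx j)).
have j2 := jet2_sum (index_enum 'I_n) (fun j => jet2_mul (jx j) (jp j)).
have j3 := jet2_sum (index_enum 'I_n) (fun j => jet2_mul (jp j) (jp j)).
have J := jet2_add (jet2_cst (1 / 16)) (jet2_add (jet2_scale (- (1 / 2)) j1)
  (jet2_add (jet2_scale (- T) (jet2_add j2 (jet2_scale (- 1) ju)))
    (jet2_scale (B / 2) j3))).
have eV w : bilin (hessian u x) w v = \sum_j w 0 j * dd v (partial j u) x.
  apply: eq_bigr => i _; congr (_ * _); apply: eq_bigr => k _; congr (_ * _).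
  by have := congr1 (fun M : 'M[R]_n => M i k) (hessian_sym oU su Ux); rewrite !mxE => <-.
have eX : dot (x - y) v = \sum_j (x 0 j - y 0 j) * v 0 j.
  by rewrite dotE; apply: eq_bigr => j _; rewrite !mxE.
have eXV : bilin (hessian u x) (x - y) v = \sum_j (x 0 j - y 0 j) * dd v (partial j u) x.
  by rewrite eV; apply: eq_bigr => j _; rewrite !mxE.
apply: (jet2_eq J) => //.
  rewrite eX eXV !big_split /=.
  have -> : \sum_j partial j u x * v 0 j = dd v u x.
    by apply: eq_bigr => j _; rewrite mulrC.
  by move: (dd v u x) (\sum_j _) (\sum_j _) (\sum_j _) => a b c d; field.
rewrite (dd_hessian oU su _ _ Ux) {2}eV dotE !big_split /=.
have z0 (f : 'I_n -> R) : \sum_j f j * 0 = 0 by apply: big1 => j _; rewrite mulr0.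
have d2 (f g : 'I_n -> R) : \sum_j 2 * f j * g j = 2 * \sum_j f j * g j.
  by rewrite mulr_sumr; apply: eq_bigr => j _; rewrite mulrA.
rewrite !z0 !d2 -eV /E.
have -> : \sum_j dd v (partial j u) x ^+ 2 = \sum_j dd v (partial j u) x * dd v (partial j u) x.
  by apply: eq_bigr => j _; rewrite expr2.
move: (bilin _ v v) (\sum_j v 0 j * v 0 j) => a b.
move: (\sum_j (x 0 j - y 0 j) * _) (\sum_j partial j u x * _) (\sum_j dd v _ x * _) => c d e.
by field.
Qed.

Lemma jet2_barrier y T B K x v b c : jet2 (fun t => barrier_phi y T B (x + t *: v))
    (barrier_phi y T B x) b c ->
  jet2 (fun t => barrier y T B K (x + t *: v)) (barrier y T B K x)
    (K * expR (K * barrier_phi y T B x) * b)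
    (K * expR (K * barrier_phi y T B x) * (c + K * b ^+ 2)).
Proof.
move=> j; have dE (z : R) : is_derive z 1 expR (expR z) := is_derive_expR z.
have := jet2_add (jet2_comp dE (dE _) (jet2_scale K j)) (jet2_cst (- 1)).
move=> h; apply: (jet2_eq h) => //; move: (expR _) => e; ring.
Qed.

Lemma dd_partial_frame x P d i j : U x -> eigenframe (hessian u x) P d ->
  dd (row i P) (partial j u) x = d 0 i * row i P 0 j.
Proof.
move=> Ux HP.
have -> : d 0 i * row i P 0 j = (row i P *m hessian u x) 0 j.
  by rewrite (row_eigenframe i HP) [RHS]mxE.
rewrite [RHS]mxE; apply: eq_bigr => k _; congr (_ * _).
by rewrite mxE.
Qed.

Lemma sum_dot_frame (P : 'M[R]_n) (z : 'rV[R]_n) : P *m P^T = 1%:M ->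
  \sum_i dot z (row i P) ^+ 2 = dot z z.
Proof.
move=> PP; have PP' := mulmx1C PP.
have -> : dot z z = dot (z *m P^T) (z *m P^T).
  by rewrite dot_mulmx trmxK -mulmxA PP' mulmx1.
rewrite dotE; apply: eq_bigr => i _; rewrite -expr2; congr (_ ^+ 2).
by rewrite dotE mxE; apply: eq_bigr => j _; rewrite !mxE.
Qed.

(** In an eigendirection everything but the third derivatives of [u], gathered in
  the last sum, is an expression in the eigenvalue and the gradient. *)
Lemma jet2_barrier_frame x y T B K P d i : U x -> eigenframe (hessian u x) P d ->
  exists b, jet2 (fun t => barrier y T B K (x + t *: row i P)) (barrier y T B K x) b
    (K * expR (K * barrier_phi y T B x) *
      ((- 1 - T * d 0 i + B * d 0 i ^+ 2
        + K * (- dot (x - y) (row i P) * (1 + T * d 0 i)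
            + B * d 0 i * dd (row i P) u x) ^+ 2)
       + \sum_j (- T * (x 0 j - y 0 j) + B * partial j u x) *
           dd (row i P) (dd (row i P) (partial j u)) x)).
Proof.
move=> Ux HP; have [PP HE] := HP; set v := row i P.
have v1 : dot v v = 1 by rewrite dot_rows // eqxx.
have pf j := dd_partial_frame i j Ux HP.
eexists; apply: (jet2_eq (jet2_barrier K (jet2_barrier_phi y T B v Ux))) => //.
have -> : bilin (hessian u x) (x - y) v = d 0 i * dot (x - y) v.
  by rewrite bilinE dot_mulmx (hessian_sym oU su Ux) (row_eigenframe i HP) dotZr.
rewrite v1 (bilin_row i HP).
have -> : \sum_j dd v (partial j u) x ^+ 2 = d 0 i ^+ 2.
  rewrite (eq_bigr (fun j => d 0 i ^+ 2 * (v 0 j * v 0 j))).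
    by rewrite -mulr_sumr -dotE v1 mulr1.
  by move=> j _; rewrite pf -/v; ring.
have -> : \sum_j partial j u x * dd v (partial j u) x = d 0 i * dd v u x.
  by rewrite /dd mulr_sumr; apply: eq_bigr => j _; rewrite -/(dd v _ x) pf -/v; ring.
have -> : \sum_j (- T * (x 0 j - y 0 j) + B * partial j u x) * dd v (dd v (partial j u)) x
  = - T * (\sum_j (x 0 j - y 0 j) * dd v (dd v (partial j u)) x)
    + B * (\sum_j partial j u x * dd v (dd v (partial j u)) x).
  by rewrite !mulr_sumr -big_split; apply: eq_bigr => j _ /=; ring.
congr (_ * _).
move: (\sum_j _) (\sum_j _) (dot _ _) (dd v u x) => a b c e; ring.
Qed.

End Barrier.

(** * The maximum principle *)

Section InteriorMinimum.
Variables (R : realType) (n : nat) (U : set 'rV[R]_n) (u : 'rV[R]_n -> R).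
Hypotheses (oU : open U) (su : smooth_on U u).
Variable Theta : R.
Hypothesis slag : special_lagrangian_on U Theta u.
Hypothesis n3 : (3 <= n)%N.
Hypothesis phase : (n%:R - 2) * pi / 2 <= Theta.
Implicit Types x y v : 'rV[R]_n.

Lemma dd_comm3 f a b x : smooth_on U f -> U x ->
  dd b (dd b (dd a f)) x = dd a (dd b (dd b f)) x.
Proof.
move=> sf Ux; rewrite (dd_comm_in oU b b a sf Ux).
exact: (dd_comm oU b a (smooth_dd oU b sf) Ux).
Qed.

Lemma dd_comm4 f a b x : smooth_on U f -> U x ->
  dd a (dd a (dd b (dd b f))) x = dd b (dd b (dd a (dd a f))) x.
Proof.
move=> sf Ux; have C y (Uy : U y) := dd_comm3 a b sf Uy.
rewrite -(dd_eq oU a C Ux).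
by rewrite -(dd_comm3 a b (smooth_dd oU a sf) Ux).
Qed.

Section Frame.
Variables (x : 'rV[R]_n) (P : 'M[R]_n) (d : 'rV[R]_n) (o : 'I_n).
Hypotheses (Ux : U x) (HP : eigenframe (hessian u x) P d).
Hypothesis dmax : d 0 o = lambda (hessian u x) 0.

Local Notation Dv := (fun k : 'I_n => d 0 k).
Local Notation e k := (row k P).
Local Notation H i k := (dd (row o P) (dd (row i P) (dd (row k P) u)) x).

Let phaseD : (n%:R - 2) * pi / 2 <= \sum_i atan (d 0 i).
Proof. by rewrite (sum_atan_eigenframe slag Ux HP). Qed.

Let maxD k : d 0 k <= d 0 o.
Proof. by rewrite dmax (le_lambda0 k HP). Qed.

Let d0 : 0 < d 0 o. Proof. exact: phase_max_gt0 n3 phaseD maxD. Qed.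

Let symH i k : H i k = H k i.
Proof. by rewrite (dd_comm_in oU). Qed.

(** Trial direction, in eigenframe coordinates, for the second derivative along
  the eigendirection [i]. Along the top one all components tilt; along any other
  one only the component [i] does, which brings in no third derivative with
  three different indices. *)
Definition tilt_coef (i : 'I_n) : 'rV[R]_n :=
  \row_k (if k == o then 0 else if (i == o) || (k == i) then tilt Dv o k * H i k else 0).

Lemma dd_tilt i : dd (e i) (dd (e o) (dd (tilt_coef i *m P) u)) x =
  \sum_k tilt_coef i 0 k * H i k.
Proof.
have E k : dd (e i) (dd (e k) (dd (e o) u)) x = H i k.
  by rewrite (dd_comm_in oU (e i) (e k) (e o) su Ux) (dd_comm oU (e i) (e o) (smooth_dd oU (e k) su) Ux).
rewrite (dd_comm_in oU (e i) (e o) _ su Ux) mulmx_sum_row.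
rewrite (dd_dd_sum oU _ _ _ (smooth_dd oU (e o) su) Ux).
by apply: eq_bigr => k _; rewrite E.
Qed.

Lemma dot_frame_row (c c' : 'rV[R]_n) : dot (c *m P) (c' *m P) = dot c c'.
Proof. by have [PP _] := HP; rewrite dot_mulmx -mulmxA PP mulmx1. Qed.

Lemma bilin_frame_row (c : 'rV[R]_n) :
  bilin (hessian u x) (c *m P) (c *m P) = \sum_k d 0 k * c 0 k ^+ 2.
Proof.
have [PP HE] := HP; rewrite bilinE.
have -> : c *m P *m hessian u x = (c *m diag_mx d) *m P.
  by rewrite HE !mulmxA -(mulmxA _ P P^T) PP mulmx1.
rewrite dot_frame_row dotE; apply: eq_bigr => k _.
by rewrite mul_mx_diag mxE; ring.
Qed.

Lemma dot_tilt i : dot (tilt_coef i *m P) (row o P) = 0.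
Proof.
rewrite rowE dot_frame_row dotE big1 // => k _; rewrite !mxE.
by case: (k == o); rewrite ?mul0r ?andbF ?mulr0.
Qed.

(** The part of the second derivative of the upper support that comes on top of
  the fourth derivative of [u]. *)
Definition gain i : R := 4 * dd (e i) (dd (e o) (dd (tilt_coef i *m P) u)) x
  + 2 * bilin (hessian u x) (tilt_coef i *m P) (tilt_coef i *m P)
  - 2 * dot (tilt_coef i *m P) (tilt_coef i *m P) * d 0 o.

Lemma gainE i : gain i = \sum_k (4 * tilt_coef i 0 k * H i k -
  2 * tilt_coef i 0 k ^+ 2 * (d 0 o - d 0 k)).
Proof.
rewrite /gain dd_tilt bilin_frame_row dot_frame_row dotE !mulr_sumr mulr_suml.
rewrite -big_split -sumrB; apply: eq_bigr => k _ /=; ring.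
Qed.

(** At the coefficient [t] the gain [4 * t - 2 * t ^+ 2 * (d 0 o - d 0 k)] is at
  least [2 * t], by [tilt_le1]. *)
Lemma gain_term (t h : R) k : t = tilt Dv o k ->
  2 * t * h ^+ 2 <= 4 * (t * h) * h - 2 * (t * h) ^+ 2 * (d 0 o - d 0 k).
Proof.
move=> tE; have t0 := tilt_gt0 n3 phaseD maxD k; have t1 := tilt_le1 n3 phaseD maxD k.
rewrite -tE in t0 t1.
have h0 : 0 <= t * h ^+ 2 by rewrite mulr_ge0 ?sqr_ge0 ?(ltW t0).
have : 0 <= t * h ^+ 2 * (1 - t * (d 0 o - d 0 k)).
  by rewrite mulr_ge0 // subr_ge0.
move: (d 0 o - d 0 k) => s; lra.
Qed.

Lemma gain_top : \sum_(k | k != o) 2 * tilt Dv o k * H o k ^+ 2 <= gain o.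
Proof.
rewrite gainE [leRHS](bigD1 o) //=.
have -> : tilt_coef o 0 o = 0 by rewrite mxE eqxx.
rewrite expr0n /= !(mulr0, mul0r) subrr add0r.
apply: ler_sum => k ko; rewrite !mxE (negPf ko) eqxx /=.
exact: gain_term.
Qed.

Lemma gain_other i : i != o -> 2 * tilt Dv o i * H i i ^+ 2 <= gain i.
Proof.
move=> io; rewrite gainE (bigD1 i) //= big1 ?addr0.
  by rewrite !mxE (negPf io) eqxx /=; exact: gain_term.
move=> k ki; rewrite !mxE (negPf io) (negPf ki) /=.
by case: ifP => _; rewrite !(mulr0, mul0r, expr0n, subrr).
Qed.

Lemma jacobi_at :
  0 <= \sum_i (1 + d 0 i ^+ 2)^-1 * (d 0 o * (1 + d 0 o ^+ 2) *
     (dd (e i) (dd (e i) (dd (e o) (dd (e o) u))) x + gain i) -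
                     (5 / 4 * d 0 o ^+ 2 - 1) * H o i ^+ 2).
Proof.
apply: (jacobi_inequality n3 phaseD maxD (d := Dv) (H := fun i k => H i k) _ symH _ _
  gain_top gain_other) => //.
  rewrite -[RHS](first_variation oU su slag (e o) Ux HP).
  by apply: eq_bigr => i _; rewrite mulrC.
have E := second_variation oU su slag (e o) Ux HP.
transitivity (\sum_i dd (e o) (dd (e o) (dd (e i) (dd (e i) u))) x / (1 + d 0 i ^+ 2)).
  by apply: eq_bigr => i _; rewrite mulrC (dd_comm4 (e i) (e o) su Ux).
exact: E.
Qed.

End Frame.

Let shift_min (p p0 p1 p2 b b' c : R) : p = p0 -> p0 - c * b <= p1 - c * b' ->
  p1 <= p2 -> p + - c * b <= p2 + - c * b'.
Proof. by move=> -> h1 h2; rewrite !mulNr; apply: le_trans h1 _; rewrite lerD2r. Qed.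

(** Second derivative test along an eigendirection at a minimum, with the upper
  support in place of the largest eigenvalue. *)
Lemma second_order_at x P d m i y (T B K delta : R) : U x ->
  eigenframe (hessian u x) P d -> d 0 m = lambda (hessian u x) 0 -> 0 < d 0 m ->
  (\forall z \near x,
    profile (lambda (hessian u x) 0) - delta * barrier u y T B K x <=
    profile (lambda (hessian u z) 0) - delta * barrier u y T B K z) ->
  0 <= profile1 (d 0 m) *
       (dd (row i P) (dd (row i P) (dd (row m P) (dd (row m P) u))) x + gain x P d m i) +
     profile (d 0 m) / (4 * (1 + d 0 m ^+ 2) ^+ 2) * (5 / 4 * d 0 m ^+ 2 - 1) *
       dd (row i P) (dd (row m P) (dd (row m P) u)) x ^+ 2 +
     - delta * (K * expR (K * barrier_phi u y T B x) *
      ((- 1 - T * d 0 i + B * d 0 i ^+ 2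
        + K * (- dot (x - y) (row i P) * (1 + T * d 0 i)
            + B * d 0 i * dd (row i P) u x) ^+ 2)
       + \sum_j (- T * (x 0 j - y 0 j) + B * partial j u x) *
           dd (row i P) (dd (row i P) (partial j u)) x)).
Proof.
move=> Ux HP dmax d0 minF.
have n0 : (0 < n)%N by exact: leq_trans n3.
have [q [jq hq]] := upper_support oU su (row i P) n0 Ux HP dmax d0 (dot_tilt m HP i).
have [b jb] := jet2_barrier_frame oU su y T B K i Ux HP.
have jp := jet2_comp (@is_derive_profile R) (is_derive_profile1 (d 0 m)) jq.
apply: (jet2_min (jet2_add jp (jet2_scale (- delta) jb))).
apply: filterS2 hq (near_line_of (row i P) minF) => t h1 h2.
exact: shift_min (congr1 (@profile R) dmax) h2 h1.
Qed.

Let neg_sum (a b : R) : 0 <= a -> 0 < b -> 0 <= - a - b -> False.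
Proof. by move=> ? ? ?; lra. Qed.

(** At an interior minimum, average the second derivative tests along the
  eigendirections with the weights of the linearised operator. The third
  derivatives in the barrier disappear by [first_variation], the profile
  contributes a nonpositive amount by [jacobi_at], and the barrier, which is
  subtracted, a negative one by [barrier_positive]. *)
Lemma no_interior_min x y (r L delta : R) :
  0 < r -> r <= 1 -> 0 <= L -> 0 < delta -> U x ->
  r ^+ 2 <= dot (x - y) (x - y) ->
  (forall v, dot v v = 1 -> `|dd v u x| <= L) ->
  let F z := profile (lambda (hessian u z) 0)
     - delta * barrier u y (bar_T n r L) (bar_B n r L) (bar_K n r L) z in
  ~ \forall z \near x, F x <= F z.
Proof.
move=> r0 r1 L0 del0 Ux hr hL F minF.
have n0 : (0 < n)%N by exact: leq_trans n3.
have [P [d HP]] := hessian_eigenframe oU su Ux.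
have [m dmax] := lambda0_eq HP n0; move/esym in dmax.
have [PP HE] := HP.
have phaseD : (n%:R - 2) * pi / 2 <= \sum_i atan (d 0 i).
  by rewrite (sum_atan_eigenframe slag Ux HP).
have maxD k : d 0 k <= d 0 m by rewrite dmax (le_lambda0 k HP).
have d0 : 0 < d 0 m by exact: phase_max_gt0 n3 phaseD maxD.
have J := jacobi_at Ux HP dmax.
have Bp := barrier_positive n3 r0 r1 L0 phaseD (X := fun i => dot (x - y) (row i P))
  (W := fun i => dd (row i P) u x).
rewrite (sum_dot_frame (x - y) PP) in Bp.
have {}Bp := Bp hr (fun i => hL _ _).
set T := bar_T n r L in F minF Bp *; set B := bar_B n r L in F minF Bp *.
set K := bar_K n r L in F minF Bp *.
have K0 : 0 < K by exact: bar_K_gt0.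
pose l := d 0 m; pose g i := (1 + d 0 i ^+ 2)^-1.
have g0 i : 0 < g i by rewrite invr_gt0 one_sqr_gt0.
pose S i j := dd (row i P) (dd (row i P) (partial j u)) x.
pose w j := - T * (x 0 j - y 0 j) + B * partial j u x.
pose beta i := - 1 - T * d 0 i + B * d 0 i ^+ 2
        + K * (- dot (x - y) (row i P) * (1 + T * d 0 i)
            + B * d 0 i * dd (row i P) u x) ^+ 2.
pose E0 := K * expR (K * barrier_phi u y T B x).
have E00 : 0 < E0 by rewrite mulr_gt0 // expR_gt0.
pose C i := dd (row i P) (dd (row i P) (dd (row m P) (dd (row m P) u))) x.
pose Hi i := dd (row i P) (dd (row m P) (dd (row m P) u)) x.
have HiE i : dd (row m P) (dd (row m P) (dd (row i P) u)) x = Hi i.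
  exact: (dd_comm3 (row i P) (row m P) su Ux).
pose kap := profile l / (4 * (1 + l ^+ 2) ^+ 2).
have kap0 : 0 < kap.
  by rewrite divr_gt0 ?profile_gt0// mulr_gt0 // exprn_gt0 // one_sqr_gt0.
have key i : 0 <= - kap * (l * (1 + l ^+ 2) * (C i + gain x P d m i)
     - (5 / 4 * l ^+ 2 - 1) * Hi i ^+ 2)
     - delta * (E0 * (beta i + \sum_j w j * S i j)).
  have {}minF : 0 <= profile1 l * (C i + gain x P d m i)
      + kap * (5 / 4 * l ^+ 2 - 1) * Hi i ^+ 2
      + - delta * (E0 * (beta i + \sum_j w j * S i j)).
    exact: (second_order_at i Ux HP dmax d0 minF).
  move: minF; congr (0 <= _); rewrite /profile1 /kap; have := one_sqr_gt0 l.
  move: (profile l) (gain _ _ _ _ _) (C i) (Hi i) (E0 * _) => a b1 b2 b3 b4 l0.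
  by field; rewrite gt_eqF.
have S0 j : \sum_i g i * S i j = 0.
  rewrite -[RHS](first_variation oU su slag (delta_mx 0 j) Ux HP).
  have E : dd (delta_mx 0 j) u = partial j u by apply/funext => z; rewrite dd_delta.
  have SE i : S i j = dd (delta_mx 0 j) (dd (row i P) (dd (row i P) u)) x.
    by rewrite /S -E; exact: dd_comm3 su Ux.
  by apply: eq_bigr => i _; rewrite SE mulrC.
have Z0 : \sum_i g i * \sum_j w j * S i j = 0.
  under eq_bigr do rewrite mulr_sumr.
  rewrite exchange_big big1 // => j _.
  rewrite (eq_bigr (fun i => w j * (g i * S i j))) => [|i _]; last by rewrite mulrCA.
  by rewrite -mulr_sumr S0 mulr0.
have tot : 0 <= \sum_i g i * (- kap * (l * (1 + l ^+ 2) * (C i + gain x P d m i)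
     - (5 / 4 * l ^+ 2 - 1) * Hi i ^+ 2)
     - delta * (E0 * (beta i + \sum_j w j * S i j))).
  by apply: sumr_ge0 => i _; rewrite mulr_ge0 ?(ltW (g0 i)) ?key.
pose A i := l * (1 + l ^+ 2) * (C i + gain x P d m i) - (5 / 4 * l ^+ 2 - 1) * Hi i ^+ 2.
have J' : 0 <= \sum_i g i * A i.
  rewrite (eq_bigr (fun i => (1 + d 0 i ^+ 2)^-1 * (d 0 m * (1 + d 0 m ^+ 2) *
     (dd (row i P) (dd (row i P) (dd (row m P) (dd (row m P) u))) x + gain x P d m i) -
       (5 / 4 * d 0 m ^+ 2 - 1) * dd (row m P) (dd (row m P) (dd (row i P) u)) x ^+ 2))).
    exact: J.
  by move=> i _; rewrite /A -HiE.
have Bp' : 0 < \sum_i g i * beta i by apply: Bp => i; rewrite dot_rows // eqxx.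
have E : \sum_i g i * (- kap * (l * (1 + l ^+ 2) * (C i + gain x P d m i)
     - (5 / 4 * l ^+ 2 - 1) * Hi i ^+ 2)
     - delta * (E0 * (beta i + \sum_j w j * S i j))) =
   - kap * (\sum_i g i * A i) - delta * E0 * (\sum_i g i * beta i)
     - delta * E0 * (\sum_i g i * \sum_j w j * S i j).
  rewrite !mulr_sumr -!sumrB; apply: eq_bigr => i _; rewrite /A.
  move: (l * _ * _ - _) (\sum_j _) => a b; ring.
move: tot; rewrite E Z0 mulr0 subr0.
have h1 : 0 <= kap * \sum_i g i * A i by rewrite mulr_ge0 // ltW.
have h2 : 0 < delta * E0 * (\sum_i g i * beta i).
  by apply: mulr_gt0 Bp'; exact: mulr_gt0.
rewrite mulNr; exact: neg_sum h1 h2.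
Qed.

End InteriorMinimum.

(** * Compactness and continuity *)

Section Growth.
Variables (R : realType) (n : nat).
Implicit Types x y v : 'rV[R]_n.

Lemma dot_add_le x y : dot (x + y) (x + y) <= 2 * dot x x + 2 * dot y y.
Proof.
have := dot_ge0 (x - y); rewrite -scaleN1r.
by rewrite !(dotDl, dotDr, dotZl, dotZr) (dotC y x); move: (dot x x) (dot y y) (dot x y) => a b c; lra.
Qed.

Lemma compact_cball (p : 'rV[R]_n) (r : R) : compact [set x | dot (x - p) (x - p) <= r].
Proof.
apply: bounded_closed_compact; last first.
  apply: (@closed_comp _ _ (fun x => dot (x - p) (x - p)) [set s | s <= r]).
    by move=> x _; exact: continuous_dot_sub.
  exact: closed_le.
exists (1 + r + dot p p *+ 2 + r + 1); split=> [|M M1 x]; first exact: num_real.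
rewrite /= => Sx; apply: le_trans (ltW M1).
have {}Sx : dot x x <= 2 * r + 2 * dot p p.
  rewrite -[x in dot x _](subrK p) -[x in dot _ x](subrK p).
  by apply: le_trans (dot_add_le _ _) _; rewrite lerD2r ler_pM2l.
rewrite [`|x|]mx_normrE; apply/bigmax_leP; split => /= [|[i j] _].
  have := dot_ge0 x; have := dot_ge0 p; move: (dot _ _) (dot _ _) Sx => a b; lra.
have h : `|x i j| ^+ 2 <= dot x x.
  rewrite real_normK ?num_real// dotE (bigD1 j) //= ord1 expr2 lerDl sumr_ge0 // => k _.
  by rewrite -expr2 sqr_ge0.
have := dot_ge0 p; move: (dot p _) (dot x _) Sx h => a b h1 h2 a0.
move: (normr_ge0 (x i j)) h2; move: `|x i j| => c; nra.
Qed.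

Section Continuity.
Variables (U : set 'rV[R]_n) (u : 'rV[R]_n -> R).
Hypotheses (oU : open U) (su : smooth_on U u).

Lemma continuous_hessian x : U x ->
  {for x, continuous (fun z => \sum_i \sum_j `|hessian u z i j - hessian u x i j|)}.
Proof.
move=> Ux; apply: continuous_sumr => i; apply: continuous_sumr => j.
apply: (@continuous_comp _ _ _ (fun z => hessian u z i j - hessian u x i j) (fun s : R => `|s|)).
  apply: continuousB; last exact: cst_continuous.
  have -> : (fun z => hessian u z i j) = partials [:: i; j] u by apply/funext => z; rewrite mxE.
  exact (proj1 (su [:: i; j] Ux)).
exact: norm_continuous.
Qed.

Lemma continuous_lambda0 x : (0 < n)%N -> U x ->
  {for x, continuous (fun z => lambda (hessian u z) 0)}.
Proof.
move=> n0 Ux; have c := continuous_hessian Ux.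
have [P [d HP]] := hessian_eigenframe oU su Ux.
have FF : Filter (nbhs x) by exact: nbhs_filter.
apply/(@cvgrPdist_le _ _ _ (nbhs x) FF) => e e0.
have {c} := c; set S := (fun z => \sum_i _) => c.
have SE z : S z = \sum_i \sum_j `|hessian u z i j - hessian u x i j| by [].
have S0 : S x = 0.
  by rewrite SE; apply: big1 => i _; apply: big1 => j _; rewrite subrr normr0.
clearbody S; have /(@cvgrPdist_le _ _ _ (nbhs x) FF)/(_ _ e0) := c.
apply: filterS2 (open_nbhs_nbhs (conj oU Ux)) => z Uz.
have [Q [b HQ]] := hessian_eigenframe oU su Uz.
rewrite S0 sub0r normrN => /(le_trans (ler_norm _)); apply: le_trans.
by rewrite SE; exact: lambda0_lipschitz HP HQ.
Qed.

Lemma continuous_profile : continuous (@profile R).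
Proof.
move=> q; apply: differentiable_continuous; apply/derivable1_diffP.
by have [] := is_derive_profile q.
Qed.

Lemma continuous_barrier y T B K x : U x -> {for x, continuous (barrier u y T B K)}.
Proof.
move=> Ux.
have cu : {for x, continuous u} by exact: (smooth_continuous su Ux).
have cp j : {for x, continuous (partial j u)} by exact (smooth_continuous (smooth_partial j su) Ux).
have cX j : {for x, continuous (fun z : 'rV[R]_n => z 0 j - y 0 j)}.
  by apply: continuousB; [exact: coord_continuous | exact: cst_continuous].
have cc (c : R) : {for x, continuous (fun _ : 'rV[R]_n => c)} by exact: cst_continuous.
have cphi : {for x, continuous (barrier_phi u y T B)}.
  rewrite /barrier_phi.
  apply: continuousD => //; apply: continuousD.
    apply: continuousM => //; apply: continuous_sumr => j; exact: continuousM.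
  apply: continuousD; apply: continuousM => //.
    apply: continuousD; last exact: continuousM.
    by apply: continuous_sumr => j; exact: continuousM.
  by apply: continuous_sumr => j; exact: continuousM.
apply: continuousD => //.
apply: (@continuous_comp _ _ _ (fun z => K * barrier_phi u y T B z) expR).
  exact: continuousM.
exact: continuous_expR.
Qed.

End Continuity.
End Growth.

(** * Growth of the largest eigenvalue *)

Section Core.
Variables (R : realType) (n : nat).
Implicit Types x y v : 'rV[R]_n.

(** Homogeneity extends the bound from unit vectors to all vectors. *)
Lemma dd_le (u : 'rV[R]_n -> R) x (L : R) v : 0 <= L ->
  (forall w, dot w w = 1 -> `|dd w u x| <= L) -> dd v u x ^+ 2 <= L ^+ 2 * dot v v.
Proof.
move=> L0 h; have [v0|v0] := eqVneq (dot v v) 0.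
  move/eqP: v0; rewrite dot_eq0 => /eqP ->.
  by rewrite /dd big1 ?expr0n ?mulr_ge0 ?sqr_ge0 ?dot_ge0// => j _; rewrite mxE mul0r.
have vp : 0 < dot v v by rewrite lt_def v0 dot_ge0.
set c := Num.sqrt (dot v v); have c0 : 0 < c by rewrite sqrtr_gt0.
have c2 : c ^+ 2 = dot v v by rewrite sqr_sqrtr // ltW.
have w1 : dot (c^-1 *: v) (c^-1 *: v) = 1.
  by rewrite dotZl dotZr -c2; field; rewrite gt_eqF.
have := h _ w1; rewrite ddZ normrM normfV (gtr0_norm c0) mulrC ler_pdivrMr // => hv.
rewrite -c2 -exprMn -[leLHS]real_normK ?num_real//.
by rewrite ler_pXn2r ?nnegrE // mulr_ge0 // ltW.
Qed.

(** With the chosen parameters the terms in [u] and its gradient are at most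
  [1 / 64]: on the half ball the sign of the exponent is that of
  [1 / 16 - s / 2] up to this margin, negative for [s = 1 / 4] and positive for
  [s < 1 / 16]. *)
Lemma barrier_phi_bounds (u : 'rV[R]_n -> R) x y (r L : R) :
  (3 <= n)%N -> 0 < r -> r < 4^-1 -> 0 <= L -> `|u x| <= L ->
  (forall w, dot w w = 1 -> `|dd w u x| <= L) -> dot (x - y) (x - y) <= 4^-1 ->
  let s := dot (x - y) (x - y) in
  let p := barrier_phi u y (bar_T n r L) (bar_B n r L) x in
  1 / 16 - s / 2 - 1 / 64 <= p /\ p <= 1 / 16 - s / 2 + 1 / 64.
Proof.
move=> n3 r0 r4 L0 hu hd hs s /=.
have N : (3 : R) <= n%:R by rewrite (ler_nat R 3 n).
have t0 := bar_T_gt0 n3 r0 L0; have tL := bar_TL n3 r0 L0.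
rewrite /bar_B; set T := bar_T n r L in t0 tL *; set p := barrier_phi _ _ _ _ _.
have {}tL : T * L <= 1 / 1536.
  apply: le_trans tL _; rewrite ler_pdivrMr; lra.
have hX := dd_le (x - y) L0 hd.
pose D : 'rV[R]_n := \row_j partial j u x; pose g := dot D D.
have gE : g = \sum_j partial j u x * partial j u x.
  by rewrite /g dotE; apply: eq_bigr => j _; rewrite !mxE.
have hg : g <= L ^+ 2.
  have e : dd D u x = g by rewrite gE; apply: eq_bigr => j _; rewrite mxE.
  have := dd_le D L0 hd; rewrite e -/g; have : 0 <= g by exact: dot_ge0.
  by clearbody g; clear; move: g => a; have := sqr_ge0 L; move: (L ^+ 2) => b; nra.
have pE : p = 1 / 16 - s / 2 - T * (dd (x - y) u x - u x) + 8 * T ^+ 2 * g.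
  rewrite /p /barrier_phi -gE /s dotE.
  have -> : \sum_j (x - y) 0 j * (x - y) 0 j = \sum_j (x 0 j - y 0 j) * (x 0 j - y 0 j).
    by apply: eq_bigr => j _; rewrite !mxE.
  have -> : dd (x - y) u x = \sum_j (x 0 j - y 0 j) * partial j u x.
    by apply: eq_bigr => j _; rewrite !mxE.
  clear; move: (\sum_j _) (\sum_j _) g => a b c; by field.
have g0 : 0 <= g by exact: dot_ge0.
have s0 : 0 <= s by exact: dot_ge0.
have {hX} hX : `|dd (x - y) u x| <= L.
  rewrite -(@ler_pXn2r _ 2) ?nnegrE// real_normK ?num_real//.
  apply: le_trans hX _; rewrite -[leRHS]mulr1 ler_wpM2l ?sqr_ge0//.
  by apply: le_trans hs _; lra.
clear gE; rewrite {}pE; clearbody g; move: hX hu hg g0; rewrite !ler_norml.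
move: (dd _ _ _) (u x) g s0 => a b c s0 /andP[a1 a2] /andP[b1 b2] c1 c0.
clearbody T s.
have h1 : T * (a - b) <= 2 * (T * L) by nra.
have h2 : - (2 * (T * L)) <= T * (a - b) by nra.
have h3 : T ^+ 2 * c <= (T * L) ^+ 2 by rewrite exprMn ler_wpM2l // sqr_ge0.
have h4 : 0 <= T ^+ 2 * c by rewrite mulr_ge0 // sqr_ge0.
have h5 : (T * L) ^+ 2 <= T * L.
  rewrite expr2 -[leRHS]mulr1 ler_wpM2l //; last by lra.
  by rewrite mulr_ge0 // ltW.
have -> : 8 * T ^+ 2 * c = 8 * (T ^+ 2 * c) by rewrite mulrA.
move: (T * L) (T * _) (T ^+ 2 * c) ((_ * _) ^+ 2) tL h1 h2 h3 h4 h5 => e f k l; lra.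
Qed.

(** An upper bound for the barrier on the ball of radius [1 / 2] over a lower bound
  on the ball of radius [1 / 4], to the power 8 that turns [profile q] into
  [(1 + q ^+ 2)^-1]. *)
Definition growth (r L : R) : R :=
  (expR (bar_K n r L) / (expR (bar_K n r L / 64) - 1)) ^+ 8.

Variables (Theta : R) (u : 'rV[R]_n -> R).
Hypotheses (su : smooth_on (eball 0 2) u)
  (slag : special_lagrangian_on (eball 0 2) Theta u) (n3 : (3 <= n)%N)
  (phase : (n%:R - 2) * pi / 2 <= Theta).

Lemma lambda0_gt0 x : eball 0 2 x -> 0 < lambda (hessian u x) 0.
Proof.
move=> Ux; have oU : open (eball (0 : 'rV[R]_n) 2) by exact: open_eball.
have n0 : (0 < n)%N by exact: leq_trans n3.
have [P [d HP]] := hessian_eigenframe oU su Ux.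
have [m dmax] := lambda0_eq HP n0; rewrite dmax.
apply: (phase_max_gt0 n3).
  by rewrite (sum_atan_eigenframe slag Ux HP).
by move=> k; rewrite -dmax (le_lambda0 k HP).
Qed.

Lemma eball_half_sub y x : eball 0 2^-1 y -> dot (x - y) (x - y) <= 4^-1 -> eball 0 1 x.
Proof.
move=> /eballE; rewrite subr0 => /(_ ltac:(lra)) hy hx; apply/eballE; first by [].
rewrite subr0 -[x in dot x _](subrK y) -[x in dot _ x](subrK y).
apply: le_lt_trans (dot_add_le _ _) _.
move: (dot y y) (dot _ _) hy hx => a b; lra.
Qed.

Lemma profile_expn8 (q : R) : profile q ^+ 8 = (1 + q ^+ 2)^-1.
Proof.
rewrite /profile -expRM_natl mulrA.
have -> : 8%:R * - (1 / 8) = - 1 :> R by field.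
by rewrite mulN1r expRN lnK // posrE one_sqr_gt0.
Qed.

Let phi_le1 (s p : R) : 0 <= s -> p <= 1 / 16 - s / 2 + 1 / 64 -> p <= 1.
Proof. by lra. Qed.

Let le1_quarter (s : R) : s < 4^-1 -> s <= 1.
Proof. by lra. Qed.

Let phi_le0 (p : R) : p <= 1 / 16 - 4^-1 / 2 + 1 / 64 -> p <= 0.
Proof. by lra. Qed.

Let phi_ge (s p : R) : s < 4 ^- 2 -> 1 / 16 - s / 2 - 1 / 64 <= p -> 1 / 64 <= p.
Proof. by lra. Qed.

(** Subtract from the profile the barrier scaled by [delta] so that the
  difference is positive on the small ball. On the sphere of radius [1 / 2] the
  barrier is negative, and [no_interior_min] excludes a minimum in between; so
  the difference is nonnegative on the whole ball. Where the barrier is bounded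
  below, this bounds the largest eigenvalue. *)
Lemma eigenvalue_growth y (r L Lam : R) x :
  eball 0 2^-1 y -> 0 < r -> r < 4^-1 -> 0 <= L -> 0 <= Lam ->
  (forall z, eball 0 1 z -> `|u z| <= L) ->
  (forall z v, eball 0 1 z -> dot v v = 1 -> `|dd v u z| <= L) ->
  (forall z, eball y r z -> lambda (hessian u z) 0 <= Lam) ->
  eball y 4^-1 x ->
  1 + lambda (hessian u x) 0 ^+ 2 <= growth r L * (1 + Lam ^+ 2).
Proof.
move=> hy r0 r4 L0 Lam0 hu hd hL /eballE.
have oU : open (eball (0 : 'rV[R]_n) 2) by exact: open_eball.
have n0 : (0 < n)%N by exact: leq_trans n3.
have sub01 z : eball 0 1 z -> eball (0 : 'rV[R]_n) 2 z by move=> h; apply: lt_trans h _; lra.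
have r1 : r <= 1 by exact: le1_quarter.
rewrite /growth; have K0 := bar_K_gt0 n3 r0 L0.
pose eta := barrier u y (bar_T n r L) (bar_B n r L) (bar_K n r L).
have etaE z : eta z = expR (bar_K n r L * barrier_phi u y (bar_T n r L) (bar_B n r L) z) - 1.
  by [].
have bounds z (hz : dot (z - y) (z - y) <= 4^-1) := barrier_phi_bounds n3 r0 r4 L0
  (hu _ (eball_half_sub hy hz)) (fun v => hd z v (eball_half_sub hy hz)) hz.
have niM delta z := no_interior_min oU su slag n3 phase (x := z) (y := y) (delta := delta) r0 r1 L0.
set K := bar_K n r L in K0 etaE *.
have e0 : 0 < expR (K / 64) - 1 by rewrite subr_gt0 expR_gt1; lra.
move=> /(_ ltac:(lra)) hx; rewrite exprVn in hx.
(* [expR K] bounds the barrier from above, so [delta] times the barrier stays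
   below [profile Lam] *)
pose delta := profile Lam / expR K.
have delta0 : 0 < delta by rewrite divr_gt0 ?expR_gt0 ?profile_gt0.
pose F z := profile (lambda (hessian u z) 0) - delta * eta z.
suff Fge : 0 <= F x.
  have hphi : 1 / 64 <= barrier_phi u y (bar_T n r L) (bar_B n r L) x.
    have hx4 : dot (x - y) (x - y) <= 4^-1 by move: hx; move: (dot _ _) => a; lra.
    by have [h _] := bounds x hx4; exact: phi_ge hx h.
  have h : delta * (expR (K / 64) - 1) <= profile (lambda (hessian u x) 0).
    move: Fge; rewrite /F subr_ge0; apply: le_trans; rewrite ler_pM2l //.
    rewrite etaE lerD2r ler_expR ler_pM2l //; apply: le_trans hphi; lra.
  have p0 : 0 <= delta * (expR (K / 64) - 1) by rewrite mulr_ge0 // ltW.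
  move: h; rewrite -(@ler_pXn2r _ 8) ?nnegrE ?(ltW (profile_gt0 _))// profile_expn8 /delta.
  have -> : profile Lam / expR K * (expR (K / 64) - 1) =
      profile Lam * (expR K / (expR (K / 64) - 1))^-1.
    by rewrite invf_div [RHS]mulrA [RHS]mulrAC.
  rewrite exprMn profile_expn8.
  have G0 : 0 < expR K / (expR (K / 64) - 1) by rewrite divr_gt0 ?expR_gt0.
  move: (expR K / _) G0 => G G0.
  have G8 : 0 < G ^+ 8 by rewrite exprn_gt0.
  rewrite exprVn -invfM lef_pV2 ?posrE ?mulr_gt0 ?one_sqr_gt0//.
  by rewrite mulrC.
have cF z : eball 0 2 z -> {for z, continuous F}.
  move=> Uz; apply: continuousB.
    apply: (@continuous_comp _ _ _ (fun z => lambda (hessian u z) 0) (@profile R)).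
      exact (continuous_lambda0 oU su n0 Uz).
    exact: continuous_profile.
  by apply: continuousM; [exact: cst_continuous | exact (continuous_barrier su Uz)].
pose S := [set z : 'rV[R]_n | dot (z - y) (z - y) <= 4^-1].
have cS : compact S by exact: compact_cball.
have SU z : S z -> eball 0 2 z by move=> Sz; apply: sub01; exact: eball_half_sub hy Sz.
have Sx : S x by rewrite /S /=; move: hx; move: (dot _ _) => a; lra.
have cFS : {within S, continuous F}.
  by apply: continuous_in_subspaceT => z; rewrite inE => Sz; apply: cF; exact: SU.
have [z] := EVT_min_rV (ex_intro _ x Sx) cS cFS.
rewrite inE => Sz zmin; rewrite leNgt; apply/negP => Fx.
have Fz : F z < 0 by apply: le_lt_trans Fx; apply: zmin; rewrite inE.
have Uz := SU _ Sz; have lz := lambda0_gt0 Uz.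
have [phi1 phi2] := bounds _ Sz; rewrite -/K in phi1 phi2.
have zr : r ^+ 2 <= dot (z - y) (z - y).
  rewrite leNgt; apply/negP => h.
  have /hL hl : eball y r z by apply/eballE.
  have hp := ler_profile (ltW lz) hl.
  have he : eta z <= expR K.
    rewrite etaE; apply: (@le_trans _ _ (expR K)); last by [].
    apply: (@le_trans _ _ (expR (K * barrier_phi u y (bar_T n r L) (bar_B n r L) z))).
      by rewrite gerBl.
    rewrite ler_expR -[leRHS]mulr1 ler_pM2l //; exact: phi_le1 (dot_ge0 _) phi2.
  have h2 : delta * eta z <= profile Lam.
    rewrite -[leRHS](@divfK _ (expR K)) ?gt_eqF ?expR_gt0// ler_pM2l //.
  by move: Fz; rewrite /F ltNge subr_ge0 (le_trans h2 hp).
have z4 : dot (z - y) (z - y) < 4^-1.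
  rewrite lt_neqAle Sz andbT; apply/eqP => h.
  have he : eta z <= 0.
    rewrite etaE subr_le0 -[leRHS]expR0 ler_expR; apply: mulr_ge0_le0; first exact: ltW.
    by rewrite h in phi2; exact: phi_le0 phi2.
  move: Fz; rewrite /F ltNge subr_ge0 (@le_trans _ _ 0) ?(ltW (profile_gt0 _))//.
  by apply: mulr_ge0_le0 he; exact: ltW.
apply: (niM delta z) => //.
  by move=> v; apply: hd; exact: eball_half_sub hy Sz.
have h4 : (2^-1 : R) ^+ 2 = 4^-1 by rewrite expr2 -invfM -natrM.
have oz : \forall t \near z, eball y 2^-1 t.
  apply: open_nbhs_nbhs; split; first exact: open_eball.
  by apply/eballE; rewrite ?h4.
apply: filterS oz => t /eballE; rewrite h4 => /(_ ltac:(done)) /ltW St.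
by apply: zmin; rewrite inE.
Qed.

End Core.

(** * Suprema, norms and Lipschitz bounds *)

Section Suprema.
Variables (R : realType) (T : Type) (A : set T).
Implicit Types (f : T -> R) (c : R).

Lemma esup_ub f x : A x -> ((f x)%:E <= esup A f)%E.
Proof. by move=> Ax; apply: ereal_sup_ubound; exists x. Qed.

Lemma esup_le f (c : R) : (forall x, A x -> f x <= c) -> (esup A f <= c%:E)%E.
Proof. by move=> h; apply: ge_ereal_sup => _ [x Ax <-]; rewrite lee_fin h. Qed.

Lemma esup_fin f x c : A x -> (forall x, A x -> f x <= c) ->
  exists2 s : R, esup A f = s%:E & forall z, A z -> f z <= s.
Proof.
move=> Ax h; have := esup_le h; have := esup_ub f Ax.
case E : (esup A f) => [s| |] // _ _; exists s => // z Az.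
by rewrite -lee_fin -E esup_ub.
Qed.

End Suprema.

Section Norms.
Variables (R : realType) (n : nat).
Implicit Types x y v : 'rV[R]_n.

Lemma l2norm_sqr_eigenframe (A P : 'M[R]_n) d : eigenframe A P d ->
  l2norm A ^+ 2 = \sum_i d 0 i ^+ 2.
Proof.
move=> [PP E]; rewrite sqr_sqrtr; last exact: sqr_frobenius_ge0.
rewrite -/(sqr_frobenius A) -(sqr_frobenius_orthogonal A PP PP) E !mulmxA PP mul1mx -mulmxA PP mulmx1.
rewrite /sqr_frobenius; apply: eq_bigr => i _; rewrite (bigD1 i) //= big1 ?addr0.
  by rewrite mxE eqxx mulr1n.
by move=> j ji; rewrite mxE eq_sym (negPf ji) mulr0n expr0n.
Qed.

Lemma l2norm_ge0 m k (A : 'M[R]_(m, k)) : 0 <= l2norm A.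
Proof. exact: sqrtr_ge0. Qed.

Lemma lambda0_le_l2norm (A P : 'M[R]_n) d : (0 < n)%N -> eigenframe A P d ->
  lambda A 0 <= l2norm A.
Proof.
move=> n0 HP; have [m ->] := lambda0_eq HP n0.
apply: le_trans (ler_norm _) _.
rewrite -(@ler_pXn2r _ 2) ?nnegrE ?l2norm_ge0// (l2norm_sqr_eigenframe HP).
by rewrite real_normK ?num_real// (bigD1 m) //= lerDl sumr_ge0 // => i _; exact: sqr_ge0.
Qed.

(** The phase condition makes the top eigenvalue the largest in absolute value. *)
Lemma l2norm_le_lambda0 (A P : 'M[R]_n) d : (3 <= n)%N -> eigenframe A P d ->
  (n%:R - 2) * pi / 2 <= \sum_i atan (d 0 i) ->
  l2norm A <= Num.sqrt n%:R * lambda A 0.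
Proof.
move=> n3 HP phase; have n0 : (0 < n)%N by exact: leq_trans n3.
have [m dmax] := lambda0_eq HP n0.
have maxD k : d 0 k <= d 0 m by rewrite -dmax (le_lambda0 k HP).
have d0 := phase_max_gt0 n3 phase maxD; have dmin := phase_min_ge n3 phase maxD.
rewrite -(@ler_pXn2r _ 2) ?nnegrE ?l2norm_ge0//; last first.
  by rewrite mulr_ge0 ?sqrtr_ge0// dmax ltW.
rewrite (l2norm_sqr_eigenframe HP) dmax exprMn sqr_sqrtr //.
have -> : n%:R * d 0 m ^+ 2 = \sum_(i < n) d 0 m ^+ 2.
  by rewrite sumr_const card_ord mulr_natl.
apply: ler_sum => i _; move: (maxD i) (dmin i) d0; move: (d 0 i) (d 0 m) => a b; nra.
Qed.

Lemma bounded_on_cball (f : 'rV[R]_n -> R) p (r : R) :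
  (forall x, dot (x - p) (x - p) <= r -> {for x, continuous f}) ->
  exists2 c : R, 0 <= c & forall x, dot (x - p) (x - p) <= r -> `|f x| <= c.
Proof.
move=> cf; pose S := [set x : 'rV[R]_n | dot (x - p) (x - p) <= r].
have [S0|S0] := pselect (S !=set0); last first.
  by exists 0 => // x Sx; exfalso; apply: S0; exists x.
have cS : compact S by exact: compact_cball.
have cg : {within S, continuous (fun x => `|f x|)}.
  apply: continuous_in_subspaceT => x; rewrite inE => Sx.
  apply: (@continuous_comp _ _ _ f (fun s : R => `|s|)); first exact: cf.
  exact: norm_continuous.
have [c _ cmax] := EVT_max_rV S0 cS cg.
by exists `|f c| => // x Sx; apply: cmax; rewrite inE.
Qed.

Section Lipschitz.
Variables (U : set 'rV[R]_n) (u : 'rV[R]_n -> R).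
Hypotheses (oU : open U) (su : smooth_on U u).

(** The derivative is a limit of difference quotients. *)
Lemma dd_le_lipschitz x v (b : R) : U x -> dot v v = 1 ->
  (\forall z \near x, `|u z - u x| <= b * l2norm (z - x)) -> `|dd v u x| <= b.
Proof.
move=> Ux v1 hb; have [du <-] := smooth_is_derive oU v su Ux.
pose q (h : R) : R := h^-1 *: (u (h *: v + x) - u x).
have C : q @ 0^' --> 'D_v u x by exact: du.
have {}C : (fun h => `|q h|) @ 0^' --> `|'D_v u x| by exact: cvg_norm.
apply: (@closed_cvg _ _ _ _ _ (fun s : R => s <= b) (@closed_le _ b) _ _ C).
rewrite /q.
near=> h; rewrite /= normrZ normfV.
have h0 : h != 0 by near: h; exact: nbhs_dnbhs_neq.
rewrite ler_pdivrMl ?normr_gt0// mulrC.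
have -> : b * `|h| = b * l2norm (h *: v + x - x).
  by rewrite addrK l2norm_row dotZl dotZr v1 mulr1 -expr2 sqrtr_sqr.
near: h; apply: nbhs_dnbhs.
by apply: filterS (near_line_of v hb) => t; rewrite (addrC x).
Unshelve. all: by end_near. Qed.

(** Mean value theorem on the segment. *)
Lemma lipschitz_of_gradient (b : R) x z :
  (forall t : R, 0 <= t <= 1 -> U (x + t *: (z - x)) /\
     forall j, `|partial j u (x + t *: (z - x))| <= b) ->
  `|u z - u x| <= n%:R * b * l2norm (z - x).
Proof.
move=> h; pose g (t : R) := u (x + t *: (z - x)).
pose dg (t : R) := dd (z - x) u (x + t *: (z - x)).
have D (t : R) : 0 <= t <= 1 -> is_derive t 1 g (dg t).
  by move=> /h[Ut _]; exact: (smooth_line oU su Ut).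
have [||c c01] := @MVT_segment R g dg 0 1 ler01.
- by move=> t /subset_itv_oo_cc; rewrite in_itv; exact: D.
- by apply: derivable_within_continuous => t; rewrite in_itv => /D[].
have -> : g 1 = u z by rewrite /g scale1r addrC subrK.
have -> : g 0 = u x by rewrite /g scale0r addr0.
rewrite subr0 mulr1 => ->; have [_ hc] := h c ltac:(by move: c01; rewrite in_itv).
apply: le_trans (ler_norm_sum _ _ _) _.
have -> : n%:R * b * l2norm (z - x) = \sum_(j < n) l2norm (z - x) * b.
  by rewrite sumr_const card_ord -[RHS]mulr_natl; ring.
apply: ler_sum => j _; rewrite normrM; apply: ler_pM => //.
rewrite l2norm_row -sqrtr_sqr ler_wsqrtr // dotE (bigD1 j) //= expr2 lerDl.
by apply: sumr_ge0 => k _; rewrite -expr2 sqr_ge0.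
Qed.

End Lipschitz.

Lemma dot_segment_le1 x z (t : R) : dot x x <= 1 -> dot z z <= 1 -> 0 <= t <= 1 ->
  dot (x + t *: (z - x)) (x + t *: (z - x)) <= 1.
Proof.
have := dot_ge0 (z - x); rewrite -(scaleN1r x).
rewrite !(dotDl, dotDr, dotZl, dotZr) (dotC x z).
move: (dot x x) (dot z z) (dot z x) => a b c h ha hb /andP[t0 t1].
have h' : 2 * c <= a + b by lra.
have : 0 <= t * (1 - t) by apply: mulr_ge0 => //; lra.
by move: h' ha hb; nra.
Qed.

(** The norm is finite because [u] is smooth on a neighbourhood of the closed
  unit ball, which is compact; then it bounds the function and its gradient. *)
Lemma C01norm_bounds (u : 'rV[R]_n -> R) : (0 < n)%N -> smooth_on (eball 0 2) u ->
  exists c : R, [/\ C01norm (eball 0 1) u = c%:E, 0 <= c,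
    forall x, eball 0 1 x -> `|u x| <= c &
    forall x v, eball 0 1 x -> dot v v = 1 -> `|dd v u x| <= c].
Proof.
move=> n0 su; have oU : open (eball (0 : 'rV[R]_n) 2) by exact: open_eball.
have oB : open (eball (0 : 'rV[R]_n) 1) by exact: open_eball.
have sub12 x : dot (x - 0) (x - 0) <= 1 -> eball 0 2 x.
  move=> h; apply/eballE => //; apply: le_lt_trans h _; rewrite -natrX ltr1n //.
have subB x : eball 0 1 x -> dot (x - 0) (x - 0) <= 1.
  by move/eballE => /(_ ltr01); rewrite expr1n => /ltW.
have [M M0 hM] := bounded_on_cball (fun x h => smooth_continuous su (sub12 x h)).
have /choice[N hN] : forall j, exists c : R, 0 <= c /\
    forall x, dot (x - 0) (x - 0) <= 1 -> `|partial j u x| <= c.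
  move=> j; have [c c0 hc] := bounded_on_cball
    (fun x h => smooth_continuous (smooth_partial j su) (sub12 x h)).
  by exists c.
pose b := \sum_j N j.
have hb x j : dot (x - 0) (x - 0) <= 1 -> `|partial j u x| <= b.
  move=> /(proj2 (hN j)) h; apply: le_trans h _.
  by rewrite /b (bigD1 j) //= lerDl sumr_ge0 // => i _; have [] := hN i.
have B0 : eball (0 : 'rV[R]_n) 1 0.
  by apply/eballE => //; rewrite subr0 expr1n /dot mul0mx mxE.
have [a Ea ha] := esup_fin B0 (fun x h => hM x (subB x h)).
have a0 : 0 <= a by apply: le_trans (ha _ B0).
pose A := [set p : 'rV[R]_n * 'rV[R]_n | [/\ eball 0 1 p.1, eball 0 1 p.2 & p.1 != p.2]].
pose q (p : 'rV[R]_n * 'rV[R]_n) := `|u p.1 - u p.2| / l2norm (p.1 - p.2).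
have lip x z : eball 0 1 x -> eball 0 1 z -> `|u z - u x| <= n%:R * b * l2norm (z - x).
  move=> /subB hx /subB hz; apply: (lipschitz_of_gradient oU su) => t t01.
  have h : dot (x + t *: (z - x) - 0) (x + t *: (z - x) - 0) <= 1.
    by rewrite !subr0 in hx hz *; exact: dot_segment_le1.
  by split => [|j]; [exact: sub12 | exact: hb].
have npos x z : x != z -> 0 < l2norm (x - z).
  by move=> xz; rewrite l2norm_row sqrtr_gt0 lt_def dot_ge0 dot_eq0 subr_eq0 xz.
have hq p : A p -> q p <= n%:R * b.
  move=> [h1 h2 h12]; rewrite /q ler_pdivrMr ?npos//; exact: lip.
(* one pair of points, so that the supremum of the quotients is not [-oo] *)
pose e : 'rV[R]_n := 2^-1 *: delta_mx 0 (Ordinal n0).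
have ee : dot e e = 4^-1.
  rewrite dotZl dotZr dotE (bigD1 (Ordinal n0)) //= big1 => [|j j0].
    by rewrite mxE !eqxx addr0 !mulr1 -invfM -natrM.
  by rewrite mxE (negPf j0) mulr0.
have Ae : A (e, 0).
  split => //=; first by apply/eballE => //; rewrite subr0 ee expr1n; lra.
  by rewrite -dot_eq0 ee invr_eq0 pnatr_eq0.
have [l El hl] := esup_fin Ae hq.
have l0 : 0 <= l by apply: le_trans (hl _ Ae); rewrite divr_ge0 ?l2norm_ge0.
exists (a + l); split.
- by rewrite /C01norm /lipschitz_const -/A -/q Ea El.
- exact: addr_ge0.
- by move=> x /ha h; apply: le_trans h _; rewrite lerDl.
move=> x v Bx v1; apply: (@le_trans _ _ l); last by rewrite lerDr.
apply: (dd_le_lipschitz oU su) v1 _; first by exact: sub12 (subB _ Bx).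
apply: filterS (open_nbhs_nbhs (conj oB Bx)) => z Bz.
have [->|zx] := eqVneq z x; first by rewrite !subrr normr0 mulr_ge0 ?l2norm_ge0.
by rewrite -ler_pdivrMr ?npos//; exact: (hl (z, x)).
Qed.

End Norms.

(** * The two estimates *)

Section Conclusion.
Variables (R : realType) (n : nat).
Hypothesis n3 : (3 <= n)%N.

Definition a1_exponent : R := 1 - 4 / (Num.sqrt (4 * n%:R + 1) + 1).

Lemma exponent_gt0 : 0 < a1_exponent.
Proof.
have N : (3 : R) <= n%:R by rewrite (ler_nat R 3 n).
have h : (3 : R) < Num.sqrt (4 * n%:R + 1).
  have -> : (3 : R) = Num.sqrt (3 ^+ 2) by rewrite sqrtr_sqr ger0_norm.
  by rewrite ltr_sqrt; lra.
rewrite /a1_exponent subr_gt0 ltr_pdivrMr; last by lra.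
by rewrite mul1r; lra.
Qed.

Lemma a1E (H : 'M[R]_n) : a1 H = expR (a1_exponent / 2 * ln (1 + lambda H 0 ^+ 2)).
Proof.
rewrite /a1 -/a1_exponent; congr expR; have p0 := one_sqr_gt0 (lambda H 0).
have s0 : 0 < Num.sqrt (1 + lambda H 0 ^+ 2) by rewrite sqrtr_gt0.
rewrite -[in RHS](sqr_sqrtr (ltW p0)) lnXn //.
by move: (ln _) a1_exponent => a m; field.
Qed.

Lemma a1_ge1 (H : 'M[R]_n) : 1 <= a1 H.
Proof.
rewrite a1E -[leLHS]expR0 ler_expR mulr_ge0 //; first by rewrite divr_ge0 // ltW // exponent_gt0.
by rewrite ln_ge0 // lerDl sqr_ge0.
Qed.

Lemma quarter_balls (x y : 'rV[R]_n) (r : R) : r < 4^-1 -> eball y r x -> eball y 4^-1 x.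
Proof. by move=> r4 h; exact: lt_trans h r4. Qed.

Section Estimates.
Variables (Theta : R) (u : 'rV[R]_n -> R).
Hypotheses (su : smooth_on (eball 0 2) u)
  (slag : special_lagrangian_on (eball 0 2) Theta u)
  (phase : (n%:R - 2) * pi / 2 <= Theta).
Variables (y : 'rV[R]_n) (r c : R).
Hypotheses (hy : eball 0 2^-1 y) (r0 : 0 < r) (r4 : r < 4^-1) (c0 : 0 <= c)
  (hu : forall x, eball 0 1 x -> `|u x| <= c)
  (hd : forall x v, eball 0 1 x -> dot v v = 1 -> `|dd v u x| <= c).

Local Notation lam x := (lambda (hessian u x) 0).
Local Notation G := (growth n r c).

Let grow (Lam : R) x : 0 <= Lam -> (forall z, eball y r z -> lam z <= Lam) ->
  eball y 4^-1 x -> 1 + lam x ^+ 2 <= G * (1 + Lam ^+ 2).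
Proof. by move=> L0 hL hx; exact: (eigenvalue_growth su slag n3 phase hy r0 r4 c0 L0). Qed.

Let center (s : R) : 0 < s -> eball y s y.
Proof. by move=> s0; apply/eballE => //; rewrite subrr /dot mul0mx mxE exprn_gt0. Qed.

Lemma in_eball2 x : eball y 4^-1 x -> eball 0 2 x.
Proof.
move=> /eballE => /(_ ltac:(lra)) h.
have /eballE h1 : eball (0 : 'rV[R]_n) 1 x.
  by apply: (eball_half_sub hy); rewrite exprVn in h; move: (dot _ _) h => a; lra.
by apply/eballE => //; apply: lt_trans (h1 _) _ => //; lra.
Qed.

Let lam_gt0 x : eball y 4^-1 x -> 0 < lam x.
Proof. by move=> /in_eball2 Ux; exact: (lambda0_gt0 su slag n3 phase Ux). Qed.

(** A bound [s] for [a1] on the small ball is a bound [E] for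
  [1 + l ^+ 2] with [E] the power [2 / a1_exponent] of [s]; [eigenvalue_growth]
  carries it to the larger ball, and raising to the power [a1_exponent / 2]
  returns to [a1]. *)
Lemma a1_growth (s : R) x : (forall z, eball y r z -> a1 (hessian u z) <= s) ->
  eball y 4^-1 x -> a1 (hessian u x) <= expR (a1_exponent / 2 * ln G) * s.
Proof.
move=> hs hx; have M0 : 0 < a1_exponent / 2 by rewrite divr_gt0 // exponent_gt0.
have s0 : 0 < s.
  by apply: lt_le_trans (hs _ (center r0)); apply: lt_le_trans (a1_ge1 _).
pose E := expR (ln s / (a1_exponent / 2)).
have hE z : eball y r z -> 1 + lam z ^+ 2 <= E.
  move=> /hs; rewrite a1E -ler_ln ?posrE ?expR_gt0// expRK => h.
  by rewrite -ler_ln ?posrE ?expR_gt0 ?one_sqr_gt0// expRK ler_pdivlMr // mulrC.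
have E1 : 0 <= E - 1.
  rewrite subr_ge0; apply: le_trans (hE _ (center r0)).
  by rewrite lerDl sqr_ge0.
pose Lam := Num.sqrt (E - 1); have LamE : 1 + Lam ^+ 2 = E.
  by rewrite sqr_sqrtr // addrC subrK.
have h : 1 + lam x ^+ 2 <= G * E.
  rewrite -LamE; apply: grow hx; first exact: sqrtr_ge0.
  move=> z Bz; have lz := lam_gt0 (quarter_balls r4 Bz).
  rewrite -(@ler_pXn2r _ 2) ?nnegrE ?sqrtr_ge0 ?(ltW lz)//.
  by have := hE _ Bz; rewrite -LamE lerD2l.
have G0 : 0 < G.
  have : 0 < G * E by apply: lt_le_trans h; exact: one_sqr_gt0.
  by rewrite pmulr_lgt0 // expR_gt0.
rewrite a1E -{1}(lnK s0) -expRD ler_expR.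
have -> : a1_exponent / 2 * ln G + ln s = a1_exponent / 2 * (ln G + ln s / (a1_exponent / 2)).
  by rewrite mulrDr (mulrC _ (ln s / _)) divfK // gt_eqF.
rewrite ler_pM2l //; apply: le_trans (_ : ln (G * E) <= _).
  by rewrite ler_ln ?posrE ?one_sqr_gt0// mulr_gt0 // expR_gt0.
by rewrite lnM ?posrE ?expR_gt0// expRK.
Qed.

(** The Frobenius norm of the Hessian and its largest eigenvalue are
  comparable, so [eigenvalue_growth] passes from one to the other. *)
Lemma hessian_growth (s : R) x : (forall z, eball y r z -> l2norm (hessian u z) <= s) ->
  eball y 4^-1 x ->
  l2norm (hessian u x) <= Num.sqrt n%:R * Num.sqrt (G * (1 + s ^+ 2)).
Proof.
move=> hs hx; have n0 : (0 < n)%N by exact: leq_trans n3.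
have oU : open (eball (0 : 'rV[R]_n) 2) by exact: open_eball.
have s0 : 0 <= s by apply: le_trans (hs _ (center r0)); exact: l2norm_ge0.
have Ux := in_eball2 hx; have [P [d HP]] := hessian_eigenframe oU su Ux.
have phase' : (n%:R - 2) * pi / 2 <= \sum_i atan (d 0 i).
  by rewrite (sum_atan_eigenframe slag Ux HP).
apply: le_trans (l2norm_le_lambda0 n3 HP phase') _.
rewrite ler_wpM2l ?sqrtr_ge0// -[leLHS]ger0_norm; last by exact: ltW (lam_gt0 hx).
rewrite -sqrtr_sqr ler_wsqrtr //; apply: (@le_trans _ _ (1 + lam x ^+ 2)).
  by rewrite lerDr.
apply: grow hx => // z Bz; apply: le_trans (hs _ Bz).
have [Q [b HQ]] := hessian_eigenframe oU su (in_eball2 (quarter_balls r4 Bz)).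
exact: lambda0_le_l2norm n0 HQ.
Qed.

(** The small ball lies in a compact subset of the domain. *)
Lemma hessian_bounded : exists s : R, forall z, eball y r z -> l2norm (hessian u z) <= s.
Proof.
have n0 : (0 < n)%N by exact: leq_trans n3.
have oU : open (eball (0 : 'rV[R]_n) 2) by exact: open_eball.
have sub x : dot (x - y) (x - y) <= 4^-1 -> eball 0 2 x.
  move=> /(eball_half_sub hy)/eballE h1.
  by apply/eballE => //; apply: lt_trans (h1 _) _ => //; lra.
have [b b0 hb] := bounded_on_cball (fun x h => continuous_lambda0 oU su n0 (sub x h)).
exists (Num.sqrt n%:R * b) => z /(quarter_balls r4) hz.
have Uz := in_eball2 hz; have [P [d HP]] := hessian_eigenframe oU su Uz.
have phase' : (n%:R - 2) * pi / 2 <= \sum_i atan (d 0 i).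
  by rewrite (sum_atan_eigenframe slag Uz HP).
apply: le_trans (l2norm_le_lambda0 n3 HP phase') _.
rewrite ler_wpM2l ?sqrtr_ge0//; apply: le_trans (ler_norm _) _; apply: hb.
move/eballE: hz => /(_ ltac:(lra)); rewrite exprVn; move: (dot _ _) => a; lra.
Qed.

End Estimates.
End Conclusion.

Theorem proposition5p1 (R : realType) (n : nat) (hn : (3 <= n)%N) :
  exists (C1 : R -> \bar R -> R) (C2 : R -> \bar R -> \bar R -> R),
  forall (Theta : R) (u : 'rV[R]_n -> R),
    (n%:R - 2) * pi / 2 <= Theta < n%:R * pi / 2 ->
    smooth_on (eball 0 2) u ->
    special_lagrangian_on (eball 0 2) Theta u ->
  forall (y : 'rV[R]_n) (r : R),
    eball 0 2^-1 y -> 0 < r < 4^-1 ->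
    (esup (eball y 4^-1) (fun x => a1 (hessian u x))
       <= (C1 r (C01norm (eball 0 1) u))%:E
          * esup (eball y r) (fun x => a1 (hessian u x)))%E
    /\
    (esup (eball y 4^-1) (fun x => l2norm (hessian u x))
       <= (C2 r (C01norm (eball 0 1) u)
             (esup (eball y r) (fun x => l2norm (hessian u x))))%:E)%E.
Proof.
exists (fun r c => expR (a1_exponent R n / 2 * ln (growth n r (fine c)))).
exists (fun r c s => Num.sqrt n%:R * Num.sqrt (growth n r (fine c) * (1 + fine s ^+ 2))).
move=> Theta u /andP[phase _] su slag y r hy /andP[r0 r4].
have n0 : (0 < n)%N by exact: leq_trans hn.
have [c [-> c0 hu hd]] := C01norm_bounds n0 su.
have yr : eball y r y.
  by apply/eballE => //; rewrite subrr /dot mul0mx mxE exprn_gt0.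
split; last first.
  have [b hb] := hessian_bounded hn su slag phase hy r4.
  have [s -> hs] := esup_fin yr hb.
  by apply: esup_le => x hx; exact: (hessian_growth hn su slag phase hy r0 r4 c0 hu hd hs hx).
have := esup_ub (fun x => a1 (hessian u x)) yr.
case E : (esup (eball y r) _) => [s| |] // _; last first.
  by rewrite gt0_muley ?lte_fin ?expR_gt0// leey.
rewrite -EFinM; apply: esup_le => x hx.
have hs z : eball y r z -> a1 (hessian u z) <= s.
  by move=> Bz; rewrite -lee_fin -E; exact: (esup_ub (fun x => a1 (hessian u x)) Bz).
exact: (a1_growth hn su slag phase hy r0 r4 c0 hu hd hs hx).
Qed.
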